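(* (i) Let $F\in\mathcal{S}^{\sharp\flat}_{1/\sqrt3}$. Then the GRH for $F$ is equivalent to the equation $$\mathrm{Re}(\lambda_F(1))=16\int_0^\infty\frac{x}{(4x^2+1)^2}N_F(x)\,dx,$$ and it is also equivalent to the equation $$\mathrm{Re}(\lambda_F(1))=\sum_{\rho=\sigma+i\gamma\in Z(F)}\left(1-\frac{4\gamma^2-1}{4\gamma^2+1}\right)=\sum_{\rho=\sigma+i\gamma\in Z(F)}\frac{2}{4\gamma^2+1}.$$ (ii) Let $F\in\mathcal{S}^{\sharp\flat}_{\sqrt6}$. Then the GRH for $F$ is also equivalent to the equation $$\mathrm{Re}(\lambda_F(2))=64\int_0^\infty\frac{x(4x^2-1)}{(4x^2+1)^3}N_F(x)\,dx,$$ and to the equation $$\mathrm{Re}(\lambda_F(2))=\sum_{\rho=\sigma+i\gamma\in Z(F)}\left(1-T_2\left(\frac{4\gamma^2-1}{4\gamma^2+1}\right)\right)=\sum_{\rho=\sigma+i\gamma\in Z(F)}\frac{32\gamma^2}{(4\gamma^2+1)^2}.$$ Zeros are counted with multiplicity.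
   Context: Let $\mathcal{S}^{\sharp\flat}$ be the class of functions $F$ satisfying: (i) $F(s)=\sum_{n\ge1}a_F(n)n^{-s}$ converges absolutely for $\mathrm{Re}(s)>1$; (ii) there is an integer $m\ge0$ such that $(s-1)^mF(s)$ is entire of finite order, the smallest such $m$ being denoted $m_F$; (iii') $\xi_F(s)=w\,\overline{\xi_F(1-\bar s)}$, where $\xi_F(s)=s^{m_F}(1-s)^{m_F}F(s)Q_F^{s}\prod_{j=1}^r\Gamma(\lambda_js+\mu_j)$ with $Q_F>0$, $r\ge0$, $\lambda_j>0$, $|w|=1$, $\mathrm{Re}\,\mu_j>-1/4$, $\mathrm{Re}(\lambda_j+2\mu_j)>0$; (v') $\frac{F'}{F}(s)=-\sum_{n\ge2}c_F(n)n^{-s}$ with absolute convergence for $\mathrm{Re}(s)>1$. The non-trivial zeros of $F$ are the zeros of $\xi_F$; their set (with multiplicities) is $Z(F)$. The GRH for $F$ is the statement that every $\rho\in Z(F)$ has $\mathrm{Re}\,\rho=1/2$. For $t>0$, $\mathcal{S}^{\sharp\flat}_t$ is the set of $F\in\mathcal{S}^{\sharp\flat}$ such that every $\rho\in Z(F)$ with $\mathrm{Re}\,\rho\ne1/2$ satisfies $|\mathrm{Im}\,\rho|>t$ (in particular $0\notin Z(F)$). For $F$ with $0\notin Z(F)$ and a nonzero integer $n$, the generalized Li coefficient is $\lambda_F(n)=\lim_{T\to\infty}\sum_{\rho\in Z(F),\,|\mathrm{Im}\rho|\le T}\left(1-(1-1/\rho)^n\right)$. For $x\ge0$, $N_F(x)$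 is the number of $\rho\in Z(F)$ (with multiplicity) with $|\mathrm{Im}\,\rho|\le x$. $T_2(x)=2x^2-1$ is the second Chebyshev polynomial of the first kind. *)

(* Defs.v *)
From HB Require Import structures.
From mathcomp Require Import all_boot all_order all_algebra.
From mathcomp Require Import all_classical all_reals all_analysis.
From mathcomp Require Import complex.

Set Implicit Arguments.
Unset Strict Implicit.
Unset Printing Implicit Defensive.

Import Order.TTheory GRing.Theory Num.Theory.
Import numFieldNormedType.Exports.
Import ComplexField.Normc.

Local Open Scope classical_set_scope.
Local Open Scope ring_scope.
Local Open Scope complex_scope.

(* The topology on R[i] is the one of the normed space R[i]^o over itself.   *)
(* Its library norm is R[i]-valued; [normc] is the R-valued modulus.         *)

Section ComplexFunctions.
Context {R : realType}.
Local Notation C := R[i].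

Definition cexp (z : C) : C :=
  (expR (complex.Re z) * cos (complex.Im z)) +i*
  (expR (complex.Re z) * sin (complex.Im z)).

(* x ^ s, meaningful for x > 0 *)
Definition cpow (x : R) (s : C) : C := cexp ((ln x)%:C * s).

(* Euler's limit  n! n^z / (z (z + 1) ... (z + n)), valid for every z other  *)
(* than 0, -1, -2, ...; the values at these poles are meaningless.           *)
Definition cGamma (z : C) : C :=
  lim ((fun n : nat => (n`!%:R * cpow n%:R z
                        / \prod_(0 <= k < n.+1) (z + k%:R)) : C^o) @ \oo).

Definition holomorphic_at (f : C -> C) (z : C) : Prop :=
  derivable (f : C^o -> C^o) z 1.

Definition entire (f : C -> C) : Prop := forall z, holomorphic_at f z.

Definition finite_order (f : C -> C) : Prop :=
  exists A r0 : R, forall z : C,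
    r0 <= normc z -> normc (f z) <= expR (normc z `^ A).

(* f has a zero of exact multiplicity k at rho (k = 0: no zero), removable   *)
(* singularities of f being removed: the value f rho plays no role.          *)
Definition vanishing_order (f : C -> C) (rho : C) (k : nat) : Prop :=
  exists g : C -> C,
    [/\ \forall z \near (rho : C^o), holomorphic_at g z,
        g rho != 0
      & \forall z \near (rho : C^o)^', f z = (z - rho) ^+ k * g z].

Definition dirichlet_abs_sum (n0 : nat) (a : nat -> C) (s v : C) : Prop :=
  (\sum_(n0 <= n <oo) (normc (a n * cpow n%:R (- s)))%:E < +oo)%E /\
  (fun k : nat => (\sum_(n0 <= n < k) a n * cpow n%:R (- s)) : C^o) @ \oo
    --> (v : C^o).

(* (s - 1) ^ m F(s) is entire of finite order; the value of F at the possible *)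
(* pole 1 is ignored.                                                        *)
Definition pole_cancelled (F : C -> C) (m : nat) : Prop :=
  exists G : C -> C,
    [/\ entire G, finite_order G
      & forall s, s != 1 -> G s = (s - 1) ^+ m * F s].

Definition completed (F : C -> C) (m : nat) (Q : R) (r : nat)
    (lam : 'I_r -> R) (mu : 'I_r -> C) (s : C) : C :=
  s ^+ m * (1 - s) ^+ m * F s * cpow Q s *
  \prod_(j < r) cGamma ((lam j)%:C * s + mu j).

(* the points where the formula [completed] can be read literally            *)
Definition completed_regular (r : nat) (lam : 'I_r -> R) (mu : 'I_r -> C)
    (s : C) : Prop :=
  s != 1 /\ forall (j : 'I_r) (k : nat), (lam j)%:C * s + mu j != - k%:R.

Definition chebyshev_T2 (x : R) : R := 2 * x ^+ 2 - 1.

End ComplexFunctions.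

(* The functional equation is an identity of meromorphic functions, hence    *)
(* required away from the isolated points where [completed] is not literal.  *)
(* [sf_nonvanishing] is part of the identity F'/F = - sum c_F(n) n^-s, made  *)
(* explicit because division by zero is total here.                          *)
Record selberg_sf (R : realType) := SelbergSF {
  sf_fun :> R[i] -> R[i];
  sf_a : nat -> R[i];
  sf_c : nat -> R[i];
  sf_m : nat;
  sf_Q : R;
  sf_r : nat;
  sf_lam : 'I_sf_r -> R;
  sf_mu : 'I_sf_r -> R[i];
  sf_w : R[i];
  sf_dirichlet : forall s : R[i], 1 < complex.Re s ->
    dirichlet_abs_sum 1 sf_a s (sf_fun s);
  sf_continuation : pole_cancelled sf_fun sf_m;
  sf_m_min : forall m, pole_cancelled sf_fun m -> (sf_m <= m)%N;
  sf_Q_gt0 : 0 < sf_Q;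
  sf_lam_gt0 : forall j, 0 < sf_lam j;
  sf_mu_gt : forall j, - 4^-1 < complex.Re (sf_mu j);
  sf_lam_mu_gt0 : forall j, 0 < sf_lam j + 2 * complex.Re (sf_mu j);
  sf_w_unit : normc sf_w = 1;
  sf_functional_equation : forall s : R[i],
    let xi := completed sf_fun sf_m sf_Q sf_lam sf_mu in
    completed_regular sf_lam sf_mu s ->
    completed_regular sf_lam sf_mu (1 - conjc s) ->
    xi s = sf_w * conjc (xi (1 - conjc s));
  sf_nonvanishing : forall s : R[i], 1 < complex.Re s -> sf_fun s != 0;
  sf_log_derivative : forall s : R[i], 1 < complex.Re s ->
    dirichlet_abs_sum 2 sf_c s
      (- (derive1 (sf_fun : R[i]^o -> R[i]^o) s / sf_fun s))
}.

Section Zeros.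
Context {R : realType}.
Local Notation C := R[i].
Variable F : selberg_sf R.

Definition sf_xi : C -> C :=
  completed F (sf_m F) (sf_Q F) (@sf_lam R F) (@sf_mu R F).

Definition zero_mult (rho : C) : nat :=
  xget 0%N [set k | vanishing_order sf_xi rho k].

(* underlying set of the multiset Z(F) *)
Definition nontrivial_zeros : set C := [set rho | (0 < zero_mult rho)%N].

Definition GRH : Prop :=
  forall rho, nontrivial_zeros rho -> complex.Re rho = 2^-1.

Definition zero_free_upto (t : R) : Prop :=
  forall rho, nontrivial_zeros rho -> complex.Re rho != 2^-1 ->
    t < `|complex.Im rho|.

Definition zeros_upto (T : R) : set C :=
  nontrivial_zeros `&` [set rho | `|complex.Im rho| <= T].

(* N_F(x), as an extended real *)
Definition zero_count (x : R) : \bar R :=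
  (\esum_(rho in zeros_upto x) (zero_mult rho)%:R%:E)%E.

(* sum over Z(F), with multiplicity, of a nonnegative function of gamma      *)
Definition sum_zeros_im (f : R -> R) : \bar R :=
  (\esum_(rho in nontrivial_zeros)
     ((zero_mult rho)%:R * f (complex.Im rho))%:E)%E.

Definition li_partial (n : int) (T : R) : C :=
  \sum_(rho \in zeros_upto T) (zero_mult rho)%:R * (1 - (1 - rho^-1) ^ n).

(* Complex limit computed coordinatewise: this is the limit of li_partial    *)
(* in R[i] whenever that limit exists.                                       *)
Definition li_coeff (n : int) : C :=
  lim (complex.Re (li_partial n T) @[T --> +oo]) +i*
  lim (complex.Im (li_partial n T) @[T --> +oo]).

End Zeros.

(* Main.v *)
(** The zeros of [F] are invariant under [rho |-> 1 - conj rho], which fixes the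
    ordinate [gamma], so [Re lambda_F(n)] is the sum over the zeros of the paired
    term [p(rho) = Re (h(rho) + h(1 - conj rho)) / 2], [h(rho) = 1 - (1 - 1/rho)^n].
    For [n = 1, 2], and [gamma] above the stated threshold off the critical line,
    [0 <= p(rho) <= q(gamma)], where [q(gamma)] is the value of [p] at
    [1/2 + i gamma], with equality only if [Re rho = 1/2]. Once the sum of the
    [q(gamma)] is known to be finite, equality of the two sums is therefore
    equivalent to GRH; Tonelli's theorem turns the second sum into an integral
    against [N_F].

    Finiteness follows from [sum 1 / (1 + gamma^2) < oo], and for this it is
    enough that [G = (s - 1)^m F] grows polynomially in vertical strips. On a line
    far to the left this comes from the functional equation, where the ratio of
    the Gamma factors is controlled termwise in Euler's product; in between, from
    a Phragmen-Lindelof argument, as [G] has finite order. A Jensen type estimate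
    around [2 + i T], together with a lower bound of [|F|] on [Re s = 2] extracted
    from [F'/F], then gives [O(log T)] zeros of height about [T]. Only the
    maximum modulus principle is needed from complex analysis; it is derived from
    Goursat's theorem. *)
Require Import Defs.
From mathcomp Require Import all_boot all_order all_algebra.
From mathcomp Require Import all_classical all_reals all_analysis.
From mathcomp Require Import complex.
From mathcomp Require Import measurable_realfun ring lra.
Import Order.TTheory GRing.Theory Num.Theory.
Import numFieldNormedType.Exports.
Import ComplexField.Normc.
Local Open Scope classical_set_scope.
Local Open Scope ring_scope.
Local Open Scope complex_scope.

Set Implicit Arguments.
Unset Strict Implicit.
Unset Printing Implicit Defensive.

(** * Modulus, exponential and complex derivatives *)

Section Modulus.
Context {R : realType}.
Local Notation C := R[i].
Local Notation Re := complex.Re.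
Local Notation Im := complex.Im.
Implicit Types (z w : C) (x : R).

(** On the critical line [1 - 1/rho] lies on the unit circle, with real part
    [(4 gamma^2 - 1) / (4 gamma^2 + 1)]: hence [q = 1 - T_n] of that number, and the kernels
    integrated against [N_F] are [- q'], which is where 16 and 64 come from. Finiteness of the sum
    of the [q(gamma)] is what gives the equations content: if both sides could be infinite, their
    equality would say nothing about individual zeros. The analytic half is shaped by three choices.
    Integrals are increments of primitives, so that every estimate of an integral is an instance of
    the mean value theorem. Contours are boundaries of rectangles and integrands are entire; circles
    are reached by substituting the exponential. Multiplicities enter as bounds
    [|G z| <= A |z - rho|^k], so that auxiliary functions are checked to be entire directly, point
    by point. What is used about Gamma (the recurrence, a local lower bound for its modulus, a
    comparison along horizontal lines) is read off Euler's limit. *)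

Lemma normc_sqrtE z : normc z = Num.sqrt (Re z ^+ 2 + Im z ^+ 2).
Proof. by case: z. Qed.

Lemma normcR x : normc x%:C = `|x|.
Proof. by rewrite normc_sqrtE /= expr0n addr0 sqrtr_sqr. Qed.

Lemma normr_normc z : `|z| = (normc z)%:C.
Proof. by rewrite normc_def normc_sqrtE. Qed.

Lemma normc_ge0 z : 0 <= normc z.
Proof. by rewrite normc_sqrtE sqrtr_ge0. Qed.

Lemma normc_sqr z : normc z ^+ 2 = Re z ^+ 2 + Im z ^+ 2.
Proof. by rewrite normc_sqrtE sqr_sqrtr // addr_ge0 ?sqr_ge0. Qed.

Lemma normc_eq0 z : (normc z == 0) = (z == 0).
Proof. by apply/eqP/eqP => [/eq0_normc //|->]; rewrite normcR normr0. Qed.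

Lemma normc_gt0 z : (0 < normc z) = (z != 0).
Proof. by rewrite lt_neqAle normc_ge0 andbT eq_sym normc_eq0. Qed.

Lemma normcX z n : normc (z ^+ n) = normc z ^+ n.
Proof.
elim: n => [|n IH]; first by rewrite !expr0 normcR normr1.
by rewrite !exprS normcM IH.
Qed.

Lemma normc_prod (I : Type) (s : seq I) (P : pred I) (f : I -> C) :
  normc (\prod_(i <- s | P i) f i) = \prod_(i <- s | P i) normc (f i).
Proof.
apply: (big_morph (fun z : C => normc z)); first exact: normcM.
by rewrite normcR normr1.
Qed.

Lemma normc_sum (I : Type) (s : seq I) (P : pred I) (f : I -> C) :
  normc (\sum_(i <- s | P i) f i) <= \sum_(i <- s | P i) normc (f i).
Proof.
elim/big_rec2: _ => [|i y1 y2 _ h]; first by rewrite normcR normr0.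
by rewrite (le_trans (le_normcD _ _)) // lerD2l.
Qed.

Lemma normc_conj z : normc (conjc z) = normc z.
Proof. by case: z => a b; rewrite !normc_sqrtE /= sqrrN. Qed.

Lemma normc_distC z w : normc (z - w) = normc (w - z).
Proof. by rewrite -normcN opprB. Qed.

Lemma Re_le_normc z : `|Re z| <= normc z.
Proof. by rewrite normc_sqrtE -sqrtr_sqr ler_wsqrtr // lerDl sqr_ge0. Qed.

Lemma Im_le_normc z : `|Im z| <= normc z.
Proof. by rewrite normc_sqrtE -sqrtr_sqr ler_wsqrtr // lerDr sqr_ge0. Qed.

Lemma normc_le_ReIm z : normc z <= `|Re z| + `|Im z|.
Proof.
rewrite -(@ler_pXn2r _ 2) ?nnegrE ?normc_ge0 ?addr_ge0 //.
rewrite normc_sqr sqrrD !real_normK ?num_real //.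
by rewrite -addrA [X in _ <= _ + X]addrC addrA lerDl mulrn_wge0 // mulr_ge0.
Qed.

Lemma le_normcB z w : normc (z - w) <= normc z + normc w.
Proof. by rewrite (le_trans (le_normcD _ _)) // normcN. Qed.

Lemma normc_sub_le z w : normc z - normc w <= normc (z - w).
Proof. by rewrite lerBlDr -{1}(subrK w z) le_normcD. Qed.

Lemma dist_normc_le z w : `|normc z - normc w| <= normc (z - w).
Proof.
rewrite ler_norml normc_sub_le andbT lerNl opprB normc_distC.
exact: normc_sub_le.
Qed.

Lemma normc_telescope z w v : normc (z - v) <= normc (z - w) + normc (w - v).
Proof. by rewrite -(subrKA w) le_normcD. Qed.

Lemma normc_nat n : normc (n%:R : C) = n%:R.
Proof. by rewrite -[n%:R](rmorph_nat (real_complex R)) normcR ger0_norm ?ler0n. Qed.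

Lemma ReD z w : Re (z + w) = Re z + Re w.
Proof. by case: z; case: w. Qed.

Lemma ImD z w : Im (z + w) = Im z + Im w.
Proof. by case: z; case: w. Qed.

Lemma ReN z : Re (- z) = - Re z.
Proof. by case: z. Qed.

Lemma ImN z : Im (- z) = - Im z.
Proof. by case: z. Qed.

Lemma ReM z w : Re (z * w) = Re z * Re w - Im z * Im w.
Proof. by case: z; case: w. Qed.

Lemma ImM z w : Im (z * w) = Re z * Im w + Im z * Re w.
Proof. by case: z; case: w. Qed.

Lemma conjcM_normc z : conjc z * z = ((normc z) ^+ 2)%:C.
Proof.
rewrite normc_sqr; case: z => a b; apply/eqP; rewrite eq_complex /=.
by apply/andP; split; apply/eqP; ring.
Qed.

Lemma ReIm_eq z w : Re z = Re w -> Im z = Im w -> z = w.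
Proof. by case: z => a b; case: w => c d /= -> ->. Qed.

Lemma Re_sum (I : Type) (s : seq I) (P : pred I) (f : I -> C) :
  Re (\sum_(i <- s | P i) f i) = \sum_(i <- s | P i) Re (f i).
Proof. by apply: (big_morph (fun z : C => Re z)) => //; exact: ReD. Qed.

End Modulus.

Section Exponential.
Context {R : realType}.
Local Notation C := R[i].
Implicit Types (z w : C) (x : R).

Lemma cexpD z w : cexp (z + w) = cexp z * cexp w.
Proof.
rewrite /cexp; apply: ReIm_eq; rewrite ?ReM ?ImM /= ReD ImD expRD.
  by rewrite cosD; ring.
by rewrite sinD; ring.
Qed.

Lemma cexp0 : cexp 0 = 1 :> C.
Proof. by rewrite /cexp /= expR0 cos0 sin0 mulr0 mulr1. Qed.

Lemma normc_cexp z : normc (cexp z) = expR (complex.Re z).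
Proof.
rewrite normc_sqrtE /= !exprMn -mulrDr cos2Dsin2 mulr1 sqrtr_sqr.
by rewrite ger0_norm ?expR_ge0.
Qed.

Lemma cexp_real x : cexp x%:C = (expR x)%:C.
Proof. by rewrite /cexp /= cos0 sin0 mulr0 mulr1. Qed.

Lemma cpowD x z w : cpow x (z + w) = cpow x z * cpow x w.
Proof. by rewrite /cpow mulrDr cexpD. Qed.

Lemma normc_cpow x z : normc (cpow x z) = expR (ln x * complex.Re z).
Proof. by rewrite /cpow normc_cexp ReM /= mul0r subr0. Qed.

Lemma cpow1 x : 0 < x -> cpow x 1 = x%:C.
Proof. by move=> x0; rewrite /cpow mulr1 cexp_real lnK. Qed.

End Exponential.

(** * Complex derivatives in terms of the real-valued modulus *)

Section Derivative.
Context {R : realType}.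
Local Notation C := R[i].
Local Notation Re := complex.Re.
Local Notation Im := complex.Im.

(** Differentiability as a first-order expansion: without a difference quotient [h = 0] is harmless,
    and all estimates stay in the ordered field [R]. [derivable_cderiv] and [cderiv_derivable]
    translate to and from the library's notion. *)
Definition has_cderiv (f : C -> C) (z d : C) : Prop :=
  forall e : R, 0 < e -> exists2 eta : R, 0 < eta &
    forall h, normc h < eta ->
      normc (f (z + h) - f z - d * h) <= e * normc h.

Lemma has_cderiv_cst (c z : C) : has_cderiv (fun=> c) z 0.
Proof.
move=> e e0; exists 1 => // h _.
by rewrite subrr mul0r subr0 normcR normr0 mulr_ge0 ?normc_ge0 ?(ltW e0).
Qed.

Lemma has_cderiv_id (z : C) : has_cderiv id z 1.
Proof.
move=> e e0; exists 1 => // h _.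
by rewrite mul1r [z + h]addrC addrK subrr normcR normr0 mulr_ge0 ?normc_ge0 ?(ltW e0).
Qed.

Lemma has_cderiv_lipschitz f z d : has_cderiv f z d ->
  exists2 eta : R, 0 < eta & forall h, normc h < eta ->
    normc (f (z + h) - f z) <= (normc d + 1) * normc h.
Proof.
move=> /(_ 1 ltr01)[eta eta0 H]; exists eta => // h /H {}H.
have := le_normcD (f (z + h) - f z - d * h) (d * h); rewrite subrK normcM; lra.
Qed.

Lemma has_cderiv_continuous f z d : has_cderiv f z d ->
  forall e : R, 0 < e -> exists2 eta : R, 0 < eta &
    forall w, normc (w - z) < eta -> normc (f w - f z) < e.
Proof.
move=> /has_cderiv_lipschitz[eta eta0 H] e e0.
have d0 : 0 < normc d + 1 by rewrite ltr_wpDl ?normc_ge0.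
exists (Num.min eta (e / (normc d + 1))); first by rewrite lt_min eta0 divr_gt0.
move=> w; rewrite lt_min => /andP[/H + wz]; rewrite [z + _]addrC subrK => /le_lt_trans; apply.
by rewrite mulrC -ltr_pdivlMr.
Qed.

Lemma has_cderivD f g z df dg : has_cderiv f z df -> has_cderiv g z dg ->
  has_cderiv (fun w => f w + g w) z (df + dg).
Proof.
move=> Hf Hg e e0; have e2 : 0 < e / 2 by rewrite divr_gt0.
have [a a0 {}Hf] := Hf _ e2; have [b b0 {}Hg] := Hg _ e2.
exists (Num.min a b); first by rewrite lt_min a0.
move=> h; rewrite lt_min => /andP[/Hf{}Hf /Hg{}Hg].
have -> : f (z + h) + g (z + h) - (f z + g z) - (df + dg) * h =
  (f (z + h) - f z - df * h) + (g (z + h) - g z - dg * h) by ring.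
have := le_normcD (f (z + h) - f z - df * h) (g (z + h) - g z - dg * h); lra.
Qed.


(** Allows errors to be collected loosely: a fixed factor [K] in front of [e], and only small [e],
    are absorbed by replacing [e] with [min 1 (e / (K + 1))]. *)
Lemma has_cderivK (f : C -> C) (z d : C) (K : R) : 0 <= K ->
  (forall e : R, 0 < e -> e <= 1 -> exists2 eta : R, 0 < eta &
    forall h, normc h < eta ->
      normc (f (z + h) - f z - d * h) <= K * e * normc h) ->
  has_cderiv f z d.
Proof.
move=> K0 H e e0; have K1 : 0 < K + 1 by lra.
pose e' := Num.min 1 (e / (K + 1)).
have e'0 : 0 < e' by rewrite lt_min ltr01 divr_gt0.
have [|eta eta0 {}H] := H _ e'0; first by rewrite ge_min lexx.
exists eta => // h /H /le_trans; apply; rewrite ler_wpM2r ?normc_ge0 //.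
have : (K + 1) * e' <= e by rewrite mulrC -ler_pdivlMr // ge_min lexx orbT.
lra.
Qed.

Lemma has_cderivM f g z df dg : has_cderiv f z df -> has_cderiv g z dg ->
  has_cderiv (fun w => f w * g w) z (df * g z + f z * dg).
Proof.
move=> Hf Hg; have [c c0 Lg] := has_cderiv_lipschitz Hg.
set L := normc dg + 1 in Lg.
have L0 : 0 < L by rewrite /L; have := normc_ge0 dg; lra.
apply: (@has_cderivK _ _ _ (normc (g z) + L + normc (f z) + normc df * L)).
  have := normc_ge0 (g z); have := normc_ge0 (f z).
  have := mulr_ge0 (normc_ge0 df) (ltW L0); lra.
move=> e e0 e1.
have [a a0 {}Hf] := Hf _ e0; have [b b0 {}Hg] := Hg _ e0.
exists (Num.min e (Num.min a (Num.min b c))).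
  by rewrite !lt_min e0 a0 b0 c0.
move=> h; rewrite !lt_min => /and4P[he /Hf Ha /Hg Hb /Lg Hc].
set A := f (z + h) - _ - _ in Ha; set B := g (z + h) - _ - _ in Hb.
set D := g (z + h) - g z in Hc.
have -> : f (z + h) * g (z + h) - f z * g z - (df * g z + f z * dg) * h =
   A * (g z + D) + f z * B + df * h * D by rewrite /A /B /D; ring.
have h0 := normc_ge0 h; have A0 := normc_ge0 A; have B0 := normc_ge0 B.
have D0 := normc_ge0 D; have f0 := normc_ge0 (f z); have g0 := normc_ge0 (g z).
have d0 := normc_ge0 df.
have t1 := le_normcD (A * (g z + D) + f z * B) (df * h * D).
have t2 := le_normcD (A * (g z + D)) (f z * B).
have t3 := le_normcD (g z) D.
rewrite !normcM in t1 t2 t3.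
have D1 : normc D <= L by apply: (le_trans Hc); rewrite ger_pMr //; lra.
have u1 : normc A * normc (g z + D) <= e * normc h * (normc (g z) + L).
  by apply: ler_pM => //; [exact: normc_ge0 | lra].
have u2 : normc (f z) * normc B <= normc (f z) * (e * normc h) by apply: ler_wpM2l.
have u3 : normc df * normc h * normc D <= normc df * normc h * (L * e).
  apply: ler_wpM2l; first exact: mulr_ge0.
  by apply: (le_trans Hc); rewrite ler_wpM2l // ltW.
lra.
Qed.

Lemma has_cderiv_comp f g z df dg : has_cderiv f (g z) df -> has_cderiv g z dg ->
  has_cderiv (fun w => f (g w)) z (df * dg).
Proof.
move=> Hf Hg; have [c c0 Lg] := has_cderiv_lipschitz Hg.
set L := normc dg + 1 in Lg.
have L0 : 0 < L by rewrite /L; have := normc_ge0 dg; lra.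
apply: (@has_cderivK _ _ _ (L + normc df)).
  by have := normc_ge0 df; lra.
move=> e e0 e1.
have [a a0 {}Hf] := Hf _ e0; have [b b0 {}Hg] := Hg _ e0.
exists (Num.min b (Num.min c (a / L))); first by rewrite !lt_min b0 c0 divr_gt0.
move=> h; rewrite !lt_min => /and3P[/Hg Hb /Lg Hc].
rewrite ltr_pdivlMr // mulrC => ha.
have {Hf}Hf := Hf _ (le_lt_trans Hc ha).
rewrite [g z + _]addrC subrK in Hf.
set B := g (z + h) - _ - _ in Hb; set D := g (z + h) - g z in Hc Hf.
have -> : f (g (z + h)) - f (g z) - df * dg * h =
  (f (g (z + h)) - f (g z) - df * D) + df * B by rewrite /B /D; ring.
apply: (le_trans (le_normcD _ _)); rewrite normcM.
have d0 := normc_ge0 df.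
have u1 : normc df * normc B <= normc df * (e * normc h) by apply: ler_wpM2l.
have u2 : e * normc D <= e * (L * normc h) by rewrite ler_wpM2l // ltW.
lra.
Qed.

Lemma has_cderiv_eq f z d d' : has_cderiv f z d -> d = d' -> has_cderiv f z d'.
Proof. by move=> ? <-. Qed.

Lemma has_cderivZ f z d c : has_cderiv f z d ->
  has_cderiv (fun w => c * f w) z (c * d).
Proof.
move=> H; apply: (has_cderiv_eq (has_cderivM (has_cderiv_cst c z) H)).
by rewrite mul0r add0r.
Qed.

Lemma has_cderivN f z d : has_cderiv f z d -> has_cderiv (fun w => - f w) z (- d).
Proof.
move=> /(has_cderivZ (-1)); rewrite mulN1r.
by under [X in has_cderiv X]funext => w do rewrite mulN1r.
Qed.

Lemma has_cderivB f g z df dg : has_cderiv f z df -> has_cderiv g z dg ->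
  has_cderiv (fun w => f w - g w) z (df - dg).
Proof. by move=> Hf /has_cderivN; exact: has_cderivD. Qed.

Lemma has_cderivX f z d n : has_cderiv f z d ->
  exists d', has_cderiv (fun w => f w ^+ n) z d'.
Proof.
move=> Hf; elim: n => [|n [d' IH]]; first by exists 0; exact: has_cderiv_cst.
under eq_exists => w do under [X in has_cderiv X]funext => x do rewrite exprS.
by eexists; exact: has_cderivM Hf IH.
Qed.

Lemma has_cderiv_near f g z d (eta : R) : 0 < eta ->
  (forall w, normc (w - z) < eta -> f w = g w) ->
  has_cderiv f z d -> has_cderiv g z d.
Proof.
move=> eta0 E H e /H[a a0 {}H]; exists (Num.min a eta); first by rewrite lt_min a0.
move=> h; rewrite lt_min => /andP[/H {}H he].
by rewrite -!E ?subrr ?normcR ?normr0 // [z + h]addrC addrK.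
Qed.

Lemma has_cderivV z : z != 0 -> has_cderiv (fun w => w^-1) z (- z ^- 2).
Proof.
move=> z0; have n0 : 0 < normc z by rewrite normc_gt0.
apply: (@has_cderivK _ _ _ (2 * normc z ^- 3)).
  by rewrite mulr_ge0 // invr_ge0 exprn_ge0 // ltW.
move=> e e0 e1; exists (Num.min e (normc z / 2)).
  by rewrite lt_min e0 divr_gt0.
move=> h; rewrite lt_min => /andP[he hz].
have Hn : normc z / 2 <= normc (z + h).
  by have := normc_sub_le z (- h); rewrite normcN opprK; lra.
have n1 : 0 < normc (z + h) by lra.
have zh0 : z + h != 0 by rewrite -normc_gt0.
have -> : (z + h)^-1 - z^-1 - - z ^- 2 * h = h * h * ((z + h)^-1 * z ^- 2).
  by field; rewrite z0.
rewrite !normcM !normcV normcX.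
have : (normc (z + h))^-1 <= 2 / normc z.
  by rewrite -[2 / _]invf_div lef_pV2 ?posrE // divr_gt0.
move=> U; have h0 := normc_ge0 h.
have -> : 2 * normc z ^- 3 * e * normc h = (e * normc h) * (2 / normc z * normc z ^- 2).
  by field; rewrite gt_eqF.
apply: ler_pM; rewrite ?mulr_ge0 ?invr_ge0 ?exprn_ge0 ?(ltW n1) ?(ltW n0) //.
  by rewrite ler_wpM2r // ltW.
by rewrite ler_wpM2r // invr_ge0 exprn_ge0 // ltW.
Qed.

End Derivative.

(** * Translation between library derivatives, neighbourhoods and limits and explicit estimates *)

Section Transfer.
Context {R : realType}.
Local Notation C := R[i].
Local Notation Re := complex.Re.
Local Notation Im := complex.Im.

Lemma is_derive_eps (g : R -> R) (t a : R) :
  (forall e : R, 0 < e -> exists2 eta : R, 0 < eta &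
    forall h, `|h| < eta -> `|g (t + h) - g t - a * h| <= e * `|h|) <->
  is_derive t 1 g a.
Proof.
have eqv (h : R) : h != 0 ->
    `|a - h^-1 *: ((g \o shift t) (h *: 1) - g t)| * `|h| = `|g (t + h) - g t - a * h|.
  move=> h0; rewrite -normrM -normrN /= [h *: 1]mulr1 [h + t]addrC; congr `|_|.
  by rewrite /GRing.scale /=; field.
split=> [H|[dg Dg] e e0].
  have cv : h^-1 *: ((g \o shift t) (h *: 1) - g t) @[h --> 0^'] --> a.
    apply/cvgrPdist_le => e /H[eta eta0 {}H].
    exists eta => // h; rewrite /ball_ /= sub0r normrN => /H hh h0.
    by move: hh; rewrite -eqv // ler_pM2r // normr_gt0.
  split; first by apply/cvg_ex; exists a.
  by apply: cvg_lim => //; exact: norm_hausdorff.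
move: dg => /cvgrPdist_le /(_ e e0); rewrite [lim _]Dg => -[eta /= eta0 H].
exists eta => // h he; have [->|h0] := eqVneq h 0.
  by rewrite addr0 subrr mulr0 subrr normr0 mulr0.
rewrite -eqv // ler_pM2r ?normr_gt0 //; apply: H => //.
by rewrite /ball_ /= sub0r normrN.
Qed.

(** Restriction of [f] to a line. The real-linear functionals of a complex number are the
    [Re (c * _)]; [c = 1] and [c = - 'i] give the real and the imaginary part at once. *)
Lemma has_cderiv_real f (z v d c : C) (t : R) : has_cderiv f (z + t%:C * v) d ->
  is_derive t 1 (fun s : R => Re (c * f (z + s%:C * v))) (Re (c * (d * v))).
Proof.
move=> H; apply/is_derive_eps => e e0.
have K0 : 0 < normc c * normc v + 1.
  by have := mulr_ge0 (normc_ge0 c) (normc_ge0 v); lra.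
have v0 : 0 < normc v + 1 by have := normc_ge0 v; lra.
have [eta eta0 {}H] := H _ (divr_gt0 e0 K0).
exists (eta / (normc v + 1)); first by rewrite divr_gt0.
move=> h; rewrite ltr_pdivlMr // => he.
have hv : normc (h%:C * v) < eta.
  rewrite normcM normcR; apply: le_lt_trans he.
  by rewrite ler_wpM2l //; lra.
have {H} := H _ hv; set A := f _ - _ - _ => HA.
have -> : Re (c * f (z + (t + h)%:C * v)) - Re (c * f (z + t%:C * v)) - Re (c * (d * v)) * h
  = Re (c * A).
  rewrite /A rmorphD /= mulrDl addrA.
  move: (f (z + t%:C * v + _)) (f (z + _)) => x y.
  rewrite !(ReM, ReD, ReN, ImM, ImD, ImN) /=; ring.
apply: (le_trans (Re_le_normc _)); rewrite normcM.
apply: (@le_trans _ _ (normc c * (e / (normc c * normc v + 1) * normc (h%:C * v)))).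
  by rewrite ler_wpM2l ?normc_ge0.
rewrite normcM normcR.
have -> : normc c * (e / (normc c * normc v + 1) * (`|h| * normc v)) =
  (e * `|h|) * ((normc c * normc v) / (normc c * normc v + 1)).
  by field; rewrite gt_eqF.
rewrite ler_piMr ?mulr_ge0 ?(ltW e0) // ler_pdivrMr // mul1r lerDl //.
Qed.


Lemma derivable_cderiv (f : C -> C) (z : C) :
  holomorphic_at f z -> has_cderiv f z (derive1 (f : C^o -> C^o) z).
Proof.
move=> df e e0; rewrite derive1E.
have e0C : 0 < e%:C by rewrite ltcR.
move: (df) => /cvgrPdist_le /(_ e%:C e0C)[eta /= eta0 H].
have etaE : eta = (complex.Re eta)%:C by rewrite RRe_real // gtr0_real.
move: H eta0; rewrite etaE ltcR => H eta0.
exists (complex.Re eta) => // h he; have [->|h0] := eqVneq h 0.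
  by rewrite addr0 subrr mulr0 subrr normcR normr0 mulr0.
have /H : ball_ [eta Num.Def.normr] 0 (complex.Re eta)%:C h.
  by rewrite /ball_ /= sub0r normrN normr_normc ltcR.
move=> /(_ h0); rewrite normr_normc lecR /= => {}H.
rewrite -ler_pdivrMr ?normc_gt0 //; apply: le_trans H.
rewrite -normcV -normcM -normcN; rewrite le_eqVlt; apply/orP; left; apply/eqP; congr normc.
by rewrite {1}/derive; move: (lim _) => D; rewrite (mulr1 h : h *: (1 : C^o) = h) [h + z]addrC (_ : h^-1 *: _ = h^-1 * (f (z + h) - f z)) //; move: D => D'; set D : C := D'; field.
Qed.

Lemma cderiv_derivable (f : C -> C) (z d : C) :
  has_cderiv f z d -> holomorphic_at f z /\ derive1 (f : C^o -> C^o) z = d.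
Proof.
move=> H; suff cv : (fun h : (C : numFieldType) => (h^-1 *: (((f : C^o -> C^o) \o shift (z : C^o)) (h *: (1 : C^o)) - f z) : C^o)) @ (0 : (C : numFieldType))^' --> (d : C^o).
  split; first by apply/cvg_ex; exists d.
  by rewrite derive1E; apply: cvg_lim => //; exact: norm_hausdorff.
apply/cvgrPdist_le => e e0.
have eE : e = (complex.Re e)%:C by rewrite RRe_real // gtr0_real.
move: e0; rewrite eE ltcR => /H[eta eta0 {}H].
exists eta%:C; first by rewrite /= ltcR.
move=> h; rewrite /ball_ /= sub0r normrN normr_normc ltcR => /H hh h0.
rewrite normr_normc lecR.
rewrite -(ler_pM2r (_ : 0 < normc h)) ?normc_gt0 // -normcM; apply: le_trans hh.
rewrite -normcN; rewrite le_eqVlt; apply/orP; left; apply/eqP; congr normc.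
rewrite /= (mulr1 h : h *: (1 : C^o) = h) [h + z]addrC.
rewrite (_ : h^-1 *: _ = h^-1 * (f (z + h) - f z)) //.
by field.
Qed.

Lemma near_normc (z : C) (P : C -> Prop) :
  (\forall w \near (z : C^o), P w) <->
  exists2 eta : R, 0 < eta & forall w, normc (w - z) < eta -> P w.
Proof.
split=> [[e /= e0 H]|[eta eta0 H]].
  have eE : e = (complex.Re e)%:C by rewrite RRe_real // gtr0_real.
  move: e0 H; rewrite eE ltcR => e0 H; exists (complex.Re e) => // w wz; apply: H.
  by rewrite /= /ball_ /= normr_normc ltcR normc_distC.
exists eta%:C; first by rewrite /= ltcR.
by move=> w; rewrite /= /ball_ /= normr_normc ltcR normc_distC => /H.
Qed.

Lemma near_punctured_normc (z : C) (P : C -> Prop) :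
  (\forall w \near (z : C^o)^', P w) <->
  exists2 eta : R, 0 < eta & forall w, w != z -> normc (w - z) < eta -> P w.
Proof.
split=> [/near_normc[e e0 H]|[e e0 H]].
  by exists e => // w wz /H; apply.
by apply/near_normc; exists e => // w ? ?; apply: H.
Qed.

Lemma cvg_normc (u : nat -> C) (l : C) :
  ((u : nat -> C^o) @ \oo --> (l : C^o)) <->
  forall e : R, 0 < e -> exists N, forall n, (N <= n)%N -> normc (u n - l) < e.
Proof.
split=> [/cvgrPdist_lt H e e0|H].
  have /H[N _ {}H] : 0 < e%:C by rewrite ltcR.
  by exists N => n /H /=; rewrite normr_normc ltcR normc_distC.
apply/cvgrPdist_lt => e e0.
have eE : e = (complex.Re e)%:C by rewrite RRe_real // gtr0_real.
move: e0; rewrite eE ltcR => /H[N {}H]; exists N => // n /H /=.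
by rewrite normr_normc ltcR normc_distC.
Qed.

Lemma expR_eps (e : R) : 0 < e -> exists2 eta : R, 0 < eta &
  forall h, `|h| < eta -> `|expR h - 1 - h| <= e * `|h|.
Proof.
move=> e0; have /is_derive_eps/(_ e e0)[eta eta0 H] := is_derive_expR (0 : R).
by exists eta => // h /H; rewrite add0r expR0 mul1r.
Qed.

(** The addition formula reduces the claim to the point 0, where the remainder is assembled from the
    first-order expansions of [expR], [sin] and [cos]; the constant 8 leaves room for the errors of
    both coordinates. *)
Lemma has_cderiv_cexp (z : C) : has_cderiv cexp z (cexp z).
Proof.
suff H : has_cderiv (@cexp R) 0 1.
  have -> : cexp = (fun w => cexp z * cexp (w - z)) :> (C -> C).
    by apply/funext => w; rewrite -cexpD addrC subrK.
  have := has_cderivZ (cexp z) (has_cderiv_comp (g := fun w => w - z) (z := z) _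
    (has_cderivB (has_cderiv_id z) (has_cderiv_cst z z))).
  by rewrite subrr => /(_ _ _ H); rewrite subr0 cexp0 !mulr1.
apply: (@has_cderivK _ _ _ _ 8) => // e e0 e1.
have [a a0 Ha] := expR_eps e0.
have /is_derive_eps/(_ e e0)[b b0 Hb] := is_derive_sin (0 : R).
have /is_derive_eps/(_ e e0)[c c0 Hc] := is_derive_cos (0 : R).
exists (Num.min (e / 2) (Num.min a (Num.min b c))).
  by rewrite !lt_min a0 b0 c0 divr_gt0.
move=> h; rewrite !lt_min => /and4P[he ha hb hc].
have [nR nI] := (Re_le_normc h, Im_le_normc h).
have {}Ha := Ha _ (le_lt_trans nR ha).
have {}Hb := Hb _ (le_lt_trans nI hb); have {}Hc := Hc _ (le_lt_trans nI hc).
rewrite add0r sin0 cos0 subr0 mul1r in Hb.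
rewrite add0r sin0 cos0 oppr0 mul0r subr0 in Hc.
rewrite add0r cexp0 mul1r; apply: (le_trans (normc_le_ReIm _)).
rewrite !(ReD, ImD, ReN, ImN) /=.
move: (normc h) (normc_ge0 h) he ha hb hc nR nI => n n0.
move: (complex.Re h) (complex.Im h) Ha Hb Hc => x y Ha Hb Hc he ha hb hc nR nI.
have Hx : `|expR x - 1| <= 2 * n.
  have := ler_normD (expR x - 1 - x) x; rewrite subrK => Hx.
  have : e * `|x| <= 1 * n by apply: ler_pM => //; lra.
  lra.
have Hx2 : `|expR x| <= 2.
  have := ler_normD (expR x - 1) 1; rewrite subrK normr1; lra.
have en : e * `|x| <= e * n by rewrite ler_wpM2l // ltW.
have en' : e * `|y| <= e * n by rewrite ler_wpM2l // ltW.
have u1 : `|expR x * cos y - 1 - x| <= 2 * (e * n) + e * n.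
  have -> : expR x * cos y - 1 - x = expR x * (cos y - 1) + (expR x - 1 - x) by ring.
  apply: (le_trans (ler_normD _ _)); rewrite normrM; apply: lerD; last exact: le_trans en.
  by apply: ler_pM => //; exact: le_trans en'.
have u2 : `|expR x * sin y - 0 - y| <= 2 * (e * n) + e * n.
  have -> : expR x * sin y - 0 - y = expR x * (sin y - y) + y * (expR x - 1) by ring.
  apply: (le_trans (ler_normD _ _)); rewrite !normrM; apply: lerD.
    by apply: ler_pM => //; exact: le_trans en'.
  apply: (@le_trans _ _ (n * (2 * n))); first by apply: ler_pM.
  rewrite mulrA; apply: ler_wpM2r => //; lra.
have := mulr_ge0 (ltW e0) n0; lra.
Qed.

End Transfer.

(** * Goursat's theorem *)

Section RealPrimitive.
Context {R : realType}.
Implicit Types (g P Q : R -> R) (a b c : R).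

(** The derivative is two-sided even at the end points, so that primitives restrict to subintervals
    and combine with the library's derivation rules without one-sided variants. *)
Definition rprim P g a b :=
  forall x, a <= x <= b -> is_derive x (1 : R) P (g x).

(* The increment over [a, b] of any primitive of [g]; 0 if there is none. *)
Definition rint g a b : R :=
  xget 0 [set v | exists2 P, rprim P g a b & v = P b - P a].

Lemma rprim_continuous P g a b : rprim P g a b -> {within `[a, b], continuous P}.
Proof.
move=> H; apply: derivable_within_continuous => x; rewrite in_itv /= => /H [].
by [].
Qed.

Lemma rprim_mvt P g a b : a <= b -> rprim P g a b ->
  exists2 x, a <= x <= b & P b - P a = g x * (b - a).
Proof.
move=> ab H; have [|x] := @MVT_segment _ P g _ _ ab _ (rprim_continuous H).
  by move=> x; rewrite in_itv /= => /andP[/ltW ax /ltW xb]; apply: H; rewrite ax.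
by rewrite in_itv /=; exists x.
Qed.

Lemma rprimB P Q g h a b : rprim P g a b -> rprim Q h a b ->
  rprim (P \- Q) (g \- h) a b.
Proof. by move=> HP HQ x xab; apply: is_deriveB; [apply: HP|apply: HQ]. Qed.

Lemma rprimD P Q g h a b : rprim P g a b -> rprim Q h a b ->
  rprim (P \+ Q) (g \+ h) a b.
Proof. by move=> HP HQ x xab; apply: is_deriveD; [apply: HP|apply: HQ]. Qed.

Lemma rprimZ P g k a b : rprim P g a b ->
  rprim (fun x => k * P x) (fun x => k * g x) a b.
Proof. by move=> HP x xab; apply: is_deriveZ; apply: HP. Qed.

Lemma rprim_le P Q g h a b : a <= b -> rprim P g a b -> rprim Q h a b ->
  (forall x, a <= x <= b -> g x <= h x) -> P b - P a <= Q b - Q a.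
Proof.
move=> ab HP HQ gh; rewrite -subr_ge0.
have [x xab /= E] := rprim_mvt ab (rprimB HQ HP).
have -> : Q b - Q a - (P b - P a) = Q b - P b - (Q a - P a) by ring.
by rewrite E mulr_ge0 // subr_ge0 // gh.
Qed.

Lemma rint_eq P g a b : a <= b -> rprim P g a b -> rint g a b = P b - P a.
Proof.
move=> ab HP; rewrite /rint; case: xgetP => [y _ [Q HQ ->]|/(_ (P b - P a))[]].
  by apply/eqP; rewrite eq_le; apply/andP; split;
    [exact: (rprim_le ab HQ HP)|exact: (rprim_le ab HP HQ)].
by exists P.
Qed.

Lemma rprim_exists g a b : continuous g -> exists P, rprim P g a b.
Proof.
(* Starting the integral at [a - 1] makes [a] an interior point, so the derivative exists
   two-sidedly there. *)
move=> cg; exists (fun x => \int[lebesgue_measure]_(t in `[a - 1, x]) g t)%R.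
move=> x /andP[ax xb].
have xu : x < x + 1 by rewrite ltrDl.
have gi : lebesgue_measure.-integrable `[a - 1, x + 1] (EFin \o g).
  apply: continuous_compact_integrable; first exact: segment_compact.
  exact: continuous_subspaceT.
have ax1 : a - 1 < x by lra.
have [D1 D2] := continuous_FTC1_closed xu gi ax1 (cg x).
split; first exact: D1.
by rewrite -derive1E; exact: D2.
Qed.

Lemma rprimW P g a b a' b' : a <= a' -> b' <= b -> rprim P g a b -> rprim P g a' b'.
Proof.
move=> aa bb H x /andP[ax xb]; apply: H.
by rewrite (le_trans aa ax) (le_trans xb bb).
Qed.

End RealPrimitive.

(** * Integrals of complex functions of a real variable *)

Section ComplexIntegral.
Context {R : realType}.
Local Notation C := R[i].
Local Notation Re := complex.Re.
Local Notation Im := complex.Im.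
Implicit Types (u v P Q : R -> C) (a b c : R).

Definition cprim P u a b :=
  rprim (fun x => Re (P x)) (fun x => Re (u x)) a b /\
  rprim (fun x => Im (P x)) (fun x => Im (u x)) a b.

Definition cint u a b : C :=
  rint (fun x => Re (u x)) a b +i* rint (fun x => Im (u x)) a b.

Lemma cint_eq P u a b : a <= b -> cprim P u a b -> cint u a b = P b - P a.
Proof.
by move=> ab [H1 H2]; apply: ReIm_eq;
  rewrite /= ?(rint_eq ab H1) ?(rint_eq ab H2) ?ReD ?ImD ?ReN ?ImN.
Qed.

Definition ccontinuous u :=
  continuous (fun x => Re (u x)) /\ continuous (fun x => Im (u x)).

Lemma cprim_exists u a b : ccontinuous u -> exists P, cprim P u a b.
Proof.
move=> [/rprim_exists-/(_ a b)[P HP] /rprim_exists-/(_ a b)[Q HQ]].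
by exists (fun x => P x +i* Q x).
Qed.

Lemma cprimD P Q u v a b : cprim P u a b -> cprim Q v a b ->
  cprim (fun x => P x + Q x) (fun x => u x + v x) a b.
Proof.
move=> [H1 H2] [H3 H4]; split.
  have := rprimD H1 H3; congr rprim; apply/funext => x; by rewrite ReD.
have := rprimD H2 H4; congr rprim; apply/funext => x; by rewrite ImD.
Qed.

Lemma cprim_rot P u a b (z : C) : cprim P u a b ->
  rprim (fun x => Re (z * P x)) (fun x => Re (z * u x)) a b.
Proof.
move=> [/(rprimZ (Re z)) H1 /(rprimZ (Im z)) H2].
have := rprimB H1 H2; congr rprim; apply/funext => x; by rewrite /= ReM.
Qed.

Lemma cprimZ P u a b (z : C) : cprim P u a b ->
  cprim (fun x => z * P x) (fun x => z * u x) a b.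
Proof.
move=> H; split; first exact: cprim_rot.
have := cprim_rot (- 'i * z) H.
by congr rprim; apply/funext => x; rewrite !(ReM, ImM) /=; ring.
Qed.

Lemma cintD u v a b : a <= b -> ccontinuous u -> ccontinuous v ->
  cint (fun x => u x + v x) a b = cint u a b + cint v a b.
Proof.
move=> ab /cprim_exists-/(_ a b)[P HP] /cprim_exists-/(_ a b)[Q HQ].
rewrite (cint_eq ab (cprimD HP HQ)) (cint_eq ab HP) (cint_eq ab HQ); ring.
Qed.

Lemma cint_split u a b c : a <= b -> b <= c -> ccontinuous u ->
  cint u a c = cint u a b + cint u b c.
Proof.
move=> ab bc /cprim_exists-/(_ a c)[P HP].
have HP1 : cprim P u a b by case: HP => H1 H2; split; apply: rprimW bc _.
have HP2 : cprim P u b c by case: HP => H1 H2; split; apply: rprimW ab _ _.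
rewrite (cint_eq ab HP1) (cint_eq bc HP2) (cint_eq (le_trans ab bc) HP).
by rewrite [RHS]addrC subrKA.
Qed.

(** The value [D] of the integral is rotated onto the real axis: [Re (conj D * P)] has increment
    [|D|^2], while its derivative is at most [|D| * phi]. Comparing primitives and dividing by [|D|]
    gives the bound. A function [phi], rather than a constant, is needed for the maximum modulus
    principle. *)
Lemma normc_cint_le u (phi Phi : R -> R) a b : a <= b -> ccontinuous u ->
  rprim Phi phi a b -> (forall x, a <= x <= b -> normc (u x) <= phi x) ->
  normc (cint u a b) <= Phi b - Phi a.
Proof.
move=> ab /cprim_exists-/(_ a b)[P HP] HPhi uphi.
rewrite (cint_eq ab HP); set D := P b - P a.
have [->|D0] := eqVneq D 0.
  rewrite normcR normr0 subr_ge0 -subr_ge0.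
  have [x xab ->] := rprim_mvt ab HPhi.
  by rewrite mulr_ge0 ?subr_ge0 // (le_trans (normc_ge0 _) (uphi _ xab)).
have n0 : 0 < normc D by rewrite normc_gt0.
have := rprim_le ab (cprim_rot (conjc D) HP) (rprimZ (normc D) HPhi).
rewrite -ReN -ReD -mulrN -mulrDr -/D conjcM_normc -mulrBr /= => H.
rewrite -(ler_pM2l n0) -expr2; apply: H => x xab.
apply: (le_trans (ler_norm _)); apply: (le_trans (Re_le_normc _)).
by rewrite normcM normc_conj ler_wpM2l ?normc_ge0 // uphi.
Qed.

Lemma rprim_cst (M a b : R) : rprim (fun x => M * x) (fun=> M) a b.
Proof.
move=> x _; have := is_deriveZ (f := @id R) M (is_derive_id x (1 : R)).
by rewrite /GRing.scale /= mulr1.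
Qed.

Lemma normc_cint_le_cst u (M : R) a b : a <= b -> ccontinuous u ->
  (forall x, a <= x <= b -> normc (u x) <= M) ->
  normc (cint u a b) <= M * (b - a).
Proof.
by move=> ab cu uM; rewrite mulrBr; apply: normc_cint_le uM => //; exact: rprim_cst.
Qed.

Lemma cprim_line (f f' : C -> C) (z v : C) a b :
  (forall w, has_cderiv f w (f' w)) ->
  cprim (fun t => f (z + t%:C * v)) (fun t => f' (z + t%:C * v) * v) a b.
Proof.
move=> H; split => t _.
  have := has_cderiv_real 1 (H (z + t%:C * v)); rewrite mul1r.
  by congr is_derive; apply/funext => s; rewrite mul1r.
have E (w : C) : Re (- 'i * w) = Im w by rewrite ReM /=; ring.
have := has_cderiv_real (- 'i) (H (z + t%:C * v)); rewrite E.
by congr is_derive; apply/funext => s; rewrite E.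
Qed.

End ComplexIntegral.

Section Goursat.
Context {R : realType}.
Local Notation C := R[i].
Local Notation Re := complex.Re.
Local Notation Im := complex.Im.
Implicit Types (f g : C -> C) (a b c : R).

Definition centire f := forall z, exists d, has_cderiv f z d.

Lemma entire_centire f : entire f -> centire f.
Proof. by move=> H z; exists (derive1 (f : C^o -> C^o) z); exact: derivable_cderiv. Qed.

Lemma centire_deriv f : centire f -> exists f', forall z, has_cderiv f z (f' z).
Proof. by move=> H; have [f' Hf'] := choice H; exists f'. Qed.

Lemma line_ccontinuous f (z v : C) : centire f ->
  ccontinuous (fun t => f (z + t%:C * v)).
Proof.
move=> /centire_deriv[f' H]; have L a b := cprim_line z v a b H.
by split => t; have [L1 L2] := L t t; [have := L1 t|have := L2 t]; rewrite lexx => /(_ isT)[D _];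
  apply: differentiable_continuous; apply/derivable1_diffP; exact: D.
Qed.

Definition hline f c (x : R) := f (x +i* c).
Definition vline f a (y : R) := f (a +i* y).

Lemma hlineE f c : hline f c = fun x => f (0 +i* c + x%:C * 1).
Proof. by apply/funext => x; rewrite /hline mulr1; congr f; apply: ReIm_eq => /=; ring. Qed.

Lemma vlineE f a : vline f a = fun y => f (a +i* 0 + y%:C * 'i).
Proof. by apply/funext => x; rewrite /vline; congr f; apply: ReIm_eq => /=; ring. Qed.

Lemma hline_ccontinuous f c : centire f -> ccontinuous (hline f c).
Proof. by rewrite hlineE; exact: line_ccontinuous. Qed.

Lemma vline_ccontinuous f c : centire f -> ccontinuous (vline f c).
Proof. by rewrite vlineE; exact: line_ccontinuous. Qed.

(** The contour integral along the boundary of [[a, b] x [c, d]], counterclockwise: bottom minus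
    top, then right minus left, ['i] being [dz/dy] on the vertical sides. *)
Definition rectint f a b c d : C :=
  cint (hline f c) a b - cint (hline f d) a b
  + 'i * (cint (vline f b) c d - cint (vline f a) c d).

Lemma rectint_primitive F f a b c d : a <= b -> c <= d ->
  (forall z, has_cderiv F z (f z)) -> centire f -> rectint f a b c d = 0.
Proof.
move=> ab cd HF cf.
have hl y : cint (hline f y) a b = F (b +i* y) - F (a +i* y).
  have := cprim_line (0 +i* y) 1 a b HF.
  rewrite -(hlineE F) (_ : (fun t => _ * 1) = hline f y); last first.
    by rewrite hlineE; apply/funext => x; rewrite mulr1.
  exact: cint_eq.
have vl x : cint (vline f x) c d = - 'i * (F (x +i* d) - F (x +i* c)).
  have := cprimZ (- 'i) (cprim_line (x +i* 0) 'i c d HF).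
  have -> : (fun t => - 'i * F (x +i* 0 + t%:C * 'i)) = (fun t => - 'i * vline F x t).
    by rewrite vlineE.
  have -> : (fun t => - 'i * (f (x +i* 0 + t%:C * 'i) * 'i)) = vline f x.
    rewrite vlineE; apply/funext => t; rewrite mulrCA mulNr -expr2 sqr_i.
    by rewrite opprK mulr1.
  by move=> /(cint_eq cd) ->; rewrite mulrBr.
rewrite /rectint !hl !vl -mulrBr mulrA mulrN -expr2 sqr_i; ring.
Qed.

Lemma rectint_splitx f a m b c d : a <= m -> m <= b -> centire f ->
  rectint f a b c d = rectint f a m c d + rectint f m b c d.
Proof.
move=> am mb cf; rewrite /rectint.
rewrite (cint_split am mb (hline_ccontinuous c cf)).
rewrite (cint_split am mb (hline_ccontinuous d cf)); ring.
Qed.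

Lemma rectint_splity f a b c m d : c <= m -> m <= d -> centire f ->
  rectint f a b c d = rectint f a b c m + rectint f a b m d.
Proof.
move=> cm md cf; rewrite /rectint.
rewrite (cint_split cm md (vline_ccontinuous a cf)).
rewrite (cint_split cm md (vline_ccontinuous b cf)); ring.
Qed.

Lemma rectintD f g a b c d : a <= b -> c <= d -> centire f -> centire g ->
  rectint (fun z => f z + g z) a b c d = rectint f a b c d + rectint g a b c d.
Proof.
move=> ab cd cf cg; rewrite /rectint /hline /vline.
rewrite !(cintD ab (hline_ccontinuous _ cf) (hline_ccontinuous _ cg)).
rewrite !(cintD cd (vline_ccontinuous _ cf) (vline_ccontinuous _ cg)).
by rewrite /hline /vline; ring.
Qed.

Lemma normc_i : normc ('i : C) = 1.
Proof. by rewrite normc_sqrtE /= expr0n /= add0r expr1n sqrtr1. Qed.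

Lemma rectint_bound f a b c d (M : R) : a <= b -> c <= d -> centire f ->
  (forall z, a <= Re z <= b -> c <= Im z <= d -> normc (f z) <= M) ->
  normc (rectint f a b c d) <= 2 * M * ((b - a) + (d - c)).
Proof.
move=> ab cd cf fM; rewrite /rectint.
have hl y : c <= y <= d -> normc (cint (hline f y) a b) <= M * (b - a).
  move=> ycd; apply: normc_cint_le_cst => // [|x xab]; first exact: hline_ccontinuous.
  exact: fM.
have vl x : a <= x <= b -> normc (cint (vline f x) c d) <= M * (d - c).
  move=> xab; apply: normc_cint_le_cst => // [|y ycd]; first exact: vline_ccontinuous.
  exact: fM.
apply: (le_trans (le_normcD _ _)); rewrite normcM normc_i mul1r.
have := le_normcB (cint (hline f c) a b) (cint (hline f d) a b).
have := le_normcB (cint (vline f b) c d) (cint (vline f a) c d).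
have := hl c; have := hl d; have := vl a; have := vl b.
rewrite !lexx ab cd => /(_ isT) ? /(_ isT) ? /(_ isT) ? /(_ isT) ?; lra.
Qed.

Lemma nested_intervals (x l : nat -> R) :
  (forall n, x n <= x n.+1) -> (forall n, x n.+1 + l n.+1 <= x n + l n) ->
  (forall n, 0 <= l n) -> exists X, forall n, x n <= X <= x n + l n.
Proof.
move=> H1 H2 H3.
have mon : {homo x : m n / (m <= n)%N >-> m <= n}.
  by apply: homo_leq => // ? ? ?; exact: le_trans.
have mon2 : {homo (fun n => x n + l n) : m n / (m <= n)%N >-> n <= m}.
  by apply: (@homo_leq _ (fun n => x n + l n) (fun a b => b <= a)) => // ? ? ? ? /le_trans; apply.
have ub m n : x m <= x n + l n.
  have := mon _ _ (leq_maxl m n); have := mon2 _ _ (leq_maxr m n).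
  have := H3 (maxn m n); lra.
exists (sup (range x)) => n; apply/andP; split.
  by apply: ub_le_sup; [exists (x 0 + l 0) => _ [m _ <-]|exists n].
by apply: ge_sup; [exists (x 0); exists 0%N|move=> _ [m _ <-]].
Qed.

Lemma normc_rect_diam a c (w h : R) (z z' : C) :
  a <= Re z <= a + w -> c <= Im z <= c + h ->
  a <= Re z' <= a + w -> c <= Im z' <= c + h -> normc (z - z') <= w + h.
Proof.
move=> /andP[? ?] /andP[? ?] /andP[? ?] /andP[? ?].
apply: (le_trans (normc_le_ReIm _)); rewrite ReD ReN ImD ImN.
by apply: lerD; rewrite ler_norml; apply/andP; split; lra.
Qed.

(** The integral is the sum of those over the four quarters, so one of them has at least a fourth of
    the modulus. *)
Lemma rectint_quarter f a c (w h eta : R) : 0 <= w -> 0 <= h -> centire f ->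
  eta <= normc (rectint f a (a + 2 * w) c (c + 2 * h)) ->
  exists p : R * R, [/\ p.1 = a \/ p.1 = a + w, p.2 = c \/ p.2 = c + h &
    eta / 4 <= normc (rectint f p.1 (p.1 + w) p.2 (p.2 + h))].
Proof.
move=> w0 h0 cf H; apply: contrapT => N.
have K x y : (x = a \/ x = a + w) -> (y = c \/ y = c + h) ->
    normc (rectint f x (x + w) y (y + h)) < eta / 4.
  by move=> ? ?; rewrite ltNge; apply/negP => ?; apply: N; exists (x, y).
move: H; rewrite (@rectint_splitx f a (a + w)) //; [|lra|lra].
rewrite (@rectint_splity f a _ c (c + h)) //; [|lra|lra].
rewrite (@rectint_splity f (a + w) _ c (c + h)) //; [|lra|lra].
have -> : a + 2 * w = a + w + w by ring.
have -> : c + 2 * h = c + h + h by ring.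
set A := rectint _ _ _ _ _; set B := rectint _ _ _ _ _.
set D := rectint _ _ _ _ _; set E := rectint _ _ _ _ _.
have := le_normcD (A + B) (D + E); have := le_normcD A B; have := le_normcD D E.
have : normc A < eta / 4 by apply: K; left.
have : normc B < eta / 4 by apply: K; [left|right].
have : normc D < eta / 4 by apply: K; [right|left].
have : normc E < eta / 4 by apply: K; right.
lra.
Qed.

Lemma centireD f g : centire f -> centire g -> centire (fun z => f z + g z).
Proof.
move=> Hf Hg z; have [df Hdf] := Hf z; have [dg Hdg] := Hg z.
by eexists; exact: (has_cderivD Hdf Hdg).
Qed.

Lemma centireM f g : centire f -> centire g -> centire (fun z => f z * g z).
Proof.
move=> Hf Hg z; have [df Hdf] := Hf z; have [dg Hdg] := Hg z.
by eexists; exact: (has_cderivM Hdf Hdg).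
Qed.

Lemma centire_comp f g : centire f -> centire g -> centire (fun z => f (g z)).
Proof.
move=> Hf Hg z; have [dg Hdg] := Hg z; have [df Hdf] := Hf (g z).
by eexists; exact: (has_cderiv_comp Hdf Hdg).
Qed.

Lemma centire_cst (k : C) : centire (fun=> k).
Proof. by move=> z; exists 0; exact: has_cderiv_cst. Qed.

Lemma centire_id : centire id.
Proof. by move=> z; exists 1; exact: has_cderiv_id. Qed.

Lemma centire_cexp : centire (@cexp R).
Proof. by move=> z; exists (cexp z); exact: has_cderiv_cexp. Qed.

(** Were the integral of modulus [eta > 0], repeated quartering would give nested rectangles with
    integrals at least [eta / 4^n], shrinking to a point [z0]. There [f] is an affine function,
    whose integral vanishes because it has a primitive, plus a remainder [g] that is at most [e]
    times the distance to [z0]. Size of [g] and perimeter both scale like [2^-n], so the integral is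
    at most [2 e D^2 / 4^n]. *)
Lemma goursat f a c (w h : R) : 0 <= w -> 0 <= h -> centire f ->
  rectint f a (a + w) c (c + h) = 0.
Proof.
move=> w0 h0 cf; apply: contrapT => /eqP; rewrite -normc_gt0.
set eta := normc _ => eta0.
pose wn n : R := w / 2 ^+ n; pose hn n : R := h / 2 ^+ n.
have wn0 n : 0 <= wn n by rewrite divr_ge0 // exprn_ge0.
have hn0 n : 0 <= hn n by rewrite divr_ge0 // exprn_ge0.
have wnS n : wn n = 2 * wn n.+1 by rewrite /wn exprS; field; rewrite expf_neq0 // pnatr_eq0.
have hnS n : hn n = 2 * hn n.+1 by rewrite /hn exprS; field; rewrite expf_neq0 // pnatr_eq0.
pose good n (p : R * R) :=
  eta / 4 ^+ n <= normc (rectint f p.1 (p.1 + wn n) p.2 (p.2 + hn n)).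
(* The premise [good n p] stands under the existential quantifier so that [choice] yields a total
   function on pairs. *)
have step (n : nat) (p : R * R) : exists q : R * R, good n p ->
    [/\ p.1 <= q.1, q.1 + wn n.+1 <= p.1 + wn n, p.2 <= q.2, q.2 + hn n.+1 <= p.2 + hn n
      & good n.+1 q].
  have [Hg|] := pselect (good n p); last by exists p.
  have := Hg; rewrite /good wnS hnS => /(rectint_quarter (wn0 _) (hn0 _) cf)[q [q1 q2 Hq]].
  exists q => _; have := wn0 n.+1; have := hn0 n.+1 => ? ?.
  split; try by [case: q1 => ->; lra|case: q2 => ->; lra].
  apply: le_trans Hq; rewrite (_ : eta / _ = eta / 4 ^+ n / 4) //.
  by rewrite exprS; field; rewrite expf_neq0 // pnatr_eq0.
have [next Hnext] := choice (fun np : nat * (R * R) => step np.1 np.2).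
pose fix p n : R * R := if n is k.+1 then next (k, p k) else (a, c).
have pgood n : good n (p n).
  elim: n => [|n IH]; first by rewrite /good /= /wn /hn expr0 !divr1.
  by case: (Hnext (n, p n) IH).
have [X HX] : exists X, forall n, (p n).1 <= X <= (p n).1 + wn n.
  by apply: nested_intervals => // n; case: (Hnext (n, p n) (pgood n)).
have [Y HY] : exists Y, forall n, (p n).2 <= Y <= (p n).2 + hn n.
  by apply: nested_intervals => // n; case: (Hnext (n, p n) (pgood n)).
pose z0 := X +i* Y; have [d Hd] := cf z0.
pose D := w + h; have D0 : 0 <= D by rewrite addr_ge0.
(* Chosen so that [2 e D^2 < eta]; adding 1 to [D^2] covers degenerate rectangles. *)
pose e := eta / (4 * (D ^+ 2 + 1)).
have D1 : 0 < D ^+ 2 + 1 by rewrite ltr_wpDl ?exprn_ge0.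
have e0 : 0 < e by rewrite divr_gt0 // mulr_gt0.
have [del del0 {}Hd] := Hd e e0.
pose n := (Num.truncn (D / del)).+1.
have Dn : D / 2 ^+ n < del.
  rewrite ltr_pdivrMr ?exprn_gt0 // mulrC -ltr_pdivrMr //.
  apply: (lt_le_trans (truncnS_gt _)); rewrite -natrX ler_nat -/n.
  exact: ltnW (ltn_expl _ _).
have := pgood n; rewrite /good.
have HXn := HX n; have HYn := HY n.
set x := (p n).1 in HXn *; set y := (p n).2 in HYn *.
pose L z := f z0 + d * (z - z0).
have cL : centire L.
  apply: centireD; first exact: centire_cst.
  by apply: centireM; [exact: centire_cst|apply: centireD; [exact: centire_id|exact: centire_cst]].
pose g z := f z + (-1) * L z.
have cg : centire g.
  by apply: centireD => //; apply: centireM => //; exact: centire_cst.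
have fE : f = (fun z => g z + L z).
  by apply/funext => z; rewrite /g; ring.
have xw : x <= x + wn n by rewrite lerDl.
have yh : y <= y + hn n by rewrite lerDl.
have rL : rectint L x (x + wn n) y (y + hn n) = 0.
  apply: (@rectint_primitive (fun z => f z0 * z + d / 2 * ((z - z0) * (z - z0)))) => // z.
  have Hz : has_cderiv (fun z => z - z0) z (1 - 0).
    by apply: has_cderivB; [exact: has_cderiv_id|exact: has_cderiv_cst].
  apply: has_cderiv_eq; first apply: has_cderivD.
  - exact: has_cderivZ (has_cderiv_id z).
  - exact: has_cderivZ (has_cderivM Hz Hz).
  by rewrite /L; field.
rewrite {1}fE (rectintD xw yh cg cL) rL addr0.
have : normc (rectint g x (x + wn n) y (y + hn n)) <=
    2 * (e * (D / 2 ^+ n)) * (x + wn n - x + (y + hn n - y)).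
  apply: rectint_bound => // z zx zy.
  have zz : normc (z - z0) <= D / 2 ^+ n.
    rewrite /D mulrDl; apply: normc_rect_diam; [exact: zx|exact: zy|exact: HXn|exact: HYn]. 
  have := Hd (z - z0) (le_lt_trans zz Dn).
  rewrite [z0 + _]addrC subrK => H.
  rewrite (_ : g z = f z - f z0 - d * (z - z0)); last by rewrite /g /L; ring.
  by apply: (le_trans H); rewrite ler_wpM2l // ltW.
move=> U V; have := le_trans V U.
have -> : x + wn n - x + (y + hn n - y) = D / 2 ^+ n.
  by rewrite /D /wn /hn; ring.
have -> : 2 * (e * (D / 2 ^+ n)) * (D / 2 ^+ n) = (2 * e * D ^+ 2) / 4 ^+ n.
  have -> : (4 : R) ^+ n = 2 ^+ n * 2 ^+ n by rewrite -exprMn; congr (_ ^+ _); ring.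
  field.
  by rewrite expf_neq0 // pnatr_eq0.
rewrite ler_pM2r ?invr_gt0 ?exprn_gt0 // leNgt => /negP; apply.
have eE : e * (4 * (D ^+ 2 + 1)) = eta.
  by rewrite divfK // gt_eqF // mulr_gt0.
have := mulr_ge0 (ltW e0) (exprn_ge0 2 D0); lra.
Qed.

End Goursat.

(** * Mean value property and maximum modulus *)

Section MaximumModulus.
Context {R : realType}.
Local Notation C := R[i].
Local Notation Re := complex.Re.
Local Notation Im := complex.Im.
Implicit Types (f : C -> C) (z : C).

Definition inrect (a b c d : R) : set C := [set z | a <= Re z <= b /\ c <= Im z <= d].

Definition ccont_real (h : C -> R) := forall z (e : R), 0 < e ->
  exists2 eta : R, 0 < eta & forall w, normc (w - z) < eta -> `|h w - h z| < e.

Lemma rect_max (h : C -> R) (a b c d : R) : a <= b -> c <= d -> ccont_real h ->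
  exists2 z0, inrect a b c d z0 & forall z, inrect a b c d z -> h z <= h z0.
Proof.
move=> ab cd ch; pose F (p : R * R) := h (p.1 +i* p.2).
have cF : continuous F.
  move=> p; apply/cvgrPdist_lt => e e0.
  have [eta eta0 H] := ch (p.1 +i* p.2) e e0.
  have eta2 : 0 < eta / 2 by rewrite divr_gt0.
  apply: filterS (nbhsx_ballx p _ eta2) => q [q1 q2].
  rewrite distrC; apply: H; apply: (le_lt_trans (normc_le_ReIm _)).
  rewrite ReD ReN ImD ImN /=.
  move: q1 q2; rewrite /ball /= => q1 q2.
  rewrite distrC [X in _ + X]distrC; lra.
have [||p|p pA pmax] := @compact_EVT_max _ _ F (`[a, b] `*` `[c, d]).
- by exists (a, c); split; rewrite /= in_itv /= lexx ?ab ?cd.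
- by apply: compact_setX; exact: segment_compact.
- exact: continuous_subspaceT.
move: pA; rewrite inE => -[/= ]; rewrite !in_itv /= => p1 p2.
exists (p.1 +i* p.2) => // -[x y] [/= xab ycd].
by apply: (pmax (x, y)); rewrite inE; split; rewrite /= in_itv.
Qed.

Lemma ccont_real_normc f : centire f -> ccont_real (fun z => normc (f z)).
Proof.
move=> cf z e e0; have [d Hd] := cf z.
have [eta eta0 H] := has_cderiv_continuous Hd e0.
by exists eta => // w /H; apply: le_lt_trans; exact: dist_normc_le.
Qed.

Lemma ccont_realD (h k : C -> R) : ccont_real h -> ccont_real k ->
  ccont_real (fun z => h z + k z).
Proof.
move=> Hh Hk z e e0; have e2 : 0 < e / 2 by rewrite divr_gt0.
have [a a0 {}Hh] := Hh z _ e2; have [b b0 {}Hk] := Hk z _ e2.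
exists (Num.min a b); first by rewrite lt_min a0.
move=> w; rewrite lt_min => /andP[/Hh{}Hh /Hk{}Hk].
have -> : h w + k w - (h z + k z) = (h w - h z) + (k w - k z) by ring.
apply: (le_lt_trans (ler_normD _ _)); lra.
Qed.

Lemma cexp_period z : cexp (z + (2 * pi) *i) = cexp z.
Proof.
rewrite cexpD [X in _ * X](_ : _ = 1) ?mulr1 // /cexp /= expR0 !mul1r.
by rewrite mulr_natl cos2pi sin2pi.
Qed.

Lemma pi2_gt0 : 0 < 2 * pi :> R.
Proof. by rewrite mulr_gt0 // pi_gt0. Qed.

(* Goursat applied to [w |-> f (z0 + exp w)], which has period [2 i pi]: the
   circle means about [z0] do not depend on the radius [exp x]; let [x] tend to
   minus infinity. *)
Lemma mean_value f z0 (x : R) : centire f ->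
  cint (vline (fun w => f (z0 + cexp w)) x) 0 (2 * pi) = (2 * pi)%:C * f z0.
Proof.
move=> cf; set k := fun w => _; set V := cint _ _ _.
have ck : centire k.
  apply: (centire_comp (g := fun w => z0 + cexp w)) => //.
  by apply: centireD; [exact: centire_cst|exact: centire_cexp].
have VE a : a <= x -> cint (vline k a) 0 (2 * pi) = V.
  move=> ax; have w0 : 0 <= x - a by lra.
  have := goursat a 0 w0 (ltW pi2_gt0) ck.
  rewrite add0r /rectint [a + _]addrC subrK.
  have -> : hline k (2 * pi) = hline k 0.
    apply/funext => t; rewrite /hline /k -(cexp_period (t +i* 0)).
    by congr (f (z0 + cexp _)); apply: ReIm_eq => /=; ring.
  have i0 : ('i : C) != 0 by rewrite -normc_gt0 normc_i.
  rewrite subrr add0r => /eqP; rewrite mulf_eq0 (negPf i0) /= subr_eq0.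
  by move=> /eqP E; rewrite /V -E.
apply/eqP; rewrite -subr_eq0 -normc_eq0 eq_le normc_ge0 andbT.
apply/ler_addgt0Pr => e e0; rewrite add0r.
have e1 : 0 < e / (2 * pi) by rewrite divr_gt0 // pi2_gt0.
have [d Hd] := cf z0; have [eta eta0 H] := has_cderiv_continuous Hd e1.
pose a := Num.min x (ln (eta / 2)).
have ax : a <= x by rewrite ge_min lexx.
have aeta : expR a < eta.
  have : expR a <= eta / 2.
    by rewrite -[eta / 2]lnK ?posrE ?divr_gt0 // ler_expR ge_min lexx orbT.
  lra.
rewrite -(VE a ax).
have cv : ccontinuous (vline k a) by exact: vline_ccontinuous.
have cc : ccontinuous (fun _ : R => - f z0) by split; exact: cst_continuous.
have -> : cint (vline k a) 0 (2 * pi) - (2 * pi)%:C * f z0 =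
    cint (fun t => vline k a t + - f z0) 0 (2 * pi).
  rewrite (cintD (ltW pi2_gt0) cv cc); congr (_ + _).
  rewrite (@cint_eq _ (fun t => - f z0 * t%:C) _ _ _ (ltW pi2_gt0)).
    by rewrite mulr0 subr0 mulNr mulrC.
  by split; have := @rprim_cst R; move=> H0;
    [have := H0 (Re (- f z0)) 0 (2 * pi)|have := H0 (Im (- f z0)) 0 (2 * pi)];
    congr rprim; apply/funext => t; rewrite !(ReM, ImM) /=; ring.
have cvc : ccontinuous (fun t => vline k a t + - f z0).
  have : centire (fun w => k w + - f z0) by apply: centireD => //; exact: centire_cst.
  exact: vline_ccontinuous.
have -> : e = e / (2 * pi) * (2 * pi - 0).
  by rewrite subr0 divfK // gt_eqF // pi2_gt0.
apply: normc_cint_le_cst => //; first exact: ltW pi2_gt0.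
move=> t _; apply/ltW/H; rewrite /vline /k [z0 + _]addrC addrK.
by rewrite normc_cexp.
Qed.

Definition circle_pt z (r t : R) : C := z + (r * cos t) +i* (r * sin t).

(** The bound may vary along the circle: in [maximum_modulus] it contains trigonometric terms, which
    integrate to 0 over a period. *)
Lemma mean_value_le f z0 (r : R) (phi Phi : R -> R) : 0 < r -> centire f ->
  rprim Phi phi 0 (2 * pi) ->
  (forall t, normc (f (circle_pt z0 r t)) <= phi t) ->
  2 * pi * normc (f z0) <= Phi (2 * pi) - Phi 0.
Proof.
move=> r0 cf HPhi H.
have -> : 2 * pi * normc (f z0) = normc ((2 * pi)%:C * f z0).
  by rewrite normcM normcR ger0_norm // ltW // pi2_gt0.
rewrite -(mean_value z0 (ln r) cf); apply: (normc_cint_le _ _ HPhi).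
- exact: ltW pi2_gt0.
- apply: vline_ccontinuous; apply: (centire_comp (g := fun w => z0 + cexp w)) => //.
  by apply: centireD; [exact: centire_cst|exact: centire_cexp].
move=> t _; have := H t; rewrite /vline /circle_pt /cexp /= lnK ?posrE //.
Qed.

Lemma circle_ptE z r t : normc (circle_pt z r t) ^+ 2 =
  normc z ^+ 2 + r ^+ 2 + 2 * r * (Re z * cos t + Im z * sin t).
Proof.
rewrite !normc_sqr /circle_pt ReD ImD /=; have := cos2Dsin2 t => E.
transitivity (Re z ^+ 2 + Im z ^+ 2 + r ^+ 2 * (cos t ^+ 2 + sin t ^+ 2)
  + 2 * r * (Re z * cos t + Im z * sin t)); first by ring.
by rewrite E mulr1.
Qed.

Lemma normc_circle_pt z r t : 0 <= r -> normc (circle_pt z r t - z) = r.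
Proof.
move=> r0; rewrite /circle_pt [z + _]addrC addrK normc_sqrtE /= !exprMn -mulrDr.
by rewrite cos2Dsin2 mulr1 sqrtr_sqr ger0_norm.
Qed.

Lemma mean_modulus_le f z0 (r M : R) : 0 < r -> centire f ->
  (forall z, normc (z - z0) = r -> normc (f z) <= M) -> normc (f z0) <= M.
Proof.
move=> r0 cf H; have := mean_value_le (z0 := z0) r0 cf (@rprim_cst _ M 0 (2 * pi)).
have Hc t : normc (f (circle_pt z0 r t)) <= M.
  by apply: H; rewrite normc_circle_pt // ltW.
move=> /(_ Hc) {}H; rewrite -(ler_pM2l pi2_gt0); apply: le_trans H _.
by rewrite mulr0 subr0 mulrC.
Qed.

(* At an interior maximum of [|f| + del |z|^2] the circle mean of this function
   would exceed its central value by [del r^2]. *)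
Lemma maximum_modulus f (a b c d M : R) : a <= b -> c <= d -> centire f ->
  (forall z, inrect a b c d z ->
     [\/ Re z = a, Re z = b, Im z = c | Im z = d] -> normc (f z) <= M) ->
  forall z, inrect a b c d z -> normc (f z) <= M.
Proof.
move=> ab cd cf HM z1 z1r; rewrite leNgt; apply/negP => Hz1.
have cq : ccont_real (fun z => normc z ^+ 2).
  have : centire (fun z => z * z) by apply: centireM; exact: centire_id.
  move=> /ccont_real_normc; congr ccont_real.
  by apply/funext => z; rewrite normcM expr2.
have [zB _ HB] := rect_max ab cd cq.
set B := normc zB ^+ 2 in HB; have B0 : 0 <= B by rewrite exprn_ge0 // normc_ge0.
(* The perturbation [del |z|^2] stays below the excess [|f z1| - M] on the whole rectangle. A
   maximum [z2] of the perturbed function then still has [|f z2| > M], hence is not on the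
   boundary. *)
pose del := (normc (f z1) - M) / (2 * (B + 1)).
have B1 : 0 < 2 * (B + 1) by lra.
have del0 : 0 < del by rewrite divr_gt0 //; lra.
have delB : del * (2 * (B + 1)) = normc (f z1) - M.
  by rewrite divfK // gt_eqF.
have cu : ccont_real (fun z => normc (f z) + normc (del%:C * (z * z))).
  apply: ccont_realD; first exact: ccont_real_normc.
  apply: ccont_real_normc; apply: centireM; first exact: centire_cst.
  by apply: centireM; exact: centire_id.
have [z2 z2r Hmax] := rect_max ab cd cu.
have wE z : normc (del%:C * (z * z)) = del * normc z ^+ 2.
  by rewrite !normcM normcR gtr0_norm // expr2.
have {}Hmax z : inrect a b c d z ->
    normc (f z) + del * normc z ^+ 2 <= normc (f z2) + del * normc z2 ^+ 2.
  by move=> /Hmax; rewrite !wE.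
have Hz2 : M < normc (f z2).
  have := Hmax _ z1r; have := mulr_ge0 (ltW del0) (exprn_ge0 2 (normc_ge0 z1)).
  have : del * normc z2 ^+ 2 <= del * B by rewrite ler_wpM2l ?(ltW del0) // HB.
  have : 0 < del * (B + 2) by rewrite mulr_gt0 //; lra.
  lra.
have [/andP[x1 x2] /andP[y1 y2]] := z2r.
have xa : a < Re z2.
  rewrite lt_neqAle x1 andbT; apply/eqP => E.
  by move: Hz2; rewrite ltNge HM //; apply: Or41.
have xb : Re z2 < b.
  rewrite lt_neqAle x2 andbT; apply/eqP => E.
  by move: Hz2; rewrite ltNge HM //; apply: Or42.
have yc : c < Im z2.
  rewrite lt_neqAle y1 andbT; apply/eqP => E.
  by move: Hz2; rewrite ltNge HM //; apply: Or43.
have yd : Im z2 < d.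
  rewrite lt_neqAle y2 andbT; apply/eqP => E.
  by move: Hz2; rewrite ltNge HM //; apply: Or44.
pose r := Num.min (Num.min (Re z2 - a) (b - Re z2)) (Num.min (Im z2 - c) (d - Im z2)).
have r0 : 0 < r by rewrite !lt_min !subr_gt0 xa xb yc yd.
have rr : [/\ r <= Re z2 - a, r <= b - Re z2, r <= Im z2 - c & r <= d - Im z2].
  by split; rewrite !ge_min lexx ?orbT.
(* [phi] is the bound for [|f|] on the circle that maximality at [z2] provides. Its trigonometric
   part has mean 0, so its mean is [K < |f z2|], against the mean value inequality. *)
pose K := normc (f z2) - del * r ^+ 2.
pose phi t := K - 2 * del * r * (Re z2 * cos t + Im z2 * sin t).
pose Phi t := K * t - 2 * del * r * (Re z2 * sin t - Im z2 * cos t).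
have HPhi : rprim Phi phi 0 (2 * pi).
  apply: rprimB; first exact: rprim_cst.
  apply: (rprimZ (P := fun t => Re z2 * sin t - Im z2 * cos t)
    (g := fun t => Re z2 * cos t + Im z2 * sin t)) => t _.
  have := is_deriveB (is_deriveZ (Re z2) (is_derive_sin t)) (is_deriveZ (Im z2) (is_derive_cos t)).
  by congr is_derive; rewrite /GRing.scale /=; ring.
have := mean_value_le (z0 := z2) r0 cf HPhi.
rewrite /Phi mulr_natl sin2pi cos2pi sin0 cos0 -mulr_natl.
have P0 : 0 < del * r ^+ 2 * (2 * pi).
  by rewrite mulr_gt0 ?pi2_gt0 // mulr_gt0 // exprn_gt0.
suff Hc t : normc (f (circle_pt z2 r t)) <= phi t by move=> /(_ Hc); rewrite /K; lra.
have := Hmax (circle_pt z2 r t); rewrite circle_ptE.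
have := normc_circle_pt z2 t (ltW r0) => nr.
have := Re_le_normc (circle_pt z2 r t - z2); have := Im_le_normc (circle_pt z2 r t - z2).
rewrite nr ReD ImD ReN ImN !ler_norml => /andP[i1 i2] /andP[i3 i4].
case: rr => r1 r2 r3 r4.
have -> : phi t = normc (f z2) + del * normc z2 ^+ 2 -
   del * (normc z2 ^+ 2 + r ^+ 2 + 2 * r * (Re z2 * cos t + Im z2 * sin t)).
  by rewrite /phi /K; ring.
rewrite lerBrDr; apply; split; lra.
Qed.

End MaximumModulus.

(** * The Gamma function as Euler's limit *)

Section GammaFunction.
Context {R : realType}.
Local Notation C := R[i].
Local Notation Re := complex.Re.
Local Notation Im := complex.Im.
Implicit Types (z w : C).

Lemma mean_value_bound (f f' : C -> C) (z v : C) (M : R) :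
  (forall w, has_cderiv f w (f' w)) -> centire f' ->
  (forall t : R, 0 <= t <= 1 -> normc (f' (z + t%:C * v)) <= M) ->
  normc (f (z + v) - f z) <= M * normc v.
Proof.
move=> Hf cf' HM; have := cint_eq ler01 (cprim_line z v 0 1 Hf).
rewrite mul1r mul0r addr0 => <-.
have := @normc_cint_le_cst R (fun t => f' (z + t%:C * v) * v) (M * normc v) 0 1 ler01.
rewrite subr0 mulr1; apply.
  apply: (line_ccontinuous (f := fun w => f' w * v)).
  by apply: centireM => //; exact: centire_cst.
by move=> t t01; rewrite normcM ler_wpM2r ?normc_ge0 // HM.
Qed.

Lemma normc_scale_le (t : R) z : 0 <= t <= 1 -> normc (t%:C * z) <= normc z.
Proof.
move=> /andP[t0 t1]; rewrite normcM normcR ger0_norm //.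
by rewrite ler_piMl ?normc_ge0.
Qed.

Lemma cexp_order1 z : normc (cexp z - 1) <= expR (normc z) * normc z.
Proof.
have := @mean_value_bound cexp cexp 0 z (expR (normc z)) (@has_cderiv_cexp R) (@centire_cexp R).
rewrite add0r cexp0; apply => t t01; rewrite add0r normc_cexp ler_expR.
by rewrite (le_trans (ler_norm _)) // (le_trans (Re_le_normc _)) // normc_scale_le.
Qed.

Lemma cexp_order2 z : normc (cexp z - 1 - z) <= expR (normc z) * normc z ^+ 2.
Proof.
have Hf w : has_cderiv (fun w => cexp w - w) w (cexp w - 1).
  by apply: has_cderivB; [exact: has_cderiv_cexp|exact: has_cderiv_id].
have cf : centire (fun w : C => cexp w - 1).
  by apply: centireD; [exact: centire_cexp|exact: centire_cst].
have := @mean_value_bound _ _ 0 z (expR (normc z) * normc z) Hf cf.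
rewrite add0r cexp0 subr0 -mulrA -expr2 addrAC; apply => t t01.
rewrite add0r; apply: (le_trans (cexp_order1 _)).
apply: ler_pM; rewrite ?expR_ge0 ?normc_ge0 ?normc_scale_le //.
by rewrite ler_expR normc_scale_le.
Qed.

Definition euler z (n : nat) : C :=
  n`!%:R * cpow n%:R z / \prod_(0 <= k < n.+1) (z + k%:R).

Definition gamma_regular z := forall k : nat, z + k%:R != 0.

Lemma normc_euler z n : normc (euler z n) =
  n`!%:R * expR (ln n%:R * Re z) / \prod_(0 <= k < n.+1) normc (z + k%:R).
Proof. by rewrite /euler !normcM normcV normc_nat normc_cpow normc_prod. Qed.

Definition euler_ratio z (n : nat) : C :=
  cexp ((ln (n.+1%:R / n%:R))%:C * z) / (1 + z / n.+1%:R).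

Lemma eulerS z n : gamma_regular z -> (0 < n)%N ->
  euler z n.+1 = euler z n * euler_ratio z n.
Proof.
move=> rz n0; rewrite /euler /euler_ratio big_nat_recr //= factS natrM.
have P0 : \prod_(0 <= k < n.+1) (z + k%:R) != 0.
  by rewrite prodf_seq_neq0; apply/allP => k _; exact: rz.
have n1 : n.+1%:R != 0 :> C by rewrite pnatr_eq0.
have -> : 1 + z / n.+1%:R = (z + n.+1%:R) / n.+1%:R.
  by rewrite mulrDl divff // addrC.
have -> : cpow n.+1%:R z = cpow n%:R z * cexp ((ln (n.+1%:R / n%:R))%:C * z).
  rewrite /cpow -cexpD -mulrDl -rmorphD /= ln_div ?posrE ?ltr0n //.
  by rewrite [ln n%:R + _]addrC subrK.
have r1 := rz n.+1; move: (z + n.+1%:R) r1 => zn r1.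
move: (n.+1%:R) n1 => m n1; by field; rewrite n1 P0 r1.
Qed.

Lemma ln_ratio_bounds n : (0 < n)%N ->
  (n.+1%:R)^-1 <= ln (n.+1%:R / n%:R : R) <= n%:R^-1.
Proof.
move=> n0; have n0R : 0 < n%:R :> R by rewrite ltr0n.
have n1R : 0 < n.+1%:R :> R by rewrite ltr0n.
apply/andP; split.
  rewrite -lerN2 -lnV ?posrE ?divr_gt0 // invf_div.
  have -> : n%:R / n.+1%:R = 1 + (- (n.+1%:R)^-1) :> R.
    by rewrite -natr1; field; rewrite natr1 gt_eqF.
  apply: le_ln1Dx; rewrite ltrN2 invf_lt1 // ltr1n ltnS //.
have -> : n.+1%:R / n%:R = 1 + n%:R^-1 :> R.
  by rewrite -natr1; field; rewrite gt_eqF.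
by apply: le_ln1Dx; rewrite (lt_le_trans (ltrN10 R)) // invr_ge0 ltW.
Qed.

(** With [l = ln (1 + 1/n)], [exp (l z)] and [1 + z / (n + 1)] agree to first order, since
    [l - 1 / (n + 1)] is at most [1/n - 1/(n + 1)]. The quadratic error of the exponential is of the
    same order [n^-2], and [2 B <= n] keeps the denominator above 1/2. *)
Lemma euler_ratio_bound (B : R) z n : 1 <= B -> normc z <= B -> 2 * B <= n%:R ->
  normc (euler_ratio z n - 1) <= 2 * (expR 1 * B ^+ 2 + B) / n%:R ^+ 2.
Proof.
move=> B1 zB nB; have B0 : 0 < B by lra.
have n0R : 0 < n%:R :> R by lra.
have n0 : (0 < n)%N by rewrite -(ltr0n R).
have n1R : 0 < n.+1%:R :> R by rewrite ltr0n.
have nn1 : n%:R <= n.+1%:R :> R by rewrite ler_nat.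
have /andP[l1 l2] := ln_ratio_bounds n0.
rewrite /euler_ratio; set l := ln _ in l1 l2 *.
have l0 : 0 <= l by apply: le_trans l1; rewrite invr_ge0 ltW.
have zn : normc (z / n.+1%:R) <= 1 / 2.
  rewrite normcM normcV normc_nat ler_pdivrMr //; lra.
have D1 : 1 / 2 <= normc (1 + z / n.+1%:R).
  have := normc_sub_le 1 (- (z / n.+1%:R)).
  by rewrite opprK normcN (normcR 1) normr1; lra.
have D0 : 1 + z / n.+1%:R != 0 by rewrite -normc_gt0; lra.
have lz : normc (l%:C * z) <= B / n%:R.
  by rewrite normcM normcR ger0_norm // mulrC ler_pM ?normc_ge0.
have lz1 : normc (l%:C * z) <= 1.
  by apply: (le_trans lz); rewrite ler_pdivrMr //; lra.
have -> : cexp (l%:C * z) / (1 + z / n.+1%:R) - 1 =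
  ((cexp (l%:C * z) - 1 - l%:C * z) + (l - n.+1%:R^-1)%:C * z) / (1 + z / n.+1%:R).
  set D := 1 + _ in D0 *; rewrite -[X in _ - X](divff D0) -mulrBl.
  by rewrite rmorphB /= fmorphV rmorph_nat; congr (_ / _); rewrite /D; ring.
rewrite normcM normcV ler_pdivrMr; last lra.
apply: (le_trans (le_normcD _ _)).
have u1 : normc (cexp (l%:C * z) - 1 - l%:C * z) <= expR 1 * B ^+ 2 / n%:R ^+ 2.
  apply: (le_trans (cexp_order2 _)); rewrite -mulrA -expr_div_n.
  apply: ler_pM; rewrite ?expR_ge0 ?exprn_ge0 ?normc_ge0 ?ler_expR //.
  by rewrite lerXn2r ?nnegrE ?normc_ge0 // divr_ge0 // ltW.
have u2 : normc ((l - n.+1%:R^-1)%:C * z) <= B / n%:R ^+ 2.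
  rewrite normcM normcR ger0_norm ?subr_ge0 // mulrC ler_pM ?normc_ge0 ?subr_ge0 //.
  apply: (@le_trans _ _ (n%:R^-1 - n.+1%:R^-1)); first by rewrite lerD2r.
  have -> : n%:R^-1 - n.+1%:R^-1 = (n%:R * n.+1%:R)^-1 :> R.
    by rewrite -natr1; field; rewrite natr1 !gt_eqF.
  by rewrite lef_pV2 ?posrE ?mulr_gt0 ?exprn_gt0 // expr2 ler_pM2l.
have X0 : 0 <= (expR 1 * B ^+ 2 + B) / n%:R ^+ 2.
  by rewrite divr_ge0 ?exprn_ge0 ?addr_ge0 ?mulr_ge0 ?expR_ge0 ?exprn_ge0 // ltW.
apply: (@le_trans _ _ ((expR 1 * B ^+ 2 + B) / n%:R ^+ 2)).
  by rewrite mulrDl lerD.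
have -> : 2 * (expR 1 * B ^+ 2 + B) / n%:R ^+ 2 * normc (1 + z / n.+1%:R)
  = (expR 1 * B ^+ 2 + B) / n%:R ^+ 2 * (2 * normc (1 + z / n.+1%:R)) by ring.
by rewrite ler_peMr //; lra.
Qed.

(* The increments are dominated by a telescoping sequence, so that real and
   imaginary parts lie in nested intervals. *)
Lemma cvg_of_increments (E : nat -> C) (K : R) (N : nat) : (1 < N)%N -> 0 <= K ->
  (forall n, (N <= n)%N ->
     normc (E n.+1 - E n) <= K * (n.-1%:R^-1 - n%:R^-1)) ->
  exists l, forall n, (N <= n)%N -> normc (E n - l) <= 2 * K / n.-1%:R.
Proof.
move=> N1 K0 H.
have main (h : nat -> R) : (forall n, (N <= n)%N -> `|h n.+1 - h n| <= K * (n.-1%:R^-1 - n%:R^-1)) ->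
    exists X, forall n, (N <= n)%N -> `|h n - X| <= K / n.-1%:R.
  move=> Hh; have [|||X HX] := @nested_intervals R (fun n => h (n + N)%N - K / (n + N).-1%:R)
     (fun n => 2 * K / (n + N).-1%:R).
  - move=> n; have := Hh (n + N)%N (leq_addl _ _); rewrite ler_norml => /andP[+ _].
    by rewrite addSn /= mulrBr; lra.
  - move=> n; have := Hh (n + N)%N (leq_addl _ _); rewrite ler_norml => /andP[_].
    by rewrite addSn /= mulrBr; lra.
  - by move=> n; rewrite divr_ge0 // mulr_ge0.
  exists X => n Nn; have := HX (n - N)%N; rewrite subnK // => /andP[? ?].
  by rewrite ler_norml; apply/andP; split; lra.
have [n Nn|X HX] := main (fun n => Re (E n)).
  by apply: le_trans (H n Nn); rewrite -ReN -ReD Re_le_normc.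
have [n Nn|Y HY] := main (fun n => Im (E n)).
  by apply: le_trans (H n Nn); rewrite -ImN -ImD Im_le_normc.
exists (X +i* Y) => n Nn; apply: (le_trans (normc_le_ReIm _)).
rewrite ReD ImD ReN ImN /=; have := HX n Nn; have := HY n Nn; lra.
Qed.

(** By [1 / n^2 <= 1 / (n - 1) - 1 / n], the relative increments from [N] on sum to at most
    [K / (N - 1) <= 1/4]. Inductively [|E n| <= 2 |E N|], so [E n] stays within [|E N| / 2] of
    [E N]. This gives convergence and, at the same time, a lower bound for the limit, from which
    Gamma is seen not to vanish. *)
Lemma cvg_of_ratios (E : nat -> C) (K : R) (N : nat) : (1 < N)%N -> 0 <= K ->
  4 * K <= N.-1%:R ->
  (forall n, (N <= n)%N -> normc (E n.+1 - E n) <= normc (E n) * (K / n%:R ^+ 2)) ->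
  exists l, (forall e : R, 0 < e -> exists M, forall n, (M <= n)%N -> normc (E n - l) < e)
    /\ normc (E N) / 2 <= normc l.
Proof.
move=> N1 K0 KN H.
have pos n : (N <= n)%N -> 0 < n.-1%:R :> R /\ 0 < n%:R :> R.
  move=> Nn; rewrite !ltr0n -subn1 subn_gt0 (leq_trans N1 Nn).
  by rewrite (leq_trans (ltnW N1) Nn).
have sq n : (N <= n)%N -> n%:R ^- 2 <= n.-1%:R^-1 - n%:R^-1 :> R.
  move=> Nn; have [n1 n0] := pos _ Nn.
  have E1 : n%:R = n.-1%:R + 1 :> R.
    by rewrite natr1 prednK // -(ltr0n R).
  have -> : n.-1%:R^-1 - n%:R^-1 = (n.-1%:R * n%:R)^-1 :> R.
    by rewrite E1; field; rewrite -E1 !gt_eqF.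
  rewrite lef_pV2 ?posrE ?exprn_gt0 ?mulr_gt0 // expr2 ler_pM2r //; lra.
have [N1' _] := pos _ (leqnn N).
have b n : (N <= n)%N -> normc (E n - E N) <=
    2 * K * normc (E N) * (N.-1%:R^-1 - n.-1%:R^-1).
  elim: n => [|n IH]; first by rewrite leqn0 => /eqP N0; rewrite N0 in N1.
  rewrite leq_eqVlt => /orP[/eqP <-|]; first by rewrite !subrr mulr0 normcR normr0.
  rewrite ltnS => Nn; have {}IH := IH Nn; have [p1 p2] := pos _ Nn.
  have En : normc (E n) <= 2 * normc (E N).
    have := normc_sub_le (E n) (E N).
    have : 2 * K * normc (E N) * (N.-1%:R^-1 - n.-1%:R^-1) <= normc (E N).
      apply: (@le_trans _ _ (2 * K * normc (E N) * N.-1%:R^-1)).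
        by rewrite ler_wpM2l ?mulr_ge0 ?normc_ge0 // gerBl invr_ge0 ltW.
      rewrite ler_pdivrMr // [2 * K * _]mulrC ler_wpM2l ?normc_ge0 //; lra.
    lra.
  have := normc_telescope (E n.+1) (E n) (E N); have := H n Nn.
  have : normc (E n) * (K / n%:R ^+ 2) <= 2 * normc (E N) * (K * (n.-1%:R^-1 - n%:R^-1)).
    apply: ler_pM; rewrite ?normc_ge0 ?divr_ge0 ?exprn_ge0 //.
    by rewrite ler_wpM2l // sq.
  rewrite /=; lra.
have En n : (N <= n)%N -> normc (E n - E N) <= normc (E N) / 2.
  move=> Nn; apply: (le_trans (b n Nn)); have [p1 p2] := pos _ Nn.
  apply: (@le_trans _ _ (2 * K * normc (E N) * N.-1%:R^-1)).
    by rewrite ler_wpM2l ?mulr_ge0 ?normc_ge0 // gerBl invr_ge0 ltW.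
  rewrite ler_pdivrMr // [2 * K * _]mulrC -mulrA ler_wpM2l ?normc_ge0 //; lra.
have K2 : 0 <= 2 * normc (E N) * K by rewrite !mulr_ge0 ?normc_ge0.
have [n Nn|l Hl] := cvg_of_increments N1 K2 (E := E).
  apply: (le_trans (H n Nn)); rewrite -(mulrA _ K); apply: ler_pM.
  - exact: normc_ge0.
  - by rewrite divr_ge0 ?exprn_ge0.
  - have := normc_sub_le (E n) (E N); have := En n Nn.
    by have := normc_ge0 (E N); lra.
  - by rewrite ler_wpM2l // sq.
exists l; have cv (e : R) : 0 < e -> exists M, forall n, (M <= n)%N -> normc (E n - l) < e.
  move=> e0; set K' := 2 * (2 * normc (E N) * K) in Hl.
  exists (maxn N (Num.truncn (K' / e)).+2) => n; rewrite geq_max => /andP[Nn kn].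
  apply: (le_lt_trans (Hl n Nn)); have [p1 p2] := pos _ Nn.
  rewrite ltr_pdivrMr // mulrC -ltr_pdivrMr //.
  apply: (lt_le_trans (truncnS_gt _)); rewrite ler_nat.
  by rewrite -ltnS prednK // -(ltr0n R).
split => //; apply/ler_addgt0Pr => e e0; have [M HM] := cv e e0.
have := HM (maxn M N) (leq_maxl _ _); have := En (maxn M N) (leq_maxr _ _).
have := normc_telescope (E N) (E (maxn M N)) l; rewrite (normc_distC (E N) (E (maxn M N))).
have := normc_sub_le (E N) l; lra.
Qed.

(** The constant is uniform on [|z| <= B]: the index [N] depends on [B] only, and [|euler z N|] is
    bounded below by estimating each factor [|z + k|] of the denominator by [B + k]. *)
Lemma euler_cvg_lower (B : R) : 1 <= B -> exists2 c : R, 0 < c &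
  forall z, normc z <= B -> gamma_regular z ->
  exists l, (forall e : R, 0 < e -> exists M, forall n, (M <= n)%N -> normc (euler z n - l) < e)
    /\ c <= normc l.
Proof.
move=> B1; pose K := 2 * (expR 1 * B ^+ 2 + B).
have K0 : 0 <= K.
  by rewrite mulr_ge0 // addr_ge0 ?mulr_ge0 ?expR_ge0 ?exprn_ge0 //; lra.
pose N := (Num.truncn (4 * K + 2 * B)).+2.
have NB : 4 * K + 2 * B < N.-1%:R by exact: truncnS_gt.
exists (N`!%:R * expR (- (ln N%:R * B)) / \prod_(0 <= k < N.+1) (B + k%:R) / 2).
  rewrite !divr_gt0 ?mulr_gt0 ?expR_gt0 ?ltr0n ?fact_gt0 //.
  by apply: prodr_gt0 => k _; rewrite ltr_wpDr //; lra.
move=> z zB rz; have [||n Nn|l [cl hl]] := @cvg_of_ratios (euler z) K N _ K0.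
- by [].
- by lra.
- have NnR : N.-1%:R <= n%:R :> R by rewrite ler_nat (leq_trans (leq_pred _)).
  rewrite eulerS //; last exact: leq_trans Nn.
  rewrite -{2}[euler z n]mulr1 -mulrBr normcM ler_wpM2l ?normc_ge0 //.
  by apply: euler_ratio_bound => //; lra.
exists l; split => //; apply: le_trans hl; rewrite ler_pM2r ?invr_gt0 //.
rewrite normc_euler; apply: ler_pM.
- by rewrite mulr_ge0 // ?expR_ge0.
- by rewrite invr_ge0 prodr_ge0 // => k _; rewrite addr_ge0 //; lra.
- rewrite ler_wpM2l // ler_expR -mulrN ler_wpM2l ?ln_ge0 ?ler1n //.
  by have := Re_le_normc z; rewrite ler_norml => /andP[]; lra.
- rewrite lef_pV2 ?posrE.
  + rewrite ler_prod // => k _; rewrite normc_ge0 /=.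
    by apply: (le_trans (le_normcD _ _)); rewrite normc_nat lerD2r.
  + by apply: prodr_gt0 => k _; rewrite ltr_wpDr //; lra.
  + by apply: prodr_gt0 => k _; rewrite normc_gt0 rz.
Qed.

Lemma cGamma_lim z l :
  (forall e : R, 0 < e -> exists M, forall n, (M <= n)%N -> normc (euler z n - l) < e) ->
  cGamma z = l.
Proof.
move=> /cvg_normc H; rewrite /cGamma.
exact: (cvg_lim (@norm_hausdorff _ _) H).
Qed.

Lemma euler_cvg z : gamma_regular z ->
  forall e : R, 0 < e -> exists M, forall n, (M <= n)%N -> normc (euler z n - cGamma z) < e.
Proof.
move=> rz; have B1 : 1 <= 1 + normc z by rewrite lerDl normc_ge0.
have [c _ H] := euler_cvg_lower B1.
have [|l [Hl _]] := H z _ rz; first by rewrite lerDr.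
by rewrite (cGamma_lim Hl).
Qed.

Lemma cGamma_lower (B : R) : exists2 c : R, 0 < c &
  forall z, normc z <= B -> gamma_regular z -> c <= normc (cGamma z).
Proof.
have B1 : 1 <= Num.max 1 B by rewrite le_max lexx.
have [c c0 H] := euler_cvg_lower B1; exists c => // z zB rz.
have [|l [Hl hl]] := H z _ rz; first by rewrite le_max zB orbT.
by rewrite (cGamma_lim Hl).
Qed.

Lemma cGamma_neq0 z : gamma_regular z -> cGamma z != 0.
Proof.
move=> rz; have [c c0 H] := cGamma_lower (normc z).
by rewrite -normc_gt0 (lt_le_trans c0) // H.
Qed.

Lemma gamma_regularD z n : gamma_regular z -> gamma_regular (z + n%:R).
Proof. by move=> H k; rewrite -addrA -natrD. Qed.

Lemma gamma_regular_Re z : 0 < Re z -> gamma_regular z.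
Proof.
move=> z0 k; apply/eqP => /(congr1 (@complex.Re R)); rewrite ReD.
rewrite -(rmorph_nat (real_complex R)) /= => H.
by have : 0 <= k%:R :> R by []; lra.
Qed.

Lemma gamma_regular_Im z : Im z != 0 -> gamma_regular z.
Proof.
move=> z0 k; apply/eqP => /(congr1 (@complex.Im R)); rewrite ImD.
by rewrite -(rmorph_nat (real_complex R)) /= addr0 => /eqP; rewrite (negPf z0).
Qed.

(** The exact defect of [Gamma (z + 1) = z Gamma z] at the [n]-th stage of Euler's limit; the factor
    [1/n] makes it vanish in the limit. *)
Lemma eulerD1 z n : gamma_regular z -> (0 < n)%N ->
  euler (z + 1) n - z * euler z n = - ((z + 1) / n%:R * euler (z + 1) n).
Proof.
move=> rz n0; rewrite /euler cpowD cpow1 ?ltr0n // rmorph_nat.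
have nC : n%:R != 0 :> C by rewrite pnatr_eq0 -lt0n.
have -> : \prod_(0 <= k < n.+1) (z + 1 + k%:R) =
    \prod_(0 <= k < n.+1) (z + k%:R) * (z + n.+1%:R) / z.
  have z0 := rz 0%N; rewrite addr0 in z0; apply: (mulIf z0); rewrite divfK //.
  transitivity (\prod_(0 <= k < n.+2) (z + k%:R)); last by rewrite big_nat_recr.
  rewrite [RHS]big_nat_recl // addr0 mulrC; congr (_ * _).
  by apply: eq_bigr => k _; rewrite -addrA -natr1 [1 + _]addrC.
have P0 : \prod_(0 <= k < n.+1) (z + k%:R) != 0.
  by rewrite prodf_seq_neq0; apply/allP => k _; exact: rz.
have z0 := rz 0%N; rewrite addr0 in z0; have zn := rz n.+1.
rewrite -natr1 in zn *; move: (\prod_(0 <= k < n.+1) _) P0 => P P0.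
move: (n%:R : C) nC zn => m nC zn; field.
by rewrite z0 zn P0 nC.
Qed.

Lemma cGammaD1 z : gamma_regular z -> cGamma (z + 1) = z * cGamma z.
Proof.
move=> rz; have rz1 := gamma_regularD 1 rz.
apply/eqP; rewrite -subr_eq0 -normc_eq0 eq_le normc_ge0 andbT.
apply/ler_addgt0Pr => e e0; rewrite add0r.
pose A := normc (z + 1) * (normc (cGamma (z + 1)) + 1).
have A0 : 0 <= A by rewrite mulr_ge0 ?addr_ge0 ?normc_ge0.
have e1 : 0 < Num.min 1 (e / 3) by rewrite lt_min ltr01 divr_gt0.
have e2 : 0 < e / 3 / (normc z + 1) by rewrite !divr_gt0 // ltr_wpDl ?normc_ge0.
have [M1 H1] := euler_cvg rz1 e1; have [M2 H2] := euler_cvg rz e2.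
pose n := maxn (maxn M1 M2) (Num.truncn (A / (e / 3))).+1.
have n0 : (0 < n)%N by rewrite /n leq_max orbT.
have nR : 0 < n%:R :> R by rewrite ltr0n.
have nM1 : (M1 <= n)%N by rewrite /n !leq_max leqnn.
have nM2 : (M2 <= n)%N by rewrite /n !leq_max leqnn orbT.
have := H1 n nM1; rewrite lt_min => /andP[h1 h2]; have h3 := H2 n nM2.
have hA : A / n%:R <= e / 3.
  rewrite ler_pdivrMr // mulrC -ler_pdivrMr ?divr_gt0 //.
  apply: (le_trans (ltW (truncnS_gt _))); rewrite ler_nat.
  exact: leq_maxr.
have -> : cGamma (z + 1) - z * cGamma z = (cGamma (z + 1) - euler (z + 1) n) +
   ((euler (z + 1) n - z * euler z n) + z * (euler z n - cGamma z)) by ring.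
apply: (le_trans (le_normcD _ _)); rewrite (normc_distC (cGamma (z + 1))).
apply: (@le_trans _ _ (e / 3 + (e / 3 + e / 3))); last lra.
apply: lerD; first exact: ltW.
apply: (le_trans (le_normcD _ _)); apply: lerD.
  rewrite (eulerD1 rz n0) normcN normcM (normcM (z + 1)) normcV normc_nat.
  apply: le_trans hA; rewrite /A -mulrA [_^-1 * _]mulrC mulrA ler_wpM2r ?invr_ge0 // ler_wpM2l ?normc_ge0 //.
  have := normc_sub_le (euler (z + 1) n) (cGamma (z + 1)); lra.
rewrite normcM; apply: (@le_trans _ _ ((normc z + 1) * (e / 3 / (normc z + 1)))).
  by apply: ler_pM; rewrite ?normc_ge0 // ?lerDl // ltW.
by rewrite mulrC divfK // gt_eqF // ltr_wpDl ?normc_ge0.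
Qed.

Lemma cGammaDn z (n : nat) : gamma_regular z ->
  cGamma (z + n%:R) = \prod_(k < n) (z + k%:R) * cGamma z.
Proof.
move=> rz; elim: n => [|n IH]; first by rewrite big_ord0 addr0 mul1r.
rewrite -natr1 addrA cGammaD1; last exact: gamma_regularD.
by rewrite IH big_ord_recr /=; ring.
Qed.

Lemma normc_euler_cvg z : gamma_regular z ->
  (fun n => normc (euler z n)) @ \oo --> normc (cGamma z).
Proof.
move=> rz; apply/cvgrPdist_lt => e e0; have [M H] := euler_cvg rz e0.
exists M => // n /H; apply: le_lt_trans; rewrite normc_distC.
exact: dist_normc_le.
Qed.

(* Termwise in Euler's product: [|z + a + k| / |z + k| <= (x + a + k) / (x + k)]. *)
Lemma cGamma_ratio_le z (a : R) : 0 < Re z -> 0 <= a ->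
  normc (cGamma z) * normc (cGamma (Re z + a)%:C) <=
  normc (cGamma (Re z)%:C) * normc (cGamma (z + a%:C)).
Proof.
move=> x0 a0; have rz := gamma_regular_Re x0.
have r1 : gamma_regular (Re z + a)%:C by apply: gamma_regular_Re => /=; lra.
have r2 : gamma_regular (Re z)%:C by exact: gamma_regular_Re.
have r3 : gamma_regular (z + a%:C) by apply: gamma_regular_Re; rewrite ReD /=; lra.
apply: (ler_cvg_to (cvgM (normc_euler_cvg rz) (normc_euler_cvg r1))
  (cvgM (normc_euler_cvg r2) (normc_euler_cvg r3))).
apply: nearW => n; change (normc (euler z n) * normc (euler (Re z + a)%:C n) <=
  normc (euler (Re z)%:C n) * normc (euler (z + a%:C) n)).
rewrite !normc_euler ReD /=.
set x := Re z; pose Q := \prod_(0 <= k < n.+1) normc (z + k%:R).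
set c := n`!%:R; set e1 := expR _; set e2 := expR _.
have -> : c * e1 / \prod_(0 <= k < n.+1) normc (z + k%:R) *
  (c * e2 / \prod_(0 <= k < n.+1) normc ((x + a)%:C + k%:R)) =
  (c * c * e1 * e2) / \prod_(0 <= k < n.+1) (normc (z + k%:R) * normc ((x + a)%:C + k%:R)).
  by rewrite big_split /= invfM; ring.
have -> : c * e1 / \prod_(0 <= k < n.+1) normc (x%:C + k%:R) *
  (c * e2 / \prod_(0 <= k < n.+1) normc (z + a%:C + k%:R)) =
  (c * c * e1 * e2) / \prod_(0 <= k < n.+1) (normc (x%:C + k%:R) * normc (z + a%:C + k%:R)).
  by rewrite big_split /= invfM; ring.
have pos (w : C) k : gamma_regular w -> 0 < normc (w + k%:R) by move=> rw; rewrite normc_gt0.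
rewrite ler_wpM2l ?mulr_ge0 ?expR_ge0 //.
rewrite lef_pV2 ?posrE; last 2 first.
- by apply: prodr_gt0 => k _; rewrite mulr_gt0 ?pos.
- by apply: prodr_gt0 => k _; rewrite mulr_gt0 ?pos.
rewrite ler_prod // => k _; rewrite mulr_ge0 ?normc_ge0 //=.
have kR (y : R) : 0 <= y -> normc (y%:C + k%:R) = y + k%:R.
  by move=> y0; rewrite -(rmorph_nat (real_complex R)) -rmorphD normcR ger0_norm // addr_ge0.
have xx : 0 < x by [].
rewrite (kR x) ?(kR (x + a)); [|lra|lra].
have k0 : 0 <= k%:R :> R by [].
have t1 : normc (z + a%:C + k%:R) <= normc (z + k%:R) + a.
  by rewrite addrAC (le_trans (le_normcD _ _)) // normcR ger0_norm.
have t2 : x + k%:R <= normc (z + k%:R).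
  have := Re_le_normc (z + k%:R); rewrite ReD -(rmorph_nat (real_complex R)) /=.
  by move=> /(le_trans (ler_norm _)).
have xk : 0 <= x + k%:R by lra.
have := ler_wpM2l xk t1; have := ler_wpM2l a0 t2; lra.
Qed.

End GammaFunction.

(** * Growth in vertical strips *)

Section DirichletSeries.
Context {R : realType}.
Local Notation C := R[i].
Local Notation Re := complex.Re.
Local Notation Im := complex.Im.

(** [S] is the sum of the [|a n| n^-2]. For [n >= N] the remaining factor [n^-(Re s - 2)] is at most
    [N^-(Re s - 2)]. The cutoff [N = 1] gives a uniform bound, [N = 2] exponential decay in
    [Re s]. *)
Lemma dirichlet_tail (n0 : nat) (a : nat -> C) (v2 : C) : (0 < n0)%N ->
  dirichlet_abs_sum n0 a 2 v2 ->
  exists2 S : R, 0 <= S & forall (s v : C) (N : nat), (n0 <= N)%N -> 2 <= Re s ->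
    dirichlet_abs_sum n0 a s v ->
    normc (v - \sum_(n0 <= n < N) a n * cpow n%:R (- s)) <=
      S * expR (- (ln N%:R * (Re s - 2))).
Proof.
move=> n00 [+ _]; set f := fun n => normc (a n * cpow n%:R (- 2)).
have f0 n : 0 <= f n by exact: normc_ge0.
move=> Sfin; pose S := fine (\sum_(n0 <= n <oo) (f n)%:E)%E.
have SE : (\sum_(n0 <= n <oo) (f n)%:E)%E = S%:E.
  rewrite /S fineK // ge0_fin_numE //.
  by apply: nneseries_ge0 => n _ _; rewrite lee_fin.
have partial k : \sum_(n0 <= n < k) f n <= S.
  rewrite -lee_fin -SE -sumEFin; apply: nneseries_lim_ge => n _ _.
  by rewrite lee_fin.
exists S; first by have := partial 0%N; rewrite big_geq //.
move=> s v N nN s2 [_ /cvg_normc cv].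
set b := fun n => a n * cpow n%:R (- s).
have bb n : (N <= n)%N -> normc (b n) <= f n * expR (- (ln N%:R * (Re s - 2))).
  move=> Nn; have N0 : (0 < N)%N by exact: leq_trans nN.
  rewrite /b /f !normcM -mulrA ler_wpM2l ?normc_ge0 // !normc_cpow -expRD ler_expR.
  rewrite !ReN (_ : Re 2 = 2); last by rewrite -(rmorph_nat (real_complex R)).
  have : ln N%:R <= ln n%:R :> R.
    by rewrite ler_ln ?posrE ?ltr0n ?ler_nat // (leq_trans N0).
  move=> /ler_wpM2r => /(_ (Re s - 2)); rewrite subr_ge0 => /(_ s2); lra.
have main k : (N <= k)%N ->
    normc (\sum_(n0 <= n < k) b n - \sum_(n0 <= n < N) b n) <=
    S * expR (- (ln N%:R * (Re s - 2))).
  move=> Nk; rewrite (big_cat_nat nN Nk) /= [X in X - _]addrC addrK.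
  apply: (le_trans (normc_sum _ _ _)).
  apply: (@le_trans _ _ (\sum_(N <= n < k) f n * expR (- (ln N%:R * (Re s - 2))))).
    by rewrite big_nat_cond [leRHS]big_nat_cond; apply: ler_sum => n /andP[/andP[/bb]].
  rewrite -mulr_suml ler_wpM2r ?expR_ge0 //; apply: le_trans (partial k).
  by rewrite (big_cat_nat nN Nk) /= lerDr sumr_ge0.
apply/ler_addgt0Pr => e e0; have [M HM] := cv e e0.
have := HM (maxn M N) (leq_maxl _ _); have := main (maxn M N) (leq_maxr _ _).
have := normc_telescope v (\sum_(n0 <= n < maxn M N) b n) (\sum_(n0 <= n < N) b n).
rewrite (normc_distC v (\sum_(n0 <= n < maxn M N) b n)); lra.
Qed.

(* [phi] multiplied, resp. divided, by [exp (- (2 S / kappa) exp (- kappa (x - 2)))]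
   is monotone. *)
Lemma gronwall (phi dphi : R -> R) (S kappa : R) : 0 < kappa ->
  (forall x : R, 2 <= x -> is_derive x (1 : R) phi (dphi x)) ->
  (forall x, 2 <= x -> `|dphi x| <= 2 * S * expR (- (kappa * (x - 2))) * phi x) ->
  0 <= S -> (forall x, 2 <= x -> 0 <= phi x) ->
  forall x, 2 <= x -> expR (- (2 * S / kappa)) * phi 2 <= phi x /\
    expR (- (2 * S / kappa)) * phi x <= phi 2.
Proof.
move=> k0 Hphi Hd S0 phi0 x x2.
have DE (y : R) : is_derive y (1 : R) (fun y => expR (- (kappa * (y - 2))))
    (- kappa * expR (- (kappa * (y - 2)))).
  have H : is_derive y (1 : R) (fun y => - (kappa * (y - 2))) (- kappa).
    apply/is_derive_eps => e e0; exists 1 => // h _.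
    by rewrite (_ : _ - _ = 0) ?normr0 ?mulr_ge0 ?(ltW e0) //; ring.
  have := @is_derive1_comp R expR (fun y => - (kappa * (y - 2))) y _ _ (is_derive_expR _) H.
  by rewrite mulrC.
have mono (sg : R) : sg = 1 \/ sg = -1 ->
   0 <= sg * (phi x * expR (sg * (- (2 * S / kappa) * expR (- (kappa * (x - 2))))) -
     phi 2 * expR (sg * (- (2 * S / kappa) * expR (- (kappa * (2 - 2)))))).
  move=> sgE.
  pose P (y : R) := phi y * expR (sg * (- (2 * S / kappa) * expR (- (kappa * (y - 2))))).
  pose g (y : R) := expR (sg * (- (2 * S / kappa) * expR (- (kappa * (y - 2))))) *
    (dphi y + sg * (2 * S * expR (- (kappa * (y - 2)))) * phi y).
  have HP : rprim P g 2 x.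
    move=> y /andP[y2 _].
    have H1 := is_deriveZ sg (is_deriveZ (- (2 * S / kappa)) (DE y)).
    have := is_deriveM (Hphi y y2) (@is_derive1_comp R expR
      (fun y => sg * (- (2 * S / kappa) * expR (- (kappa * (y - 2))))) y _ _ (is_derive_expR _) H1).
    congr is_derive; rewrite /GRing.scale /= /g; field.
    by rewrite gt_eqF.
  have [y /andP[y2 _] E] := rprim_mvt x2 HP.
  rewrite -/(P x) -/(P 2) E mulrA mulr_ge0 ?subr_ge0 // /g mulrCA mulr_ge0 ?expR_ge0 //.
  have := Hd y y2; rewrite ler_norml => /andP[].
  by case: sgE => ->; lra.
have := mono 1 (or_introl erefl); have := mono (-1) (or_intror erefl).
rewrite subrr mulr0 oppr0 expR0 !mul1r !mulN1r opprB !mulr1 opprK.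
set K := 2 * S / kappa; have K0 : 0 <= K by rewrite divr_ge0 ?mulr_ge0 // ltW.
set E := expR (- (kappa * (x - 2))).
have E0 : 0 <= E by exact: expR_ge0.
rewrite mulNr opprK => H1 H2.
have p0 := phi0 x x2; have p2 := phi0 2 (lexx _).
split.
  apply: (@le_trans _ _ (phi x * expR (- (K * E)))); first lra.
  by rewrite ler_piMr // expR_le1 oppr_le0 mulr_ge0.
have : phi x <= phi x * expR (K * E).
  by rewrite ler_peMr // -expR0 ler_expR mulr_ge0.
move=> H3; rewrite expRN mulrC ler_pdivrMr ?expR_gt0 //; lra.
Qed.

End DirichletSeries.

(** * Bounds for [F] to the right of the critical strip *)

Section HalfPlane.
Context {R : realType}.
Local Notation C := R[i].
Local Notation Re := complex.Re.
Local Notation Im := complex.Im.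
Variables (F : selberg_sf R) (G : C -> C).
Hypothesis cG : centire G.
Hypothesis GE : forall s, s != 1 -> G s = (s - 1) ^+ sf_m F * F s.

Lemma normc_subr_gt0 (z w : C) : z != w -> 0 < normc (z - w).
Proof. by rewrite normc_gt0 subr_eq0. Qed.

(** Only [G] is given as entire; near a point other than 1, [F] is [G] divided by [(s - 1)^m]. *)
Lemma sf_cderiv s : s != 1 -> has_cderiv F s (derive1 (sf_fun F : C^o -> C^o) s).
Proof.
move=> s1; suff [d Hd] : exists d, has_cderiv F s d.
  by have [_ ->] := cderiv_derivable Hd.
have [dG HG] := cG s.
have Hs : has_cderiv (fun w => w - 1) s (1 - 0).
  by apply: has_cderivB; [exact: has_cderiv_id|exact: has_cderiv_cst].
have s10 : s - 1 != 0 by rewrite subr_eq0.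
have [d Hd] := has_cderivX (sf_m F)
  (has_cderiv_comp (g := fun w => w - 1) (has_cderivV s10) Hs).
eexists; apply: (has_cderiv_near (normc_subr_gt0 s1)) (has_cderivM HG Hd) => w ws.
have w1 : w - 1 != 0.
  rewrite subr_eq0; apply/eqP => E; by move: ws; rewrite E normc_distC ltxx.
rewrite GE; last by rewrite -subr_eq0.
rewrite exprVn mulrC mulrA mulVf ?mul1r //.
exact: expf_neq0.
Qed.

Lemma Re_neq1 (s : C) : 1 < Re s -> s != 1.
Proof. by apply: contraTneq => -> /=; rewrite ltxx. Qed.

Lemma Re2 : Re (2 : C) = 2.
Proof. by rewrite -(rmorph_nat (real_complex R)). Qed.

Lemma sf_upper : exists2 A : R, 0 <= A & forall s, 2 <= Re s -> normc (F s) <= A.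
Proof.
have H2 : 1 < Re (2 : C) by rewrite Re2 ltr1n.
have [S S0 H] := dirichlet_tail (ltn0Sn 0) (sf_dirichlet F H2).
exists S => // s s2; have s1 : 1 < Re s by lra.
have := H s (F s) 1%N (leqnn _) s2 (sf_dirichlet F s1).
by rewrite big_geq // subr0 ln1 mul0r oppr0 expR0 mulr1.
Qed.

Lemma exists_expR_small (kappa theta : R) : 0 < kappa -> 0 < theta ->
  exists2 x, 2 <= x & expR (- (kappa * (x - 2))) <= theta.
Proof.
move=> k0 t0; exists (2 + (theta^-1) / kappa).
  by rewrite lerDl divr_ge0 ?invr_ge0 ?(ltW t0) ?(ltW k0).
rewrite addrAC subrr add0r mulrC divfK ?gt_eqF // expRN.
rewrite -[leRHS]invrK lef_pV2 ?posrE ?expR_gt0 ?invr_gt0 //.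
by apply: le_trans (expR_ge1Dx _); rewrite lerDr.
Qed.

(* By Gronwall applied to [F'/F], [|F (x + i t)|] and [|F (2 + i t)|] are comparable
   uniformly in [t]; as [x] grows, [F (x + i t)] tends to [a(1)], which is therefore
   nonzero. *)
Lemma sf_lower : exists2 c : R, 0 < c & forall t : R, c <= normc (F (2 +i* t)).
Proof.
have H2 : 1 < Re (2 : C) by rewrite Re2 ltr1n.
pose kappa : R := ln 2; have k0 : 0 < kappa by rewrite ln_gt0 // ltr1n.
have [Sa Sa0 Ha] := dirichlet_tail (ltn0Sn 0) (sf_dirichlet F H2).
have [Sc Sc0 Hc] := dirichlet_tail (ltn0Sn 1) (sf_log_derivative F H2).
pose D (s : C) := derive1 (sf_fun F : C^o -> C^o) s / F s.
have HD s : 2 <= Re s -> normc (D s) <= Sc * expR (- (kappa * (Re s - 2))).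
  move=> s2; have s1 : 1 < Re s by lra.
  have := Hc s _ 2%N (leqnn _) s2 (sf_log_derivative F s1).
  by rewrite big_geq // subr0 normcN.
(* With cutoff 2 only the term [a(1)] is left in the partial sum, and the error decays like
   [2^-(Re s - 2)]. *)
have Hlim s : 2 <= Re s -> normc (F s - sf_a F 1) <= Sa * expR (- (kappa * (Re s - 2))).
  move=> s2; have s1 : 1 < Re s by lra.
  have := Ha s _ 2%N (leqW (leqnn _)) s2 (sf_dirichlet F s1).
  by rewrite big_nat1 /cpow ln1 mul0r cexp0 mulr1.
(* Gronwall is applied to the squared modulus, a polynomial in the differentiable functions [Re F]
   and [Im F]. Since [q <= 1] implies [q^2 <= q], the factor [q] obtained for squares also serves
   for moduli. *)
pose phi t x := normc (F (x +i* t)) ^+ 2.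
have phi0 t x : 0 <= phi t x by rewrite exprn_ge0 ?normc_ge0.
have main t x : 2 <= x -> expR (- (2 * Sc / kappa)) * phi t 2 <= phi t x /\
    expR (- (2 * Sc / kappa)) * phi t x <= phi t 2.
  pose z x := x +i* t.
  pose F' x := derive1 (sf_fun F : C^o -> C^o) (z x).
  pose dphi x := 2 * (Re (F (z x)) * Re (F' x) + Im (F (z x)) * Im (F' x)).
  apply: (@gronwall _ (phi t) dphi Sc kappa) => // y y2.
    have y1 : z y != 1 by apply: Re_neq1 => /=; lra.
    have lineE (c : C) : is_derive y (1 : R) (fun x => Re (c * F (z x))) (Re (c * F' y)).
      have := sf_cderiv y1.
      have E u : z u = 0 +i* t + u%:C * 1 by apply: ReIm_eq => /=; ring.
      rewrite {1}E => /(has_cderiv_real c); rewrite mulr1.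
      by congr is_derive; apply/funext => u; rewrite -E.
    have i1 := lineE 1; have i2 := lineE (- 'i).
    have := is_deriveD (is_deriveM i1 i1) (is_deriveM i2 i2).
    have -> : phi t = (fun x => Re (1 * F (z x))) * (fun x => Re (1 * F (z x))) +
        (fun x => Re (- 'i * F (z x))) * (fun x => Re (- 'i * F (z x))).
      apply/funext => u; rewrite /phi normc_sqr.
      transitivity (Re (1 * F (z u)) * Re (1 * F (z u)) +
        Re (- 'i * F (z u)) * Re (- 'i * F (z u))) => //.
      by rewrite -/(z u) mul1r ReM /=; ring.
    congr is_derive; rewrite /dphi /GRing.scale /= !ReM /=; ring.
  have z1 : 1 < Re (z y) by rewrite /=; lra.
  have FE : F' y = D (z y) * F (z y) by rewrite /D divfK // sf_nonvanishing.
  have -> : dphi y = 2 * (Re (D (z y)) * phi t y).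
    by rewrite /dphi FE /phi normc_sqr (ReM (D (z y))) (ImM (D (z y))) -/(z y); ring.
  rewrite normrM gtr0_norm // -!mulrA ler_pM2l // mulrA normrM (ger0_norm (phi0 _ _)).
  rewrite ler_wpM2r //; apply: (le_trans (Re_le_normc _)); exact: HD.
set q := expR _ in main; have q0 : 0 < q by exact: expR_gt0.
have q1 : q <= 1 by rewrite expR_le1 oppr_le0 divr_ge0 ?mulr_ge0 // ltW.
have F20 : 0 < normc (F (2 +i* 0)) by rewrite normc_gt0 sf_nonvanishing //= ltr1n.
have mainN t x : 2 <= x -> q * normc (F (2 +i* t)) <= normc (F (x +i* t)) /\
    q * normc (F (x +i* t)) <= normc (F (2 +i* t)).
  move=> x2; have [m1 m2] := main t x x2.
  have qq : q ^+ 2 <= q by rewrite expr2 ler_piMl // ltW.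
  have qn y : 0 <= q * normc y by rewrite mulr_ge0 ?normc_ge0 // ltW.
  split; rewrite -(@ler_pXn2r _ 2) ?nnegrE ?normc_ge0 // exprMn.
    by apply: le_trans m1; rewrite ler_wpM2r // exprn_ge0 ?normc_ge0.
  by apply: le_trans m2; rewrite ler_wpM2r // exprn_ge0 ?normc_ge0.
(* At abscissa [x] each value of [F] then differs from [a(1)] by at most a quarter of [q |F 2|]. As
   [|F x| >= q |F 2|], every [|F (x + i t)|] is at least half of [q |F 2|]. *)
pose th := q * normc (F (2 +i* 0)) / (4 * (Sa + 1)).
have th0 : 0 < th by rewrite divr_gt0 ?mulr_gt0 //; lra.
have [x x2 xth] := exists_expR_small k0 th0.
exists (q * (q * normc (F (2 +i* 0)) / 2)); first by rewrite !mulr_gt0 // invr_gt0.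
move=> t; have [_] := mainN t x x2; apply: le_trans; rewrite ler_pM2l //.
have [m0 _] := mainN 0 x x2.
have small s : Re s = x -> normc (F s - sf_a F 1) <= q * normc (F (2 +i* 0)) / 4.
  move=> sx; have := Hlim s; rewrite sx => /(_ x2) /le_trans; apply.
  apply: (@le_trans _ _ ((Sa + 1) * th)).
    by apply: ler_pM; rewrite ?expR_ge0 // lerDl.
  rewrite /th le_eqVlt; apply/orP; left; apply/eqP; field; lra.
have := small (x +i* t) erefl; have := small (x +i* 0) erefl.
have := normc_telescope (F (x +i* 0)) (sf_a F 1) (F (x +i* t)).
rewrite (normc_distC (sf_a F 1) (F (x +i* t))).
have := normc_sub_le (F (x +i* 0)) (F (x +i* t)); lra.
Qed.

End HalfPlane.

(** * Polynomial growth of [F] on a line to the left, by the functional equation *)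

Section LeftLine.
Context {R : realType}.
Local Notation C := R[i].
Local Notation Re := complex.Re.
Local Notation Im := complex.Im.

(* Both arguments have the same ordinate [l t + Im mu]. With [N >= (1 + 2 b) l],
   [|Gamma z'|] is at most a constant times [|Gamma (z + N)|], and the latter is
   [|Gamma z|] times [N] linear factors. *)
Lemma cGamma_shift_growth (l : R) (mu : C) (b : R) : 0 < l -> 0 <= b ->
  0 < l + 2 * Re mu ->
  exists A : R, exists N : nat, 0 <= A /\ forall t : R,
    l * t + Im mu != 0 ->
    normc (cGamma (l%:C * ((1 + b) +i* t) + mu)) <=
    A * (1 + `|t|) ^+ N * normc (cGamma (l%:C * (- b +i* t) + mu)).
Proof.
move=> l0 b0 lmu; pose N := (Num.truncn ((1 + 2 * b) * l)).+1.
have NB : (1 + 2 * b) * l < N%:R by exact: truncnS_gt.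
pose a := N%:R - (1 + 2 * b) * l; have a0 : 0 <= a by rewrite /a; lra.
pose x := l * (1 + b) + Re mu.
have x0 : 0 < x by rewrite /x; have := mulr_ge0 (ltW l0) b0; lra.
have rx : gamma_regular x%:C by exact: gamma_regular_Re.
have rxa : gamma_regular (x + a)%:C by apply: gamma_regular_Re => /=; lra.
have Gxa0 : 0 < normc (cGamma (x + a)%:C) by rewrite normc_gt0 cGamma_neq0.
pose B := l * (1 + b) + normc mu + N%:R.
have B0 : 0 <= B by rewrite !addr_ge0 ?normc_ge0 // mulr_ge0 ?(ltW l0) // addr_ge0.
exists (normc (cGamma x%:C) / normc (cGamma (x + a)%:C) * B ^+ N), N; split.
  by rewrite mulr_ge0 ?divr_ge0 ?exprn_ge0 ?normc_ge0.
move=> t imt; set z' := _ + mu; set z := l%:C * (- b +i* t) + mu.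
have zz' : z' + a%:C = z + N%:R.
  rewrite /z /z' /a -(rmorph_nat (real_complex R)).
  by apply: ReIm_eq; rewrite !(ReD, ImD, ReM, ImM) /=; ring.
have Rez' : Re z' = x by rewrite /z' ReD ReM /=; rewrite /x; ring.
have rz : gamma_regular z.
  apply: gamma_regular_Im; rewrite /z ImD ImM /=.
  by rewrite mul0r addr0.
have := @cGamma_ratio_le R z' a; rewrite Rez' => /(_ x0 a0).
rewrite zz' cGammaDn // normcM => H.
have prodB : normc (\prod_(k < N) (z + k%:R)) <= B ^+ N * (1 + `|t|) ^+ N.
  rewrite normc_prod -exprMn -[X in _ ^+ X]card_ord -prodr_const.
  apply: ler_prod => k _; rewrite normc_ge0 /=.
  apply: (le_trans (le_normcD _ _)); rewrite normc_nat.
  apply: (@le_trans _ _ (l * (b + `|t|) + normc mu + N%:R)).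
    apply: lerD; last by rewrite ler_nat ltnW.
    apply: (le_trans (le_normcD _ _)); rewrite lerD2r normcM normcR gtr0_norm //.
    rewrite ler_wpM2l ?(ltW l0) //; apply: (le_trans (normc_le_ReIm _)) => /=.
    by rewrite normrN ger0_norm.
  have t0 := normr_ge0 t; have := mulr_ge0 (normc_ge0 mu) t0.
  have : 0 <= N%:R * `|t| by rewrite mulr_ge0.
  have : 0 <= l * b * `|t| by rewrite !mulr_ge0 // ltW.
  rewrite /B; lra.
rewrite -(ler_pM2r Gxa0); apply: (le_trans H).
have -> : normc (cGamma x%:C) / normc (cGamma (x + a)%:C) * B ^+ N * (1 + `|t|) ^+ N *
  normc (cGamma z) * normc (cGamma (x + a)%:C) =
  normc (cGamma x%:C) * (B ^+ N * (1 + `|t|) ^+ N * normc (cGamma z)).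
  by field; rewrite gt_eqF.
by rewrite ler_wpM2l ?normc_ge0 // ler_wpM2r ?normc_ge0.
Qed.

Variable (F : selberg_sf R).

Lemma completed_regular_Im (s : C) : Im s != 0 ->
  (forall j : 'I_(sf_r F), sf_lam j * Im s + Im (sf_mu j) != 0) ->
  completed_regular (@sf_lam R F) (@sf_mu R F) s.
Proof.
move=> s0 H; split; first by apply: contraNneq s0 => ->.
move=> j k; apply/eqP => /(congr1 (@complex.Im R)).
rewrite ImD ImM ImN -(rmorph_nat (real_complex R)) /= mul0r addr0 oppr0 => /eqP.
by rewrite (negPf (H j)).
Qed.

(** Take moduli in the functional equation at [s = - b + i t], with [s' = 1 - conj s = 1 + b + i t].
    As [|s'| = |1 - s|] and [|1 - s'| = |s|], the polynomial factors cancel. [|F s'|] is bounded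
    because [1 + b >= 2], and [cGamma_shift_growth] bounds the quotient of the Gamma factors. *)
Lemma sf_left_line (b : R) : 1 <= b -> exists A : R, exists K : nat, exists t0 : R,
  [/\ 0 <= A, 0 < t0 & forall t : R, t0 <= `|t| ->
    normc (F (- b +i* t)) <= A * (1 + `|t|) ^+ K].
Proof.
move=> b1; have b0 : 0 <= b by lra.
have [AF AF0 HF] := sf_upper F.
(* At heights [|t| >= t0] no argument [lambda_j s + mu_j] is real: the functional equation can be
   read literally there, and the Gamma factors are nonzero. *)
pose t0 : R := 1 + \sum_(j < sf_r F) (`|Im (sf_mu j)| / sf_lam j).
have t0j (t : R) : t0 <= `|t| -> t != 0 /\ forall j : 'I_(sf_r F), sf_lam j * t + Im (sf_mu j) != 0.
  move=> tt; have S0 : 0 <= \sum_(j < sf_r F) (`|Im (sf_mu j)| / sf_lam j) :> R.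
    by apply: sumr_ge0 => j _; rewrite divr_ge0 // ltW // sf_lam_gt0.
  split; first by rewrite -normr_gt0; move: tt; rewrite /t0; lra.
  move=> j; apply/eqP => E.
  have lj : 0 < sf_lam j by exact: sf_lam_gt0.
  have Sj : `|Im (sf_mu j)| / sf_lam j <= \sum_(j < sf_r F) (`|Im (sf_mu j)| / sf_lam j).
    rewrite [leRHS](bigD1 j) //= lerDl; apply: sumr_ge0 => i _.
    by rewrite divr_ge0 // ltW // sf_lam_gt0.
  have : `|Im (sf_mu j)| = sf_lam j * `|t|.
    by rewrite -[X in _ = X * _](gtr0_norm lj) -normrM -normrN; congr `|_|; lra.
  move=> E'; move: Sj; rewrite E' mulrC mulKf ?gt_eqF //.
  by move: tt; rewrite /t0; lra.
have Hj (j : 'I_(sf_r F)) : exists p : R * nat, 0 <= p.1 /\ forall t : R,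
    sf_lam j * t + Im (sf_mu j) != 0 ->
    normc (cGamma ((sf_lam j)%:C * ((1 + b) +i* t) + sf_mu j)) <=
    p.1 * (1 + `|t|) ^+ p.2 * normc (cGamma ((sf_lam j)%:C * (- b +i* t) + sf_mu j)).
  have [A [N H]] := cGamma_shift_growth (sf_lam_gt0 j) b0 (sf_lam_mu_gt0 j).
  by exists (A, N).
have [p Hp] := choice Hj.
exists (expR (ln (sf_Q F) * (1 + 2 * b)) * AF * \prod_(j < sf_r F) (p j).1).
exists (\sum_(j < sf_r F) (p j).2)%N, t0; split.
- rewrite !mulr_ge0 ?expR_ge0 //; apply: prodr_ge0 => j _; exact: (Hp j).1.
- by rewrite ltr_wpDr //; apply: sumr_ge0 => j _; rewrite divr_ge0 // ltW // sf_lam_gt0.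
move=> t /t0j[tn0 tj]; set s := - b +i* t.
have s'E : 1 - conjc s = (1 + b) +i* t by apply: ReIm_eq => /=; ring.
have := @sf_functional_equation R F s; rewrite s'E /= => FE.
have {}FE := congr1 (@normc R) (FE (completed_regular_Im (s := s) tn0 tj)
  (completed_regular_Im (s := (1 + b) +i* t) tn0 tj)).
rewrite [RHS]normcM sf_w_unit mul1r normc_conj /completed in FE.
set s' := (1 + b) +i* t in FE s'E.
have n1 : normc s' = normc (1 - s).
  by rewrite -s'E -[RHS]normc_conj rmorphB rmorph1.
have n2 : normc (1 - s') = normc s.
  by rewrite -s'E opprB addrC subrK normc_conj.
rewrite !normcM !normcX n1 n2 !normc_cpow !normc_prod /= in FE.
have sn0 : 0 < normc s by rewrite normc_gt0; apply: contraNneq tn0 => /(congr1 (@complex.Im R)) /= ->.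
have sn1 : 0 < normc (1 - s).
  rewrite normc_gt0; apply: contraNneq tn0 => /(congr1 (@complex.Im R)).
  by rewrite ImD ImN /= add0r => /eqP; rewrite oppr_eq0.
pose P (u : C) : R := \prod_(j < sf_r F) normc (cGamma ((sf_lam j)%:C * u + sf_mu j)).
rewrite -/(P s) -/(P s') in FE.
have Ps : 0 < P s.
  apply: prodr_gt0 => j _; rewrite normc_gt0 cGamma_neq0 //; apply: gamma_regular_Im.
  by rewrite ImD ImM /= mul0r addr0 tj.
have FP : normc (F s) * P s = expR (ln (sf_Q F) * (1 + 2 * b)) * normc (F s') * P s'.
  have -> : expR (ln (sf_Q F) * (1 + 2 * b)) = expR (ln (sf_Q F) * (1 + b)) / expR (ln (sf_Q F) * - b).
    by rewrite -expRN -expRD; congr expR; ring.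
  have e0 : expR (ln (sf_Q F) * - b) != 0 by rewrite gt_eqF ?expR_gt0.
  have c1 : normc s ^+ sf_m F != 0 by rewrite expf_neq0 // gt_eqF.
  have c2 : normc (1 - s) ^+ sf_m F != 0 by rewrite expf_neq0 // gt_eqF.
  move: (normc s ^+ _) (normc (1 - s) ^+ _) c1 c2 FE => x y x0 y0.
  move: (expR (ln _ * - b)) (expR (ln _ * (1 + b))) e0 => q1 q2 q10 FE.
  apply: (mulfI (mulf_neq0 (mulf_neq0 x0 y0) q10)).
  transitivity (x * y * normc (F s) * q1 * P s); first by ring.
  by rewrite FE; field.
rewrite -(ler_pM2r Ps) FP -!mulrA ler_wpM2l ?expR_ge0 //.
apply: ler_pM; rewrite ?normc_ge0 //.
- by apply: prodr_ge0 => j _; exact: normc_ge0.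
- by apply: HF; rewrite /=; lra.
rewrite -prodrXr mulrA -!big_split /=; apply: ler_prod => j _.
by rewrite normc_ge0 /=; exact: ((Hp j).2 t (tj j)).
Qed.

End LeftLine.

(** * The damping factor for the Phragmen-Lindelof argument *)

Section Multiplier.
Context {R : realType}.
Local Notation C := R[i].
Local Notation Re := complex.Re.
Local Notation Im := complex.Im.

(* Doubly exponential decay along vertical strips beats any finite order. *)
Definition damping (kappa : R) (z : C) : C :=
  cexp (- (cexp (kappa *i * z) + cexp ((- kappa) *i * z))).

Lemma normc_damping kappa z : normc (damping kappa z) =
  expR (- ((expR (kappa * Im z) + expR (- (kappa * Im z))) * cos (kappa * Re z))).
Proof.
have E (k : R) : Re (cexp (k *i * z)) = expR (- (k * Im z)) * cos (k * Re z).
  by rewrite /cexp /= ReM ImM /= !mul0r sub0r add0r.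
rewrite /damping normc_cexp ReN ReD !E !mulNr opprK cosN.
by congr expR; ring.
Qed.

Lemma centire_damping kappa : centire (damping kappa).
Proof.
have H (k : C) : centire (fun z => cexp (k * z)).
  apply: (centire_comp (g := fun z => k * z)); first exact: centire_cexp.
  by apply: centireM; [exact: centire_cst|exact: centire_id].
apply: (centire_comp (g := fun z => - (cexp (kappa *i * z) + cexp ((- kappa) *i * z)))).
  exact: centire_cexp.
have -> : (fun z : C => - (cexp (kappa *i * z) + cexp ((- kappa) *i * z))) =
   (fun z => (-1) * (cexp (kappa *i * z) + cexp ((- kappa) *i * z))).
  by apply/funext => z; rewrite mulN1r.
by apply: centireM; [exact: centire_cst|exact: centireD].
Qed.

Lemma cos_ge_half (b : R) : 0 < b -> exists2 kappa, 0 < kappa &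
  forall x, `|x| <= b -> 1 / 2 <= cos (kappa * x).
Proof.
move=> b0; have e0 : 0 < 1 / 2 :> R by lra.
have /is_derive_eps/(_ _ e0)[eta eta0 H] := is_derive_cos (0 : R).
pose m := Num.min 1 eta; have m0 : 0 < m by rewrite lt_min ltr01.
exists (m / (2 * b)); first by rewrite divr_gt0 // mulr_gt0.
move=> x xb.
have kx : `|m / (2 * b) * x| <= m / 2.
  rewrite normrM gtr0_norm ?divr_gt0 ?mulr_gt0 //.
  apply: (@le_trans _ _ (m / (2 * b) * b)).
    by rewrite ler_wpM2l // divr_ge0 ?mulr_ge0 // ltW.
  by rewrite le_eqVlt; apply/orP; left; apply/eqP; field; rewrite gt_eqF.
have m1 : m <= 1 by rewrite ge_min lexx.
have meta : m <= eta by rewrite ge_min lexx orbT.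
have := H (m / (2 * b) * x); rewrite add0r sin0 cos0 oppr0 mul0r subr0.
move=> /(_ _); rewrite ler_norml => K.
have /K/andP[K1 _] : `|m / (2 * b) * x| < eta by lra.
lra.
Qed.

Lemma normc_damping_le kappa z : 0 < kappa -> 1 / 2 <= cos (kappa * Re z) ->
  normc (damping kappa z) <= expR (- (expR (kappa * `|Im z|) / 2)).
Proof.
move=> k0 hc; rewrite normc_damping ler_expR lerN2.
apply: (@le_trans _ _ (expR (kappa * `|Im z|) * (1 / 2))); first by rewrite mul1r.
apply: ler_pM => //; rewrite ?expR_ge0 //.
have [i0|i0] := leP 0 (Im z).
  by rewrite ger0_norm // lerDl expR_ge0.
by rewrite ltr0_norm // mulrN lerDr expR_ge0.
Qed.

Lemma normc_damping_ge kappa b z : 0 < kappa -> `|Im z| <= b ->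
  expR (- (2 * expR (kappa * b))) <= normc (damping kappa z).
Proof.
move=> k0; rewrite ler_norml => /andP[b1 b2].
rewrite normc_damping ler_expR lerN2.
have e1 : expR (kappa * Im z) <= expR (kappa * b) by rewrite ler_expR ler_pM2l.
have e2 : expR (- (kappa * Im z)) <= expR (kappa * b).
  by rewrite ler_expR -mulrN ler_pM2l //; lra.
apply: (@le_trans _ _ ((expR (kappa * Im z) + expR (- (kappa * Im z))) * 1)).
  by rewrite ler_wpM2l ?cos_le1 // addr_ge0 ?expR_ge0.
lra.
Qed.

Lemma expR_ge_sqr (x : R) : 0 <= x -> x ^+ 2 / 4 <= expR x.
Proof.
move=> x0; have -> : expR x = expR (x / 2) ^+ 2.
  by rewrite -expRM_natl; congr expR; field.
have -> : x ^+ 2 / 4 = (x / 2) ^+ 2 by field.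
rewrite lerXn2r ?nnegrE ?expR_ge0 ?divr_ge0 //.
by have := expR_ge1Dx (x / 2); lra.
Qed.

(** Bound [(1 + u)^K] by [exp (K u)] and [exp (kappa u)] from below by [(kappa u)^2 / 4]. Completing
    the square gives [K u <= (kappa u)^2 / 8 + 2 K^2 / kappa^2]. *)
Lemma polynomial_damping (kappa u : R) (K : nat) : 0 < kappa -> 0 <= u ->
  (1 + u) ^+ K * expR (- (expR (kappa * u) / 2)) <= expR (2 * K%:R ^+ 2 / kappa ^+ 2).
Proof.
move=> k0 u0; apply: (@le_trans _ _ (expR (K%:R * u) * expR (- (expR (kappa * u) / 2)))).
  rewrite ler_wpM2r ?expR_ge0 // expRM_natl.
  by rewrite lerXn2r ?nnegrE ?expR_ge0 ?expR_ge1Dx // addr_ge0.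
rewrite -expRD ler_expR.
have := expR_ge_sqr (mulr_ge0 (ltW k0) u0).
have : 0 <= (kappa * u - 4 * K%:R / kappa) ^+ 2 by rewrite sqr_ge0.
have -> : (kappa * u - 4 * K%:R / kappa) ^+ 2 =
  (kappa * u) ^+ 2 - 8 * (K%:R * u) + 8 * (2 * K%:R ^+ 2 / kappa ^+ 2).
  by field; rewrite gt_eqF.
lra.
Qed.

(** For [B <= L] the left side is at most [(2 L)^n], and the term of degree [n + 1] of the
    exponential series exceeds twice that as soon as [L >= c]. *)
Lemma order_damping (kappa B : R) (n : nat) : 0 < kappa ->
  exists2 L0 : R, 0 <= L0 & forall L, L0 <= L ->
    B <= L -> (B + L) ^+ n <= expR (kappa * L) / 2 \/ B < 0.
Proof.
move=> k0; pose c := 2 ^+ n.+1 * n.+1`!%:R / kappa ^+ n.+1.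
have c0 : 0 <= c by rewrite divr_ge0 ?mulr_ge0 ?exprn_ge0 // ltW.
exists c => // L cL BL; have [B0|] := leP 0 B; last by right.
left; have L0 : 0 <= L by exact: le_trans BL.
apply: (@le_trans _ _ ((2 * L) ^+ n)).
  by rewrite lerXn2r ?nnegrE ?addr_ge0 ?mulr_ge0 //; lra.
have := expR_ge1Dxn n (mulr_ge0 (ltW k0) L0).
have : 2 * (2 * L) ^+ n <= (kappa * L) ^+ n.+1 / n.+1`!%:R.
  rewrite ler_pdivlMr ?ltr0n ?fact_gt0 // !exprMn [L ^+ n.+1]exprS.
  have := ler_wpM2r (exprn_ge0 n L0) cL.
  move=> /(ler_wpM2l (exprn_ge0 n.+1 (ltW k0))).
  have -> : kappa ^+ n.+1 * (c * L ^+ n) = 2 * (2 ^+ n * L ^+ n) * n.+1`!%:R.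
    by rewrite /c [2 ^+ n.+1]exprS; field; rewrite expf_neq0 // gt_eqF.
  by [].
lra.
Qed.

End Multiplier.

(** * Polynomial growth of [G] around [2 + i T] *)

Section Growth.
Context {R : realType}.
Local Notation C := R[i].
Local Notation Re := complex.Re.
Local Notation Im := complex.Im.
Variables (F : selberg_sf R) (G : C -> C).
Hypothesis cG : centire G.
Hypothesis oG : finite_order G.
Hypothesis GE : forall s, s != 1 -> G s = (s - 1) ^+ sf_m F * F s.

Lemma normc_line_le (s : R) (t : R) (m : nat) : 
  normc ((s +i* t - 1) ^+ m) <= (1 + `|s - 1|) ^+ m * (1 + `|t|) ^+ m.
Proof.
rewrite normcX -exprMn lerXn2r ?nnegrE ?normc_ge0 ?mulr_ge0 ?addr_ge0 //.
apply: (le_trans (normc_le_ReIm _)); rewrite ReD ImD /= oppr0 addr0.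
have := mulr_ge0 (normr_ge0 (s - 1)) (normr_ge0 t); lra.
Qed.

(** The abscissae 14 here and [- 10] in [G_left_line] are [2 + 12] and [2 - 12]: the lines enclose
    the discs of radius 12 about [2 + i T] on which [jensen_count] requires a bound. *)
Lemma G_right_line : exists A : R, exists K : nat, 0 <= A /\
  forall t : R, normc (G (14 +i* t)) <= A * (1 + `|t|) ^+ K.
Proof.
have [A A0 HA] := sf_upper F.
exists ((1 + `|14 - 1|) ^+ sf_m F * A), (sf_m F); split.
  by rewrite mulr_ge0 // exprn_ge0 // addr_ge0.
move=> t; rewrite GE; last by apply: Re_neq1 => /=; lra.
rewrite normcM mulrAC; apply: ler_pM; rewrite ?normc_ge0 ?normc_line_le //.
by apply: HA => /=; lra.
Qed.

(** For [|t| >= t0] this is the bound on [F] obtained from the functional equation; the remaining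
    compact segment is covered by the maximum of [|G|] on it. *)
Lemma G_left_line : exists A : R, exists K : nat, 0 <= A /\
  forall t : R, normc (G (- 10 +i* t)) <= A * (1 + `|t|) ^+ K.
Proof.
have b1 : 1 <= 10 :> R by lra.
have [A [K [t0 [A0 t00 HA]]]] := sf_left_line F b1.
have [z1 _ Hz1] := rect_max (lexx (- 10)) (ltW (gtrN t00) : - t0 <= t0) (ccont_real_normc cG).
exists (normc (G z1) + (1 + `|- 10 - 1|) ^+ sf_m F * A), (sf_m F + K)%N; split.
  by rewrite addr_ge0 ?normc_ge0 // mulr_ge0 // exprn_ge0 // addr_ge0.
move=> t; have t1 : 1 <= (1 + `|t|) ^+ (sf_m F + K) by rewrite exprn_ege1 // lerDl.
have P0 : 0 <= (1 + `|- 10 - 1|) ^+ sf_m F * A by rewrite mulr_ge0 // exprn_ge0 // addr_ge0.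
have [tt|tt] := leP t0 `|t|.
  rewrite mulrDl; apply: (@le_trans _ _ ((1 + `|- 10 - 1|) ^+ sf_m F * A * (1 + `|t|) ^+ (sf_m F + K))); last first.
    by rewrite lerDr mulr_ge0 ?normc_ge0 // exprn_ge0 // addr_ge0.
  rewrite GE; last first.
    apply/eqP => /(congr1 (@complex.Re R)) /=; lra.
  rewrite normcM exprD mulrACA; apply: ler_pM; rewrite ?normc_ge0 ?normc_line_le //.
  exact: HA.
apply: (@le_trans _ _ (normc (G z1))).
  apply: Hz1; split; rewrite /= ?lexx //.
  by rewrite -ler_norml ltW.
by apply: (@le_trans _ _ (normc (G z1) + (1 + `|- 10 - 1|) ^+ sf_m F * A));
  [rewrite lerDl | rewrite ler_peMr // addr_ge0 ?normc_ge0].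
Qed.

(* Phragmen-Lindelof: the damping factor centred at [2 + i T] makes [G] small on
   far horizontal segments, and bounded by a power of [1 + |T|] on the two vertical
   lines. *)
Lemma strip_growth : exists A : R, exists K : nat, 0 < A /\
  forall (T : R) (z : C), normc (z - (2 +i* T)) <= 12 ->
  normc (G z) <= A * (1 + `|T|) ^+ K.
Proof.
have [A1 [K1 [A10 H1]]] := G_right_line.
have [A2 [K2 [A20 H2]]] := G_left_line.
have [kappa k0 Hk] := @cos_ge_half R 12 (ltac:(lra)).
have [Ao [r0 Ho]] := oG.
pose K := (K1 + K2)%N.
pose A := 1 + A1 + A2; have A0 : 0 < A by rewrite /A; lra.
pose B := expR (2 * K%:R ^+ 2 / kappa ^+ 2).
have B1 : 1 <= B.
  by rewrite -[leLHS]expR0 ler_expR divr_ge0 ?mulr_ge0 ?exprn_ge0 // ltW.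
exists (A * B * expR (2 * expR (kappa * 12))), K; split.
  by rewrite !mulr_gt0 ?expR_gt0.
move=> T z zT.
pose n := (Num.truncn `|Ao|).+1.
have An : Ao <= n%:R by rewrite (le_trans (ler_norm _)) // ltW // truncnS_gt.
(* The half-height [L >= 2 D] of the rectangle may depend on [T], since it disappears from the final
   bound. On the horizontal sides [|v|] lies between [|r0| + 1], so that the finite order estimate
   applies, and [D + L], so that the estimate is cancelled by the damping factor. *)
pose D := 16 + `|T| + `|r0|.
have D0 : 16 <= D by rewrite /D -addrA lerDl addr_ge0.
have [L0 L00 HL] := order_damping D n k0.
pose L := Num.max L0 D + D.
have LD : D <= L.
  by rewrite /L lerDr le_max; apply/orP; right; lra.
have LL0 : L0 <= L.
  by rewrite /L (le_trans (_ : L0 <= Num.max L0 D)) ?le_max ?lexx // lerDl; lra.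
have LDD : 2 * D <= L.
  have : D <= Num.max L0 D by rewrite le_max lexx orbT.
  by rewrite /L; lra.
have {}HL : (D + L) ^+ n <= expR (kappa * L) / 2.
  by case: (HL L LL0 LD) => //; lra.
pose z0 := 2 +i* T : C.
pose f w := G w * damping kappa (w - z0).
have cf : centire f.
  apply: centireM => //.
  apply: (centire_comp (g := fun w => w - z0)); first exact: centire_damping.
  by apply: centireD; [exact: centire_id|exact: centire_cst].
have T0 := normr_ge0 T.
have AT : 1 <= A * B * (1 + `|T|) ^+ K.
  have a1 : 1 <= A by rewrite /A; lra.
  have t1 : 1 <= (1 + `|T|) ^+ K by rewrite exprn_ege1 // lerDl.
  have : 1 * 1 <= A * B by apply: ler_pM.
  rewrite mul1r => ab; have : 1 * 1 <= A * B * (1 + `|T|) ^+ K by apply: ler_pM.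
  by rewrite mul1r.
have bound w : inrect (- 10) 14 (T - L) (T + L) w -> normc (f w) <= A * B * (1 + `|T|) ^+ K.
  apply: maximum_modulus => //; [lra|lra|].
  move=> v [/andP[v1 v2] /andP[v3 v4]].
  have cosv : 1 / 2 <= cos (kappa * Re (v - z0)).
    by apply: Hk; rewrite ReD ReN /= ler_norml; lra.
  have mu := normc_damping_le k0 cosv.
  have side (s : R) (A' : R) (K' : nat) : 0 <= A' -> A' <= A -> (K' <= K)%N ->
      (forall t, normc (G (s +i* t)) <= A' * (1 + `|t|) ^+ K') -> Re v = s ->
      normc (f v) <= A * B * (1 + `|T|) ^+ K.
    move=> A'0 A'A KK Hs vs.
    have -> : v = s +i* Im v by apply: ReIm_eq.
    rewrite /f normcM -{2}vs (_ : Re v +i* Im v = v); last by case: (v).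
    apply: (@le_trans _ _ (A * ((1 + `|T|) ^+ K * (1 + `|Im (v - z0)|) ^+ K) *
       expR (- (expR (kappa * `|Im (v - z0)|) / 2)))).
      apply: ler_pM; rewrite ?normc_ge0 //; apply: (le_trans (Hs _)).
      apply: ler_pM => //.
      apply: (@le_trans _ _ ((1 + `|Im v|) ^+ K)); first by rewrite ler_weXn2l // lerDl.
      rewrite -exprMn lerXn2r ?nnegrE ?mulr_ge0 ?addr_ge0 //.
      have : `|Im v| <= `|Im (v - z0)| + `|T|.
        rewrite ImD ImN /=; apply: le_trans (ler_normD _ _).
        by rewrite subrK.
      have := mulr_ge0 T0 (normr_ge0 (Im (v - z0))); lra.
    have := polynomial_damping K k0 (normr_ge0 (Im (v - z0))); rewrite -/B.
    have T1 : 0 <= (1 + `|T|) ^+ K by rewrite exprn_ge0 // addr_ge0.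
    move=> /(ler_wpM2l (ltW A0)) /(ler_wpM2r T1) H.
    by apply: le_trans H; rewrite le_eqVlt; apply/orP; left; apply/eqP; ring.
  have horiz : `|Im (v - z0)| = L -> normc (f v) <= A * B * (1 + `|T|) ^+ K.
    move=> vL; apply: le_trans AT; rewrite /f normcM.
    have vn : normc v <= D + L.
      apply: (le_trans (normc_le_ReIm _)).
      have : `|Im v| <= `|Im (v - z0)| + `|T|.
        rewrite ImD ImN /=; apply: le_trans (ler_normD _ _).
        by rewrite subrK.
      have : `|Re v| <= 14 by rewrite ler_norml; lra.
      by rewrite vL /D; have := normr_ge0 r0; lra.
    have vl : `|r0| + 1 <= normc v.
      have : `|Im (v - z0)| <= `|Im v| + `|T|.
        by rewrite ImD ImN /=; exact: ler_normB.
      by rewrite vL; have := Im_le_normc v; rewrite /D in LDD; have := normr_ge0 r0; lra.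
    have v1' : 1 <= normc v by have := normr_ge0 r0; lra.
    have Gv : normc (G v) <= expR ((D + L) ^+ n).
      apply: (le_trans (Ho v _)); first by have := ler_norm r0; lra.
      rewrite ler_expR; apply: (@le_trans _ _ (normc v `^ n%:R)); first exact: ler_powR.
      by rewrite powR_mulrn ?normc_ge0 // lerXn2r ?nnegrE ?normc_ge0 //; lra.
    rewrite vL in mu.
    apply: (@le_trans _ _ (expR ((D + L) ^+ n) * expR (- (expR (kappa * L) / 2)))).
      by apply: ler_pM; rewrite ?normc_ge0.
    by rewrite -expRD -[leRHS]expR0 ler_expR subr_le0.
  case=> hv.
  - by apply: (side (- 10) A2 K2) => //; rewrite ?leq_addl // /A; lra.
  - by apply: (side 14 A1 K1) => //; rewrite ?leq_addr // /A; lra.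
  - by apply: horiz; rewrite ImD ImN hv /= addrAC subrr add0r normrN ger0_norm //; lra.
  - by apply: horiz; rewrite ImD ImN hv /= addrAC subrr add0r ger0_norm //; lra.
have zr : inrect (- 10) 14 (T - L) (T + L) z.
  have := Re_le_normc (z - z0); have := Im_le_normc (z - z0).
  rewrite ReD ImD ReN ImN /= => /le_trans/(_ zT) h1 /le_trans/(_ zT).
  move: h1; rewrite !ler_norml => /andP[? ?] /andP[? ?].
  by split; apply/andP; split; lra.
have := bound z zr; rewrite /f normcM.
(* On the disc of radius 12 the damping factor is bounded below independently of [T], so dividing by
   it costs only a constant. *)
have ge : expR (- (2 * expR (kappa * 12))) <= normc (damping kappa (z - z0)).
  apply: normc_damping_ge => //.
  exact: le_trans (Im_le_normc _) zT.
move=> H; have {}H : normc (G z) * expR (- (2 * expR (kappa * 12))) <= A * B * (1 + `|T|) ^+ K.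
  by apply: le_trans H; rewrite ler_wpM2l ?normc_ge0.
by move: H; rewrite expRN ler_pdivrMr ?expR_gt0 // mulrAC.
Qed.

End Growth.

(** * Counting zeros *)

Section ZeroCounting.
Context {R : realType}.
Local Notation C := R[i].
Local Notation Re := complex.Re.
Local Notation Im := complex.Im.

(* Only upper bounds on multiplicities are needed, so no factorization of [G]. *)
Definition vanishes_to_order (G : C -> C) (rho : C) (k : nat) : Prop :=
  exists A eta : R, [/\ 0 <= A, 0 < eta & forall z, z != rho -> normc (z - rho) < eta ->
    normc (G z) <= A * normc (z - rho) ^+ k].

Lemma has_cderiv_factor (rho z : C) (n : nat) : z != rho ->
  exists d, has_cderiv (fun w => (w - rho) ^+ 2 / (w - rho) ^+ n) z d.
Proof.
move=> zr; have Hs : has_cderiv (fun w => w - rho) z (1 - 0).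
  by apply: has_cderivB; [exact: has_cderiv_id|exact: has_cderiv_cst].
have [d1 H1] := has_cderivX 2 Hs; have [d2 H2] := has_cderivX n Hs.
have n0 : (z - rho) ^+ n != 0 by rewrite expf_neq0 // subr_eq0.
have H3 := has_cderiv_comp (f := fun w => w^-1) (g := fun w => (w - rho) ^+ n) (has_cderivV n0) H2.
by eexists; exact: (has_cderivM H1 H3).
Qed.

Lemma has_cderiv_prod (s : seq C) (f : C -> C -> C) (z : C) :
  (forall rho, rho \in s -> exists d, has_cderiv (f rho) z d) ->
  exists d, has_cderiv (fun w => \prod_(rho <- s) f rho w) z d.
Proof.
elim: s => [|r s IH] H.
  exists 0; rewrite (_ : (fun w => _) = fun=> 1); first exact: has_cderiv_cst.
  by apply/funext => w; rewrite big_nil.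
have [d1 H1] := H r (mem_head _ _).
have [|d2 H2] := IH; first by move=> r' r's; apply: H; rewrite inE r's orbT.
have := has_cderivM H1 H2; rewrite (_ : (fun w => _) = fun w => \prod_(rho <- r :: s) f rho w).
  by move=> ?; eexists; eassumption.
by apply/funext => w; rewrite big_cons.
Qed.

Lemma has_cderiv_quadratic (f : C -> C) (rho : C) (B eta : R) : 0 <= B -> 0 < eta ->
  f rho = 0 -> (forall h, normc h < eta -> normc (f (rho + h)) <= B * normc h ^+ 2) ->
  has_cderiv f rho 0.
Proof.
move=> B0 eta0 f0 H e e0; have B1 : 0 < B + 1 by lra.
exists (Num.min eta (e / (B + 1))); first by rewrite lt_min eta0 divr_gt0.
move=> h; rewrite lt_min => /andP[/H {}H]; rewrite ltr_pdivlMr // => he.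
rewrite f0 subr0 mul0r subr0; apply: (le_trans H).
rewrite expr2 mulrA ler_wpM2r ?normc_ge0 //.
by have := normc_ge0 h; lra.
Qed.

(* The mean value inequality for [G^3 prod (z - rho)^(2 - 3 k)], on the circle of
   radius 12. Since [G^3] vanishes to order [3 k], the remaining [(z - rho)^2] makes
   this function differentiable at [rho] (with derivative 0) without any theorem on
   removable singularities. *)
Lemma jensen_count (G : C -> C) (z0 : C) (M : R) (s : seq C) (k : C -> nat) :
  centire G -> uniq s ->
  (forall rho, rho \in s -> [/\ (0 < k rho)%N, 1 <= normc (z0 - rho), normc (z0 - rho) <= 2
     & vanishes_to_order G rho (k rho)]) ->
  (forall z, normc (z - z0) = 12 -> normc (G z) <= M) ->
  normc (G z0) ^+ 3 * 2 ^+ (\sum_(rho <- s) k rho) <= M ^+ 3.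
Proof.
move=> cG us Hs HM.
pose b rho w : C := (w - rho) ^+ 2 / (w - rho) ^+ (3 * k rho).
pose f w := G w ^+ 3 * \prod_(rho <- s) b rho w.
have cf : centire f.
  move=> z; have [zs|zs] := boolP (z \in s); last first.
    have [dG HG] := cG z; have [d1 H1] := has_cderivX 3 HG.
    have [|d2 H2] := @has_cderiv_prod s b z.
      move=> rho rs; apply: has_cderiv_factor.
      by apply: contraNneq zs => ->.
    by eexists; exact: has_cderivM H1 H2.
  have [k0 _ _ [A [eta [A0 eta0 HA]]]] := Hs z zs.
  have [|d2 H2] := @has_cderiv_prod (rem z s) b z.
    move=> rho rs; apply: has_cderiv_factor.
    by move: rs; rewrite mem_rem_uniq // inE => /andP[] ; rewrite eq_sym.
  pose q w := \prod_(rho <- rem z s) b rho w.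
  have [eta2 eta20 {}H2] : exists2 eta : R, 0 < eta &
    forall w, normc (w - z) < eta -> normc (q w - q z) < 1.
    exact: has_cderiv_continuous H2 _ ltr01.
  have fE w : f w = G w ^+ 3 * (b z w * q w) by rewrite /f (big_rem z zs).
  (* At the zero itself the numerator of [b z z] vanishes, whatever the inverse of 0 is, so
     [f z = 0]. This is also the limit of [f], by the quadratic estimate below. *)
  have fz : f z = 0 by rewrite fE /b subrr expr0n /= mul0r mul0r mulr0.
  exists 0; apply: (@has_cderiv_quadratic f z (A ^+ 3 * (normc (q z) + 1)) (Num.min eta eta2)) => //.
  - by rewrite mulr_ge0 ?exprn_ge0 // addr_ge0 ?normc_ge0.
  - by rewrite lt_min eta0.
  move=> h; rewrite lt_min => /andP[h1 h2]; have [->|hn0] := eqVneq h 0.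
    by rewrite addr0 fz normcR normr0 expr0n mulr0.
  have zh : z + h != z by rewrite -subr_eq0 [z + h]addrC addrK.
  have := HA (z + h) zh; have := H2 (z + h).
  rewrite fE /b [z + h]addrC addrK => /(_ h2) qh /(_ h1) Gh.
  have nh : 0 < normc h by rewrite normc_gt0.
  rewrite normcM normcX (normcM (_ / _)) (normcM (h ^+ 2)) normcV !normcX.
  have nk : normc h ^+ (3 * k z) = (normc h ^+ k z) ^+ 3 by rewrite -exprM mulnC.
  have nk0 : 0 < (normc h ^+ k z) ^+ 3 by rewrite !exprn_gt0.
  have qb : normc (q (h + z)) <= normc (q z) + 1.
    by have := normc_sub_le (q (h + z)) (q z); lra.
  rewrite nk; apply: (@le_trans _ _ ((A * normc h ^+ k z) ^+ 3 *
      (normc h ^+ 2 / (normc h ^+ k z) ^+ 3 * (normc (q z) + 1)))).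
    apply: ler_pM.
    - by rewrite exprn_ge0 ?normc_ge0.
    - by rewrite !mulr_ge0 ?normc_ge0 ?exprn_ge0 ?invr_ge0 ?exprn_ge0 ?normc_ge0.
    - by rewrite lerXn2r ?nnegrE ?normc_ge0 ?mulr_ge0 ?exprn_ge0 ?normc_ge0.
    - by rewrite ler_wpM2l // divr_ge0 ?exprn_ge0 ?normc_ge0.
  rewrite le_eqVlt; apply/orP; left; apply/eqP; rewrite exprMn; field.
  by rewrite gt_eqF // exprn_gt0.
have kE rho : rho \in s -> exists k', k rho = k'.+1.
  by move=> /Hs[k0 _ _ _]; exists (k rho).-1; rewrite prednK.
have powE (x : R) k' : 0 < x -> x ^+ 2 / x ^+ (3 * k'.+1) = (x ^+ (3 * k' + 1))^-1.
  move=> x0; rewrite (_ : 3 * k'.+1 = 2 + (3 * k' + 1))%N; last by rewrite mulnS addnA [RHS]addnC addnA.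
  rewrite exprD invfM mulrA divff ?mul1r //.
  by rewrite expf_neq0 // gt_eqF.
(* [3 k - 2], written without truncated subtraction. On the circle [|z - rho| >= 12 - 2 = 10], at
   the centre [|z0 - rho| <= 2]: the zero [rho] gains the factor [(10 / 2)^d]. *)
pose d rho := (3 * (k rho).-1 + 1)%N.
have fup : normc (f z0) <= M ^+ 3 * \prod_(rho <- s) (10 ^+ d rho)^-1.
  apply: (mean_modulus_le (r := 12)) => // z z12.
  have M0 : 0 <= M by apply: le_trans (HM z z12); exact: normc_ge0.
  rewrite /f normcM normcX; apply: ler_pM.
  - by rewrite exprn_ge0 ?normc_ge0.
  - exact: normc_ge0.
  - by rewrite lerXn2r ?nnegrE ?normc_ge0 ?HM.
  rewrite normc_prod big_seq [leRHS]big_seq; apply: ler_prod => rho rs.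
  rewrite normc_ge0 /= /b normcM normcV !normcX /d.
  have [_ r1 r2 _] := Hs rho rs; have [k' kk] := kE rho rs.
  have zr : 10 <= normc (z - rho).
    by have := normc_telescope z rho z0; rewrite (normc_distC rho) z12; lra.
  have zr0 : 0 < normc (z - rho) by lra.
  rewrite kk powE //= lef_pV2 ?posrE ?exprn_gt0 // lerXn2r ?nnegrE //; lra.
have flow : normc (G z0) ^+ 3 * \prod_(rho <- s) (2 ^+ d rho)^-1 <= normc (f z0).
  rewrite /f normcM normcX ler_wpM2l ?exprn_ge0 ?normc_ge0 // normc_prod.
  rewrite big_seq [leRHS]big_seq; apply: ler_prod => rho rs.
  rewrite invr_ge0 exprn_ge0 //= /b normcM normcV !normcX /d.
  have [_ r1 r2 _] := Hs rho rs; have [k' kk] := kE rho rs.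
  have zr0 : 0 < normc (z0 - rho) by lra.
  by rewrite kk powE //= lef_pV2 ?posrE ?exprn_gt0 // lerXn2r ?nnegrE //; lra.
have P2 : 0 < \prod_(rho <- s) (2 : R) ^+ d rho by apply: prodr_gt0 => rho _; rewrite exprn_gt0.
have P10 : 0 < \prod_(rho <- s) (10 : R) ^+ d rho by apply: prodr_gt0 => rho _; rewrite exprn_gt0.
have := le_trans flow fup; rewrite !prodfV.
rewrite ler_pdivrMr // mulrAC ler_pdivlMr // => H.
(* [5^(3 k - 2) >= 5^k >= 2^k], because [k >= 1]. *)
have : \prod_(rho <- s) (2 : R) ^+ d rho * 2 ^+ (\sum_(rho <- s) k rho) <=
    \prod_(rho <- s) (10 : R) ^+ d rho.
  rewrite -prodrXr -big_split /= big_seq [leRHS]big_seq; apply: ler_prod => rho rs.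
  rewrite mulr_ge0 ?exprn_ge0 //= -exprD.
  have [k' kk] := kE rho rs; rewrite /d kk /=.
  rewrite (_ : (10 : R) = 2 * 5); last by ring.
  rewrite exprD exprMn ler_pM2l ?exprn_gt0 //.
  apply: (@le_trans _ _ (5 ^+ k'.+1)); first by rewrite lerXn2r ?nnegrE //; lra.
  by rewrite ler_weXn2l ?ler1n // addn1 ltnS leq_pmull.
have M0 : 0 <= M ^+ 3.
  have x12 : normc (circle_pt z0 12 0 - z0) = 12 by rewrite normc_circle_pt.
  by rewrite exprn_ge0 //; apply: le_trans (HM _ x12); exact: normc_ge0.
move=> H2.
rewrite -(ler_pM2r P10); apply: le_trans (ler_wpM2l M0 H2).
apply: le_trans (_ : normc (G z0) ^+ 3 * (\prod_(rho <- s) 10 ^+ d rho) *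
   2 ^+ (\sum_(rho <- s) k rho) <= _); first by rewrite mulrAC.
by rewrite mulrA ler_wpM2r // exprn_ge0.
Qed.

(** Telescoping: [(j + 1)^(-3/2) <= 2 / sqrt j - 2 / sqrt (j + 1)], where the right side is
    rewritten by a difference of squares. *)
Lemma sum_inv_sqrt3_le (n : nat) :
  \sum_(j < n.+1) ((j.+1%:R * Num.sqrt j.+1%:R)^-1 : R) <= 3 - 2 / Num.sqrt n.+1%:R.
Proof.
elim: n => [|n IH]; first by rewrite big_ord1 sqrtr1 mulr1 invr1; lra.
rewrite big_ord_recr /=; apply: (le_trans (lerD IH (lexx _))).
set a := Num.sqrt n.+1%:R; set b := Num.sqrt n.+2%:R.
have a0 : 0 < a by rewrite sqrtr_gt0 ltr0n.
have b0 : 0 < b by rewrite sqrtr_gt0 ltr0n.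
have b2 : b ^+ 2 = n.+2%:R by rewrite sqr_sqrtr // ler0n.
have a2 : a ^+ 2 = n.+1%:R by rewrite sqr_sqrtr // ler0n.
have ab : a <= b by rewrite ler_sqrt ?ltr0n // ler_nat.
have e1 : b ^+ 2 - a ^+ 2 = 1 by rewrite b2 a2 -(natr1 n.+1); ring.
rewrite -b2; have : (b ^+ 2 * b)^-1 <= 2 / a - 2 / b.
  have -> : 2 / a - 2 / b = 2 / (a * b * (a + b)).
    have ab0 : a + b != 0 by rewrite gt_eqF // addr_gt0.
    rewrite -[X in X / (a * b * _)]mulr1 -e1; field.
    by rewrite ab0 !gt_eqF.
  rewrite -[leLHS]mul1r ler_pdivrMr ?mulr_gt0 ?exprn_gt0 //.
  rewrite mulrAC ler_pdivlMr ?mulr_gt0 ?addr_gt0 // mul1r.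
  have : a * b * (a + b) <= b * b * (b + b).
    apply: ler_pM => //; rewrite ?mulr_ge0 ?addr_ge0 ?(ltW a0) ?(ltW b0) //.
      by rewrite ler_wpM2r // ltW.
    by rewrite lerD2r.
  by rewrite expr2; lra.
lra.
Qed.

End ZeroCounting.

(** * Summing the local counts over all heights *)

Section ZeroSum.
Context {R : realType}.
Local Notation C := R[i].
Local Notation Re := complex.Re.
Local Notation Im := complex.Im.
Variables (F : selberg_sf R) (G : C -> C).
Hypothesis cG : centire G.
Hypothesis oG : finite_order G.
Hypothesis GE : forall s, s != 1 -> G s = (s - 1) ^+ sf_m F * F s.
Variable k : C -> nat.

(** If moreover [|Im rho - T| <= 1], the distance of [rho] to [2 + i T] is at least 1, and at most 2
    because [(3/2)^2 + 1 <= 4], as [jensen_count] demands. Zeros with [Re rho < 1/2] are later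
    reflected into this half. *)
Definition right_zero (rho : C) : Prop :=
  [/\ (0 < k rho)%N, 1 / 2 <= Re rho <= 1 & vanishes_to_order G rho (k rho)].

Lemma ln_le_sqrt (x : R) : 1 <= x -> ln x <= 2 * Num.sqrt x.
Proof.
move=> x1; have x0 : 0 < x by lra.
have s0 : 0 < Num.sqrt x by rewrite sqrtr_gt0.
rewrite -{1}(sqr_sqrtr (ltW x0)) lnXn // -[_ *+ 2]mulr_natl.
by rewrite ler_pM2l // ltW // ln_sublinear.
Qed.

(** [jensen_count], the lower bound at [2 + i T] and the polynomial growth give
    [2^n <= B (1 + |T|)^(3 K)]. The resulting logarithmic bound is weakened to a square root, whose
    sum against [T^-2] is still finite and elementary. *)
Lemma local_count : exists2 C0 : R, 0 <= C0 & forall (T : R) (s : seq C), uniq s ->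
  (forall rho, rho \in s -> right_zero rho /\ `|Im rho - T| <= 1) ->
  (\sum_(rho <- s) k rho)%:R <= C0 * Num.sqrt (1 + `|T|).
Proof.
have [c c0 Hc] := sf_lower cG GE.
have [A [K [A0 HA]]] := strip_growth cG oG GE.
have [B BE] : exists B, B = (A / c) ^+ 3 by exists ((A / c) ^+ 3).
have B0 : 0 < B by rewrite BE exprn_gt0 // divr_gt0.
have l2 : 0 < ln (2 : R) by rewrite ln_gt0 // ltr1n.
exists ((B + 6 * K%:R) / ln 2).
  by apply: divr_ge0 (ltW l2); apply: addr_ge0 (ltW B0) _; rewrite mulr_ge0.
move=> T s us Hs; pose z0 := 2 +i* T : C.
set n := (\sum_(rho <- s) k rho)%N.
pose x := 1 + `|T|; have x1 : 1 <= x by rewrite lerDl.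
have x0 : 0 < x by lra.
have Hn : normc (G z0) ^+ 3 * 2 ^+ n <= (A * x ^+ K) ^+ 3.
  apply: jensen_count => //; last by move=> z z12; apply: HA; rewrite z12.
  move=> rho rs; have [[k0 /andP[r1 r2] v] rT] := Hs rho rs; split=> //.
    have := Re_le_normc (z0 - rho); rewrite ReD ReN /= => /(le_trans (ler_norm _)); lra.
  rewrite -(@ler_pXn2r _ 2) ?nnegrE ?normc_ge0 // normc_sqr ReD ReN ImD ImN /=.
  have : (Im rho - T) ^+ 2 <= 1.
    by rewrite -[leRHS](expr1n _ 2) -real_normK ?num_real // lerXn2r ?nnegrE.
  have : (2 - Re rho) ^+ 2 <= (3 / 2) ^+ 2 by rewrite lerXn2r ?nnegrE //; lra.
  have -> : (Im rho - T) ^+ 2 = (T - Im rho) ^+ 2 by ring.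
  lra.
have Gc : c <= normc (G z0).
  rewrite GE; last by apply: Re_neq1 => /=; lra.
  rewrite normcM; apply: le_trans (Hc T) _; rewrite ler_peMl ?normc_ge0 // normcX.
  apply: exprn_ege1.
  have := Re_le_normc (z0 - 1); rewrite ReD ReN /= => /(le_trans (ler_norm _)); lra.
have {}Hn : 2 ^+ n <= B * x ^+ (3 * K).
  rewrite BE expr_div_n mulrAC ler_pdivlMr ?exprn_gt0 //.
  have -> : x ^+ (3 * K) = (x ^+ K) ^+ 3 by rewrite -exprM mulnC.
  rewrite -exprMn; apply: le_trans Hn; rewrite mulrC ler_wpM2r ?exprn_ge0 //.
  by rewrite lerXn2r ?nnegrE ?normc_ge0 // ltW.
have : ln (2 ^+ n) <= ln (B * x ^+ (3 * K)).
  by rewrite ler_ln ?posrE ?mulr_gt0 ?exprn_gt0.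
rewrite lnM ?posrE ?exprn_gt0 // !lnXn // => H.
rewrite -/x mulrAC ler_pdivlMr // (mulr_natl (ln 2) n); apply: (le_trans H).
have s1 : 1 <= Num.sqrt x by rewrite -[leLHS]sqrtr1 ler_wsqrtr.
rewrite mulrDl; apply: lerD.
  apply: (le_trans (ltW (ln_sublinear B0))); rewrite ler_peMr // ltW //.
rewrite -(mulr_natl (ln x)) natrM; have := ler_wpM2l (ler0n R K) (ln_le_sqrt x1); lra.
Qed.

(** The zeros are sorted by the integer part [j] of [|Im rho|]. Each class lies within distance 1 of
    the heights [j] and [- j], and on it [1 / (1 + gamma^2) <= 2 / (j + 1)^2]; the class contributes
    [O((j + 1)^(-3/2))]. *)
Lemma zero_sum_bound : exists C1 : R, forall s : seq C, uniq s ->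
  (forall rho, rho \in s -> right_zero rho) ->
  \sum_(rho <- s) (k rho)%:R / (1 + Im rho ^+ 2) <= C1.
Proof.
have [C0 C00 H0] := local_count.
exists (4 * C0 * 3) => s us Hs.
pose t (rho : C) : nat := Num.truncn (`|Im rho| : R).
pose n := \max_(rho <- s) t rho.
have tn rho : rho \in s -> (t rho < n.+1)%N.
  by move=> rs; rewrite ltnS /n (big_rem rho rs) /= leq_maxl.
pose p rho : 'I_n.+1 := inord (t rho).
have term (j : 'I_n.+1) : \sum_(rho <- s | p rho == j) (k rho)%:R / (1 + Im rho ^+ 2)
    <= 4 * C0 * (j.+1%:R * Num.sqrt j.+1%:R)^-1.
  have j0 : 0 < j.+1%:R :> R by rewrite ltr0n.
  have tj rho : rho \in s -> p rho == j -> j%:R <= `|Im rho| < (j.+1%:R : R).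
    move=> rs /eqP pj; have -> : nat_of_ord j = t rho by rewrite -pj inordK // tn.
    by rewrite truncn_itv.
  have cnt (q : pred C) (T : R) : `|T| = j%:R ->
      (forall rho, rho \in s -> p rho == j -> q rho -> `|Im rho - T| <= 1) ->
      \sum_(rho <- s | (p rho == j) && q rho) (k rho)%:R <= C0 * Num.sqrt j.+1%:R.
    move=> Tj HT; rewrite -natr_sum -big_filter -natr1 addrC -Tj.
    apply: H0; first exact: filter_uniq.
    move=> rho; rewrite mem_filter => /andP[/andP[pj qr] rs].
    by split; [exact: Hs|exact: HT].
  have kj : \sum_(rho <- s | p rho == j) (k rho)%:R <= 2 * (C0 * Num.sqrt j.+1%:R).
    rewrite (bigID (fun rho => 0 <= Im rho)) /= mulr_natl mulr2n; apply: lerD.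
      apply: (cnt _ j%:R); first by rewrite ger0_norm.
      move=> rho rs pj q0; have := tj _ rs pj; rewrite ger0_norm // -natr1 => /andP[? ?].
      by rewrite ler_norml; apply/andP; split; lra.
    apply: (cnt _ (- j%:R)); first by rewrite normrN ger0_norm.
    move=> rho rs pj; rewrite -ltNge => q0; have := tj _ rs pj.
    rewrite ltr0_norm // -natr1 => /andP[? ?].
    by rewrite ler_norml; apply/andP; split; lra.
  apply: (@le_trans _ _ (\sum_(rho <- s | p rho == j) (k rho)%:R * (2 / j.+1%:R ^+ 2))).
    rewrite big_seq_cond [leRHS]big_seq_cond; apply: ler_sum => rho /andP[rs pj].
    rewrite ler_wpM2l // -[2 / _]invf_div lef_pV2 ?posrE ?divr_gt0 ?exprn_gt0 //; last first.
      by rewrite ltr_pwDl // sqr_ge0.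
    have /andP[jl _] := tj _ rs pj.
    have : j%:R ^+ 2 <= Im rho ^+ 2 :> R.
      by rewrite -[leRHS]real_normK ?num_real // lerXn2r ?nnegrE.
    have := sqr_ge0 (1 - j%:R : R); rewrite -natr1; lra.
  rewrite -mulr_suml.
  apply: (@le_trans _ _ (2 * (C0 * Num.sqrt j.+1%:R) * (2 / j.+1%:R ^+ 2))).
    by rewrite ler_wpM2r // divr_ge0 ?exprn_ge0.
  have s0 : 0 < Num.sqrt j.+1%:R :> R by rewrite sqrtr_gt0.
  have s2 : Num.sqrt j.+1%:R ^+ 2 = j.+1%:R :> R by rewrite sqr_sqrtr // ltW.
  rewrite le_eqVlt; apply/orP; left; apply/eqP; rewrite -{2 3}s2.
  by field; rewrite gt_eqF.
rewrite (partition_big p xpredT) //=.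
apply: (@le_trans _ _ (\sum_(j < n.+1) 4 * C0 * (j.+1%:R * Num.sqrt j.+1%:R)^-1)).
  by apply: ler_sum => j _; exact: term.
rewrite -mulr_sumr; apply: ler_wpM2l; first by rewrite mulr_ge0.
apply: (le_trans (sum_inv_sqrt3_le n)); rewrite gerBl.
by rewrite divr_ge0 // sqrtr_ge0.
Qed.

End ZeroSum.

(** * The symmetry of the zeros *)

Section Reflection.
Context {R : realType}.
Local Notation C := R[i].
Local Notation Re := complex.Re.
Local Notation Im := complex.Im.
Variable F : selberg_sf R.

Definition creflect (z : C) : C := 1 - conjc z.

Lemma creflectK : involutive creflect.
Proof. by move=> z; apply: ReIm_eq => /=; case: z => a b /=; ring. Qed.

Lemma Re_reflect z : Re (creflect z) = 1 - Re z.
Proof. by case: z => a b /=; ring. Qed.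

Lemma Im_reflect z : Im (creflect z) = Im z.
Proof. by case: z => a b /=; ring. Qed.

Lemma normc_reflectB z w : normc (creflect z - creflect w) = normc (z - w).
Proof.
by rewrite -(normc_conj (z - w)) -normcN; congr normc; rewrite rmorphB /creflect; ring.
Qed.

(** The points where [l z + mu] is a nonpositive integer are at least [1 / l] apart, so at most one
    of them is within [1 / (2 l)] of [rho]. If it is not [rho], its distance to [rho] serves as
    radius. *)
Lemma near_isolated (l : R) (mu rho : C) : 0 < l ->
  \forall z \near (rho : C^o)^', forall k : nat, l%:C * z + mu != - k%:R.
Proof.
move=> l0; have l2 : 0 < (2 * l)^-1 by rewrite invr_gt0 mulr_gt0.
have uniq_pole (z1 z2 : C) k1 k2 : l%:C * z1 + mu = - k1%:R -> l%:C * z2 + mu = - k2%:R ->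
    normc (z1 - z2) < l^-1 -> z1 = z2.
  move=> e1 e2 h; have E : l%:C * (z1 - z2) = (k2%:R - k1%:R)%:C.
    by rewrite rmorphB /= !rmorph_nat -[k2%:R]opprK -e2 -[k1%:R]opprK -e1; ring.
  have : `|k2%:R - k1%:R| < 1 :> R.
    rewrite -normcR -E normcM normcR gtr0_norm //.
    by rewrite mulrC -ltr_pdivlMr // mul1r.
  have [lt|lt|kk _] := ltngtP k1 k2.
  - have : k1.+1%:R <= k2%:R :> R by rewrite ler_nat.
    by rewrite -natr1 ltr_norml => ? /andP[_ ?]; exfalso; lra.
  - have : k2.+1%:R <= k1%:R :> R by rewrite ler_nat.
    by rewrite -natr1 ltr_norml => ? /andP[? _]; exfalso; lra.
  move: E; rewrite kk subrr => /eqP; rewrite mulf_eq0 => /orP[/eqP E|].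
    by move: l0; rewrite (complexI E) ltxx.
  by rewrite subr_eq0 => /eqP.
have l1 : (2 * l)^-1 + (2 * l)^-1 = l^-1 by field; rewrite gt_eqF.
have [[z1 [z1rho z1n [k1 e1]]]|N] := pselect (exists z1, [/\ z1 != rho,
  normc (z1 - rho) < (2 * l)^-1 & exists k : nat, l%:C * z1 + mu = - k%:R]).
  apply/near_punctured_normc; exists (normc (z1 - rho)); first by rewrite normc_gt0 subr_eq0.
  move=> z zr zn k; apply/eqP => e.
  have zz1 : z = z1.
    apply: (uniq_pole _ _ _ _ e e1).
    clear e e1; have := normc_telescope z rho z1.
    by rewrite (normc_distC rho z1); lra.
  by move: zn; rewrite zz1 ltxx.
apply/near_punctured_normc; exists (2 * l)^-1 => // z zr zn k; apply/eqP => e.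
by apply: N; exists z; split=> //; exists k.
Qed.

Lemma near_neq (a rho : C) : \forall z \near (rho : C^o)^', z != a.
Proof.
have [->|ra] := eqVneq a rho; first by apply/near_punctured_normc; exists 1.
apply/near_punctured_normc; exists (normc (a - rho)); first by rewrite normc_gt0 subr_eq0.
by move=> z _; apply: contraTneq => ->; rewrite ltxx.
Qed.

Lemma near_completed_regular (rho : C) :
  \forall z \near (rho : C^o)^', completed_regular (@sf_lam R F) (@sf_mu R F) z.
Proof.
apply: filterS2 (near_neq 1 rho) (_ : \forall z \near (rho : C^o)^', forall (j : 'I_(sf_r F)) (k : nat),
  (sf_lam j)%:C * z + sf_mu j != - k%:R); first by move=> z; split.
by apply: filter_forall => j; apply: near_isolated; exact: sf_lam_gt0.
Qed.

Lemma near_reflect (rho : C) (P : C -> Prop) :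
  (\forall z \near ((creflect rho : C) : C^o)^', P z) -> \forall z \near (rho : C^o)^', P (creflect z).
Proof.
move=> /near_punctured_normc[e e0 H]; apply/near_punctured_normc; exists e => // z zr zn.
apply: H; last by rewrite normc_reflectB.
by apply: contraNneq zr => /(can_inj creflectK) ->.
Qed.

Lemma has_cderiv_conj (g : C -> C) (z d : C) : has_cderiv g (creflect z) d ->
  has_cderiv (fun w => conjc (g (creflect w))) z (- conjc d).
Proof.
move=> H e /H[eta eta0 {}H]; exists eta => // h hn.
have := H (- conjc h); rewrite normcN normc_conj => /(_ hn).
rewrite (_ : creflect z + - conjc h = creflect (z + h)); last first.
  by rewrite /creflect rmorphD opprD addrA.
congr (_ <= _); rewrite -[LHS]normc_conj; congr normc.
by rewrite !rmorphB rmorphM rmorphN /= conjcK; ring.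
Qed.

(** The new cofactor is the conjugate of [g] at the reflected point, times [w (-1)^k]; the sign
    comes from [conj (creflect z - rho) = - (z - creflect rho)]. The functional equation is only
    used on a punctured neighbourhood free of irregular points. *)
Lemma vanishing_order_reflect (rho : C) (k : nat) :
  vanishing_order (sf_xi F) rho k -> vanishing_order (sf_xi F) (creflect rho) k.
Proof.
move=> [g [hg g0 xig]].
exists (fun z => sf_w F * (-1) ^+ k * conjc (g (creflect z))); split.
- move/near_normc: hg => [e e0 hg]; apply/near_normc; exists e => // z zn.
  have /derivable_cderiv Hd : holomorphic_at g (creflect z).
    by apply: hg; rewrite -[rho]creflectK normc_reflectB.
  have [] // := cderiv_derivable (has_cderivZ (sf_w F * (-1) ^+ k) (has_cderiv_conj Hd)).
- rewrite creflectK !mulf_neq0 ?signr_eq0 ?conjc_eq0 //.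
  by rewrite -normc_gt0 sf_w_unit.
have H1 := near_completed_regular (creflect rho).
have H2 : \forall z \near ((creflect rho : C) : C^o)^',
    completed_regular (@sf_lam R F) (@sf_mu R F) (creflect z).
  by apply: (@near_reflect (creflect rho)); exact: near_completed_regular.
have H3 : \forall z \near ((creflect rho : C) : C^o)^',
    sf_xi F (creflect z) = (creflect z - rho) ^+ k * g (creflect z).
  by apply: (@near_reflect (creflect rho)
    (fun u => sf_xi F u = (u - rho) ^+ k * g u)); rewrite creflectK.
apply: filterS3 H1 H2 H3 => z r1 r2 xiz.
rewrite [LHS](sf_functional_equation r1 r2) -/(sf_xi F _) -/(creflect z) xiz.
rewrite rmorphM rmorphXn /= (_ : conjc (creflect z - rho) = - (z - creflect rho)); last first.
  by rewrite /creflect !rmorphB rmorph1 /= conjcK; ring.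
rewrite (exprNn (z - creflect rho)); move: ((-1) ^+ k) ((z - creflect rho) ^+ k) => u v; ring.
Qed.

Lemma zero_mult_reflect (rho : C) : zero_mult F (creflect rho) = zero_mult F rho.
Proof.
rewrite /zero_mult; congr (xget _ _); apply/seteqP; split => k /= H.
  by rewrite -[rho]creflectK; exact: vanishing_order_reflect.
exact: vanishing_order_reflect.
Qed.

(** A positive value cannot be the default 0 of [xget], so it is a genuine order of vanishing. *)
Lemma zero_multP (rho : C) : (0 < zero_mult F rho)%N ->
  vanishing_order (sf_xi F) rho (zero_mult F rho).
Proof. by rewrite /zero_mult; case: xgetP => // k -> H. Qed.

End Reflection.

(** * From zeros of [xi] to zeros of [G]; the critical strip *)

Section ZerosOfXi.
Context {R : realType}.
Local Notation C := R[i].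
Local Notation Re := complex.Re.
Local Notation Im := complex.Im.
Variables (F : selberg_sf R) (G : C -> C).
Hypothesis cG : centire G.
Hypothesis oG : finite_order G.
Hypothesis GE : forall s, s != 1 -> G s = (s - 1) ^+ sf_m F * F s.

(** For [Re rho >= 1/2] the condition [0 < l + 2 Re mu] puts [l rho + mu] in the right half-plane,
    and [eta] is small enough to keep [l z + mu] there. *)
Lemma gamma_factor_lower (l : R) (mu rho : C) : 0 < l -> 0 < l + 2 * Re mu ->
  1 / 2 <= Re rho -> exists2 c : R, 0 < c &
    \forall z \near (rho : C^o)^', c <= normc (cGamma (l%:C * z + mu)).
Proof.
move=> l0 lmu r2; have [c c0 H] := @cGamma_lower R (l * (normc rho + 1) + normc mu).
exists c => //; apply/near_punctured_normc.
pose eta := (l + 2 * Re mu) / (2 * l).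
have eta0 : 0 < eta by rewrite divr_gt0 // mulr_gt0.
have etaE : l * eta = (l + 2 * Re mu) / 2 by rewrite /eta; field; rewrite gt_eqF.
exists (Num.min 1 eta); first by rewrite lt_min ltr01.
move=> z _; rewrite lt_min => /andP[z1 ze]; apply: H.
  apply: (le_trans (le_normcD _ _)); rewrite lerD2r normcM normcR gtr0_norm //.
  by rewrite ler_wpM2l ?(ltW l0) //; have := normc_sub_le z rho; lra.
apply: gamma_regular_Re; rewrite ReD ReM /= mul0r subr0.
have := Re_le_normc (z - rho); rewrite ReD ReN ler_norml => /andP[h _].
have : l * (Re rho - eta) < l * Re z by rewrite ltr_pM2l //; lra.
have : l * (1 / 2) <= l * Re rho by rewrite ler_pM2l.
lra.
Qed.

Lemma prod_lower (n : nat) (f : 'I_n -> C -> R) (rho : C) :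
  (forall j, exists2 c : R, 0 < c & \forall z \near (rho : C^o)^', c <= f j z) ->
  exists2 c : R, 0 < c & \forall z \near (rho : C^o)^', c <= \prod_(j < n) f j z.
Proof.
move=> H.
have H' (j : 'I_n) : exists c : R, 0 < c /\ \forall z \near (rho : C^o)^', c <= f j z.
  by have [c c0 Hc] := H j; exists c.
have [c Hc] := choice H'.
exists (\prod_(j < n) c j); first by apply: prodr_gt0 => j _; exact: (Hc j).1.
have : \forall z \near (rho : C^o)^', forall j, c j <= f j z.
  by apply: filter_forall => j; exact: (Hc j).2.
apply: filterS => z Hz; apply: ler_prod => j _.
by rewrite (ltW (Hc j).1) Hz.
Qed.

(** In modulus [xi] is [|z|^m |G z| Q^(Re z)] times the Gamma factors, and near [rho] all factors
    other than [G] are bounded below. An upper bound for [xi] is thus one for [G]. *)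
Lemma xi_G_vanishes (rho : C) (k : nat) : 1 / 2 <= Re rho ->
  vanishing_order (sf_xi F) rho k -> vanishes_to_order G rho k.
Proof.
move=> r2 [g [hg g0 xig]].
have hg' : holomorphic_at g rho.
  by move/near_normc: hg => [e e0 hg]; apply: hg; rewrite subrr normcR normr0.
have [e e0 He] := has_cderiv_continuous (derivable_cderiv hg') ltr01.
have Hg : \forall z \near (rho : C^o)^', normc (g z) <= normc (g rho) + 1.
  apply/near_punctured_normc; exists e => // z _ /He.
  by have := normc_sub_le (g z) (g rho); lra.
have Hz : \forall z \near (rho : C^o)^', 1 / 4 <= normc z /\ `|Re z| <= `|Re rho| + 1.
  apply/near_punctured_normc; exists (1 / 4); first lra.
  move=> z _ zn; have := Re_le_normc (z - rho); rewrite ReD ReN => h.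
  have /andP[h1 h2] : - (1 / 4) <= Re z - Re rho <= 1 / 4 by rewrite -ler_norml; lra.
  split; first by have := Re_le_normc z => /(le_trans (ler_norm _)); lra.
  have := ler_normD (Re z - Re rho) (Re rho); rewrite subrK; lra.
have [cg cg0 Hgam] : exists2 c : R, 0 < c & \forall z \near (rho : C^o)^',
    c <= \prod_(j < sf_r F) normc (cGamma ((sf_lam j)%:C * z + sf_mu j)).
  apply: prod_lower => j; apply: gamma_factor_lower => //.
    exact: sf_lam_gt0.
  exact: sf_lam_mu_gt0.
pose q := `|ln (sf_Q F)| * (`|Re rho| + 1).
pose c := (1 / 4) ^+ sf_m F * expR (- q) * cg.
have c0 : 0 < c by rewrite !mulr_gt0 ?expR_gt0 ?exprn_gt0 //; lra.
have : \forall z \near (rho : C^o)^', normc (G z) <=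
    (normc (g rho) + 1) / c * normc (z - rho) ^+ k.
  apply: filterS3 (near_neq 1 rho) Hgam _ => [z z1 zg|]; last first.
    exact: filterI xig (filterI Hg Hz).
  move=> [xiz [gz [zl zr]]].
  have xin : normc (sf_xi F z) = normc z ^+ sf_m F * normc (G z) *
      expR (ln (sf_Q F) * Re z) * \prod_(j < sf_r F) normc (cGamma ((sf_lam j)%:C * z + sf_mu j)).
    rewrite /sf_xi /completed GE //.
    rewrite (normcM _ (\prod_(j < _) _)) normc_prod (normcM _ (cpow _ _)) normc_cpow.
    rewrite (normcM _ (sf_fun F z)) (normcM (z ^+ _)) (normcM _ (sf_fun F z)) !normcX.
    by rewrite (normc_distC 1 z) !mulrA.
  have H1 : normc (G z) * c <= normc (sf_xi F z).
    rewrite xin [normc z ^+ _ * _]mulrC -!mulrA ler_wpM2l ?normc_ge0 // /c !mulrA.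
    apply: ler_pM => //; last first.
    - apply: ler_pM; rewrite ?exprn_ge0 ?expR_ge0 //.
        by rewrite lerXn2r ?nnegrE ?normc_ge0 //; lra.
      rewrite ler_expR lerNl; apply: (@le_trans _ _ `|ln (sf_Q F) * Re z|).
        by rewrite -normrN ler_norm.
      by rewrite normrM ler_wpM2l.
    - exact: ltW.
  rewrite mulrAC ler_pdivlMr //; apply: (le_trans H1).
  by rewrite xiz normcM normcX mulrC ler_wpM2r ?exprn_ge0 ?normc_ge0.
move=> /near_punctured_normc[eta eta0 H]; exists ((normc (g rho) + 1) / c), eta; split => //.
by rewrite divr_ge0 ?addr_ge0 ?normc_ge0 // ltW.
Qed.

(** The bound concerns [z != rho] only; the value at [rho] follows by continuity of [G], tested at
    [rho + h] with small real [h]. *)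
Lemma vanishes_to_order_eq0 (rho : C) (k : nat) : (0 < k)%N ->
  vanishes_to_order G rho k -> G rho = 0.
Proof.
case: k => // k _ [A [eta [A0 eta0 H]]]; apply/eqP; rewrite -normc_eq0 eq_le normc_ge0 andbT.
apply/ler_addgt0Pr => e e0; rewrite add0r.
have e2 : 0 < e / 2 by rewrite divr_gt0.
have [d Hd] := cG rho; have [del del0 Hc] := has_cderiv_continuous Hd e2.
pose h := Num.min 1 (Num.min (Num.min eta del) (e / (A + 1))) / 2.
have A1 : 0 < A + 1 by lra.
have m0 : 0 < Num.min 1 (Num.min (Num.min eta del) (e / (A + 1))).
  by rewrite !lt_min ltr01 eta0 del0 divr_gt0.
have h0 : 0 < h by rewrite divr_gt0.
have hb : [/\ h <= 1, h < eta, h < del & (A + 1) * (2 * h) <= e].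
  have hm : 2 * h = Num.min 1 (Num.min (Num.min eta del) (e / (A + 1))) by rewrite /h mulrC divfK.
  have m1 : 2 * h <= 1 by rewrite hm ge_min lexx.
  have m2 : 2 * h <= eta by rewrite hm !ge_min lexx !orbT.
  have m3 : 2 * h <= del by rewrite hm !ge_min lexx !orbT.
  have m4 : 2 * h <= e / (A + 1) by rewrite hm !ge_min lexx !orbT.
  by split; [lra|lra|lra|rewrite mulrC -ler_pdivlMr].
case: hb => h1 h2 h3 h4.
have hn : normc (rho + h%:C - rho) = h by rewrite addrAC subrr add0r normcR gtr0_norm.
have hne : rho + h%:C != rho.
  by rewrite -subr_eq0 -normc_eq0 hn gt_eqF.
have := H _ hne; rewrite hn => /(_ h2) Gh.
have {}Hc : normc (G (rho + h%:C) - G rho) < e / 2 by apply: Hc; rewrite hn.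
have hk : A * h ^+ k.+1 <= A * h.
  by rewrite ler_wpM2l // exprS ler_piMr ?exprn_ile1 // ltW.
have := normc_sub_le (G rho) (G (rho + h%:C)); rewrite (normc_distC (G rho)); lra.
Qed.

Lemma zeros_right_half (rho : C) : 1 / 2 <= Re rho -> nontrivial_zeros F rho ->
  right_zero G (zero_mult F) rho.
Proof.
move=> r2 k0; have V := xi_G_vanishes r2 (zero_multP k0).
split=> //; rewrite r2 /= leNgt; apply/negP => r1.
have := vanishes_to_order_eq0 k0 V; have rho1 := Re_neq1 r1.
rewrite GE // => /eqP; rewrite mulf_eq0 (negPf (sf_nonvanishing F r1)) orbF.
by rewrite expf_eq0 subr_eq0 (negPf rho1) andbF.
Qed.

Lemma nontrivial_zeros_reflect (rho : C) :
  nontrivial_zeros F rho -> nontrivial_zeros F (creflect rho).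
Proof. by rewrite /nontrivial_zeros /= zero_mult_reflect. Qed.

Lemma nontrivial_zeros_strip (rho : C) : nontrivial_zeros F rho -> 0 <= Re rho <= 1.
Proof.
move=> Zr; have [r2|r2] := leP (1 / 2) (Re rho).
  by have [_ /andP[_ h] _] := zeros_right_half r2 Zr; apply/andP; split; lra.
have r2' : 1 / 2 <= Re (creflect rho) by rewrite Re_reflect; lra.
have [_ + _] := zeros_right_half r2' (nontrivial_zeros_reflect Zr).
by rewrite Re_reflect => /andP[? ?]; apply/andP; split; lra.
Qed.

Lemma sum_over_zeros_bound : exists B : R, forall s : seq C, uniq s ->
  (forall rho, rho \in s -> nontrivial_zeros F rho) ->
  \sum_(rho <- s) (zero_mult F rho)%:R / (1 + Im rho ^+ 2) <= B.
Proof.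
have [B HB] := zero_sum_bound cG oG GE (zero_mult F).
exists (B + B) => s us Hs; rewrite (bigID (fun rho => 1 / 2 <= Re rho)) /=.
apply: lerD.
  rewrite -big_filter; apply: HB; first exact: filter_uniq.
  by move=> rho; rewrite mem_filter => /andP[r2 rs]; apply: zeros_right_half => //; exact: Hs.
rewrite -big_filter; set s' := [seq _ <- s | _].
have -> : \sum_(rho <- s') (zero_mult F rho)%:R / (1 + Im rho ^+ 2) =
    \sum_(rho <- map (@creflect R) s') (zero_mult F rho)%:R / (1 + Im rho ^+ 2) :> R.
  by rewrite big_map; apply: eq_bigr => rho _; rewrite zero_mult_reflect Im_reflect.
apply: HB.
  by rewrite map_inj_uniq ?filter_uniq //; exact: can_inj (@creflectK R).
move=> rho /mapP[rho' + ->]; rewrite mem_filter -ltNge => /andP[r2 rs].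
apply: zeros_right_half; first by rewrite Re_reflect; lra.
by apply: nontrivial_zeros_reflect; exact: Hs.
Qed.

End ZerosOfXi.

(** * Li coefficients *)

Lemma esum_subset (R : realType) (T : choiceType) (A B : set T) (a : T -> \bar R) :
  A `<=` B -> (\esum_(i in A) a i <= \esum_(i in B) a i)%E.
Proof.
move=> AB; apply: le_ereal_sup => _ [X [finX XA] <-].
by exists X => //; split => //; exact: subset_trans AB.
Qed.

Section LiCoefficients.
Context {R : realType}.
Local Notation C := R[i].
Local Notation Re := complex.Re.
Local Notation Im := complex.Im.
Variable F : selberg_sf R.
Local Notation Z := (nontrivial_zeros F).
Local Notation m := (zero_mult F).

Lemma sf_entire : exists G : C -> C, [/\ centire G, finite_order G &
  forall s, s != 1 -> G s = (s - 1) ^+ sf_m F * F s].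
Proof.
by have [G [eG oG GE]] := sf_continuation F; exists G; split => //; exact: entire_centire.
Qed.

Lemma nontrivial_zeros_critical_strip rho : Z rho -> 0 <= Re rho <= 1.
Proof. by have [G [cG _ GE]] := sf_entire; exact: (nontrivial_zeros_strip cG GE). Qed.

Lemma zeros_sum_bounded : exists2 B : R, 0 <= B & forall s : seq C, uniq s ->
  (forall rho, rho \in s -> Z rho) ->
  \sum_(rho <- s) (m rho)%:R / (1 + Im rho ^+ 2) <= B.
Proof.
have [G [cG oG GE]] := sf_entire; have [B HB] := sum_over_zeros_bound cG oG GE.
by exists B => //; have := HB [::] isT; rewrite big_nil; apply.
Qed.

(** Each zero of height at most [T] contributes at least [1 / (1 + T^2)] to a bounded sum.
    Finiteness makes [li_partial] the intended sum, rather than the default value of a sum with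
    infinite support. *)
Lemma zeros_upto_finite (T : R) : finite_set (zeros_upto F T).
Proof.
apply: contrapT => inf; have [B B0 HB] := zeros_sum_bounded.
have T2 : 0 < 1 + T ^+ 2 by rewrite ltr_pwDl // sqr_ge0.
have [X XZ Xn] := infinite_set_fset (Num.truncn (B * (1 + T ^+ 2))).+1 inf.
have := HB (finmap.enum_fset X) (finmap.fset_uniq X) (fun rho h => (XZ rho h).1).
apply/negP; rewrite -ltNge.
apply: (@lt_le_trans _ _ (\sum_(rho <- finmap.enum_fset X) (1 + T ^+ 2)^-1)).
  rewrite big_const_seq count_predT iter_addr addr0 -[X in _ < X]mulr_natl.
  rewrite ltr_pdivlMr //; apply: (lt_le_trans (truncnS_gt _)).
  by rewrite ler_nat.
rewrite big_seq [leRHS]big_seq; apply: ler_sum => rho rX.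
have [Zr /= rT] := XZ rho rX.
have m1 : 1 <= (m rho)%:R :> R by rewrite ler1n.
have i2 : 0 < 1 + Im rho ^+ 2 by rewrite ltr_pwDl // sqr_ge0.
rewrite ler_pdivlMr // mulrC ler_pdivrMr //.
apply: (@le_trans _ _ (1 + T ^+ 2)); last by rewrite ler_peMl // ltW.
rewrite lerD2l -real_normK ?num_real // lerXn2r ?nnegrE //.
exact: le_trans rT.
Qed.

Lemma esum_zeros_le (f : C -> R) (K : R) : 0 <= K ->
  (forall rho, Z rho -> f rho <= K / (1 + Im rho ^+ 2)) ->
  ((\esum_(rho in Z) ((m rho)%:R * f rho)%:E) < +oo)%E.
Proof.
move=> K0 H; have [B B0 HB] := zeros_sum_bounded.
apply: (@le_lt_trans _ _ (K * B)%:E); last by rewrite ltry.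
apply: ge_ereal_sup => _ [X [finX XZ] <-].
rewrite fsumEFin // lee_fin fsbig_finite //=.
apply: (@le_trans _ _ (K * \sum_(rho <- finmap.enum_fset (fset_set X)) (m rho)%:R / (1 + Im rho ^+ 2))).
  rewrite mulr_sumr big_seq [leRHS]big_seq; apply: ler_sum => rho.
  rewrite in_fset_set // inE => /XZ/H; rewrite mulrCA.
  exact: ler_wpM2l.
rewrite ler_wpM2l // HB ?finmap.fset_uniq // => rho.
by rewrite in_fset_set // inE => /XZ.
Qed.

(** For nonnegative terms the truncations by height exhaust every finite set of zeros, so their
    limit is the unordered sum. *)
Lemma esum_zeros_cvg (w : C -> R) (S : R) : (forall rho, Z rho -> 0 <= w rho) ->
  (\esum_(rho in Z) (w rho)%:E = S%:E)%E ->
  (\sum_(rho \in zeros_upto F T) w rho) @[T --> +oo] --> S.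
Proof.
move=> w0 wS; apply/cvgrPdist_le => e e0.
have ub T : \sum_(rho \in zeros_upto F T) w rho <= S.
  rewrite -lee_fin -wS -fsumEFin; last exact: zeros_upto_finite.
  apply: esum_ge; exists (zeros_upto F T) => //; split; first exact: zeros_upto_finite.
  by move=> rho [].
have : ((S - e)%:E < ereal_sup [set \sum_(rho \in X) (w rho)%:E | X in fsets Z])%E.
  by rewrite [ereal_sup _]wS lte_fin ltrBlDr ltrDl.
move=> /ereal_sup_gt[_ [X [finX XZ] <-]]; rewrite fsumEFin // lte_fin => HX.
(* The sum of the heights in [X] bounds each of them, so [X] is contained in [zeros_upto F T] for
   [T >= M]. *)
pose M := \sum_(rho <- finmap.enum_fset (fset_set X)) `|Im rho|.
near=> T; rewrite ger0_norm ?subr_ge0 //.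
suff : \sum_(rho \in X) w rho <= \sum_(rho \in zeros_upto F T) w rho by lra.
rewrite -lee_fin -!fsumEFin //; last exact: zeros_upto_finite.
rewrite -(esum_fset finX); last by move=> rho; rewrite inE => /XZ/w0; rewrite lee_fin.
rewrite -(esum_fset (zeros_upto_finite T)); last first.
  by move=> rho; rewrite inE => -[/w0]; rewrite lee_fin.
apply: esum_subset => rho Xr; split; first exact: XZ.
apply: (@le_trans _ _ M) => /=.
  have rX : rho \in finmap.enum_fset (fset_set X) by rewrite in_fset_set // inE.
  by rewrite /M (big_rem rho rX) /= lerDl sumr_ge0.
by near: T; apply: nbhs_pinfty_ge; exact: num_real.
Unshelve. all: by end_near. Qed.

(** Reflection fixes ordinates and so permutes each truncated set; pairing takes place in these
    finite sums, before any limit. *)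
Lemma sum_zeros_upto_reflect (h : C -> R) (T : R) :
  \sum_(rho \in zeros_upto F T) (m rho)%:R * h rho =
  \sum_(rho \in zeros_upto F T) (m rho)%:R * ((h rho + h (creflect rho)) / 2).
Proof.
rewrite !(fsbig_finite _ _ (zeros_upto_finite T)) /=; pose s : seq C := finmap.enum_fset (fset_set (zeros_upto F T)).
rewrite -/s.
have sP rho : (rho \in s) = (rho \in zeros_upto F T).
  by rewrite in_fset_set //; exact: zeros_upto_finite.
have pe : perm_eq s (map (@creflect R) s).
  have us : uniq s by exact: finmap.fset_uniq.
  apply: uniq_perm => //; first by rewrite map_inj_uniq //; exact: can_inj (@creflectK R).
  have refl rho : rho \in s -> creflect rho \in s.
    rewrite !sP !inE => -[/nontrivial_zeros_reflect ? ?].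
    by split=> //=; rewrite Im_reflect.
  move=> rho; apply/idP/mapP => [rs|[rho' rs ->]]; last exact: refl.
  by exists (creflect rho); rewrite ?creflectK ?refl.
have E : \sum_(rho <- s) (m rho)%:R * h rho = \sum_(rho <- s) (m rho)%:R * h (creflect rho).
  rewrite (perm_big _ pe) big_map; apply: eq_bigr => rho _.
  by rewrite zero_mult_reflect.
under [RHS]eq_bigr do rewrite mulrA mulrDr.
by rewrite -mulr_suml big_split /= -E; field.
Qed.

Lemma Re_li_partial n T : Re (li_partial F n T) =
  \sum_(rho \in zeros_upto F T) (m rho)%:R * Re (1 - (1 - rho^-1) ^ n).
Proof.
rewrite /li_partial !(fsbig_finite _ _ (zeros_upto_finite T)) /= Re_sum.
apply: eq_bigr => rho _; rewrite -(rmorph_nat (real_complex R)) ReM /=; ring.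
Qed.

(** The [lim] in [li_coeff] is evaluated by proving convergence: after pairing, the terms are
    nonnegative with finite sum. *)
Lemma Re_li_coeff (n : int) (p : C -> R) (K : R) : 0 <= K ->
  (forall rho, Z rho -> p rho =
    (Re (1 - (1 - rho^-1) ^ n) + Re (1 - (1 - (creflect rho)^-1) ^ n)) / 2) ->
  (forall rho, Z rho -> 0 <= p rho <= K / (1 + Im rho ^+ 2)) ->
  ((Re (li_coeff F n))%:E = \esum_(rho in Z) ((m rho)%:R * p rho)%:E)%E.
Proof.
move=> K0 pE pK.
have p0 rho : Z rho -> 0 <= (m rho)%:R * p rho.
  by move=> /pK/andP[? _]; rewrite mulr_ge0.
have fin : (\esum_(rho in Z) ((m rho)%:R * p rho)%:E)%E \is a fin_num.
  rewrite ge0_fin_numE; first by apply: (esum_zeros_le K0) => rho /pK/andP[].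
  by apply: esum_ge0 => rho /p0; rewrite lee_fin.
rewrite -(fineK fin); congr EFin; apply: cvg_lim => //.
have := esum_zeros_cvg p0 (esym (fineK fin)).
apply: cvg_trans; apply: near_eq_cvg; apply: nearW => T.
rewrite Re_li_partial [RHS]sum_zeros_upto_reflect.
by apply: eq_fsbigr => rho; rewrite inE => -[Zr _]; rewrite pE.
Qed.

Lemma GRH_iff (n : int) (p : C -> R) (q : R -> R) (K : R) : 0 <= K ->
  (forall rho, Z rho -> p rho =
    (Re (1 - (1 - rho^-1) ^ n) + Re (1 - (1 - (creflect rho)^-1) ^ n)) / 2) ->
  (forall rho, Z rho -> 0 <= p rho <= q (Im rho)) ->
  (forall g, q g <= K / (1 + g ^+ 2)) ->
  (forall rho, Z rho -> p rho = q (Im rho) <-> Re rho = 2^-1) ->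
  GRH F <-> (Re (li_coeff F n))%:E = sum_zeros_im F q.
Proof.
move=> K0 pE pq qK peq; have pK rho : Z rho -> 0 <= p rho <= K / (1 + Im rho ^+ 2).
  by move=> /pq/andP[-> /= /le_trans]; apply.
rewrite (Re_li_coeff K0 pE pK) /sum_zeros_im; split=> [grh|E rho Zr].
  by apply: eq_esum => rho Zr; rewrite ((peq _ Zr).2 (grh _ Zr)).
apply/(peq _ Zr); apply/eqP; rewrite eq_sym -subr_eq0.
(* Finiteness allows the sum of the [p] to be cancelled from both sides. The nonnegative defects
   [q - p] then have sum 0, so the one at [rho] vanishes. *)
have fin : (\esum_(rho in Z) ((m rho)%:R * p rho)%:E)%E \is a fin_num.
  rewrite ge0_fin_numE; first by apply: (esum_zeros_le K0) => r /pK/andP[].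
  by apply: esum_ge0 => r /pK/andP[? _]; rewrite lee_fin mulr_ge0.
have D0 r : Z r -> (0 <= ((m r)%:R * (q (Im r) - p r))%:E)%E.
  by move=> /pq/andP[_ h]; rewrite lee_fin mulr_ge0 // subr_ge0.
have : (\esum_(r in Z) ((m r)%:R * (q (Im r) - p r))%:E = 0)%E.
  have := E; rewrite [RHS](_ : _ = \esum_(r in Z) (((m r)%:R * p r)%:E +
      ((m r)%:R * (q (Im r) - p r))%:E)%E); last first.
    by apply: eq_esum => r _; rewrite -EFinD; congr EFin; ring.
  rewrite esumD //; last by move=> r /pK/andP[? _]; rewrite lee_fin mulr_ge0.
  move: fin; case: (\esum_(r in Z) ((m r)%:R * p r)%:E)%E => // r _.
  case: (\esum_(r in Z) _)%E => // d; rewrite -EFinD => -[] h.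
  by congr EFin; lra.
move=> S0; have : (((m rho)%:R * (q (Im rho) - p rho))%:E <= 0)%E.
  rewrite -S0 -(@esum_set1 _ _ rho (fun r => ((m r)%:R * (q (Im r) - p r))%:E)); last exact: D0.
  by apply: esum_subset => r ->.
rewrite lee_fin pmulr_rle0 ?ltr0n //.
by have /andP[_ h] := pq _ Zr => h2; rewrite eq_le h2 subr_ge0.
Qed.

End LiCoefficients.

(** * The inequalities between paired terms for [n = 1] and [n = 2] *)

Section PairedTerms.
Context {R : realType}.
Local Notation C := R[i].
Local Notation Re := complex.Re.
Local Notation Im := complex.Im.
Implicit Types x y : R.

(** [li_term1] and [li_term2] are the real parts of [1 - (1 - 1/rho)^n] at [rho = x + i y], for
    [n = 1] and [n = 2]. *)
Definition li_term1 x y : R := x / (x ^+ 2 + y ^+ 2).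
Definition li_term2 x y : R :=
  2 * x / (x ^+ 2 + y ^+ 2) - (x ^+ 2 - y ^+ 2) / (x ^+ 2 + y ^+ 2) ^+ 2.

Lemma Re_li_term1 (rho : C) : Re (1 - (1 - rho^-1) ^ 1) = li_term1 (Re rho) (Im rho).
Proof. by rewrite expr1z opprB addrC subrK; case: rho => a b. Qed.

Lemma Re_li_term2 (rho : C) : Re (1 - (1 - rho^-1) ^ 2) = li_term2 (Re rho) (Im rho).
Proof.
have -> : (1 - rho^-1) ^ 2 = (1 - rho^-1) ^+ 2 by [].
have -> : 1 - (1 - rho^-1) ^+ 2 = 2 * rho^-1 - rho^-1 * rho^-1 by ring.
case: rho => a b; rewrite -(rmorph_nat (real_complex R)) ReD ReN !ReM /= /li_term2 -exprVn.
by ring.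
Qed.

(** With [u = y^2], the difference of bound and paired term is
    [(x - 1/2)^2 (3 u + (x - 1/2)^2 - 1/4)] over a positive denominator. Off the critical line
    [u > 1/3] makes it positive. *)
Lemma li_pair1 x y : (x != 2^-1 -> 3^-1 < y ^+ 2) ->
  let p := (li_term1 x y + li_term1 (1 - x) y) / 2 in
  0 <= x <= 1 ->
  0 <= p <= 2 / (4 * y ^+ 2 + 1) /\ (p = 2 / (4 * y ^+ 2 + 1) <-> x = 2^-1).
Proof.
move=> Hy p /andP[x0 x1]; rewrite /p /li_term1.
have y2 : 0 <= y ^+ 2 by exact: sqr_ge0.
have q0 : 0 < 4 * y ^+ 2 + 1 by lra.
have [xE|xn] := eqVneq x 2^-1.
  have -> : (x / (x ^+ 2 + y ^+ 2) + (1 - x) / ((1 - x) ^+ 2 + y ^+ 2)) / 2 = 2 / (4 * y ^+ 2 + 1).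
    by rewrite xE; field; lra.
  by rewrite lexx divr_ge0 // ltW.
have {}Hy := Hy xn; move: (y ^+ 2) y2 q0 Hy => u u0 q0 Hu.
have N1 : 0 < x ^+ 2 + u by have := sqr_ge0 x; lra.
have N2 : 0 < (1 - x) ^+ 2 + u by have := sqr_ge0 (1 - x); lra.
have e0 : 0 < (x - 2^-1) ^+ 2 by rewrite exprn_even_gt0 //= subr_eq0.
have E : 2 / (4 * u + 1) - (x / (x ^+ 2 + u) + (1 - x) / ((1 - x) ^+ 2 + u)) / 2 =
   (x - 2^-1) ^+ 2 * (3 * u + (x - 2^-1) ^+ 2 - 4^-1) /
   (2 * (4^-1 + u) * (x ^+ 2 + u) * ((1 - x) ^+ 2 + u)).
  by field; rewrite !gt_eqF //; lra.
have lt : (x / (x ^+ 2 + u) + (1 - x) / ((1 - x) ^+ 2 + u)) / 2 < 2 / (4 * u + 1).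
  rewrite -subr_gt0 E; move: ((x - 2^-1) ^+ 2) e0 => e e0.
  by apply: divr_gt0; [|apply: mulr_gt0 => //; apply: mulr_gt0 => //];
    apply: mulr_gt0 => //; lra.
split; last by split=> H; [move: lt; rewrite H ltxx|move: xn; rewrite H eqxx].
rewrite (ltW lt) andbT divr_ge0 // addr_ge0 // divr_ge0 ?(ltW N1) ?(ltW N2) //; lra.
Qed.

(** In the variables [e = (x - 1/2)^2] and [b = u + 1/4], where [u = y^2], the product of the
    denominators is [P = b^2 + e (2 b + e - 1) >= b^2]. The difference to the bound is [2 e] times
    [P b^2 + u (P (2 b + e - 1) - 2 b^2)] over a positive quantity; [b > 6] makes it positive. The
    paired term is nonnegative because [x^2 <= 1 < u], and likewise for [1 - x]. *)
Lemma li_pair2 x y : (x != 2^-1 -> 6 < y ^+ 2) ->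
  let p := (li_term2 x y + li_term2 (1 - x) y) / 2 in
  0 <= x <= 1 ->
  0 <= p <= 32 * y ^+ 2 / (4 * y ^+ 2 + 1) ^+ 2 /\
  (p = 32 * y ^+ 2 / (4 * y ^+ 2 + 1) ^+ 2 <-> x = 2^-1).
Proof.
move=> Hy p /andP[x0 x1]; rewrite /p /li_term2.
have y2 : 0 <= y ^+ 2 by exact: sqr_ge0.
have q0 : 0 < 4 * y ^+ 2 + 1 by lra.
move: (y ^+ 2) y2 q0 Hy => u u0 q0 Hu.
have [xE|xn] := eqVneq x 2^-1.
  have -> : (2 * x / (x ^+ 2 + u) - (x ^+ 2 - u) / (x ^+ 2 + u) ^+ 2 +
      (2 * (1 - x) / ((1 - x) ^+ 2 + u) - ((1 - x) ^+ 2 - u) / ((1 - x) ^+ 2 + u) ^+ 2)) / 2 =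
      32 * u / (4 * u + 1) ^+ 2.
    by rewrite xE; field; lra.
  by rewrite lexx divr_ge0 ?mulr_ge0 // ?exprn_ge0 // ltW.
have {}Hu := Hu xn.
have N1 : 0 < x ^+ 2 + u by have := sqr_ge0 x; lra.
have N2 : 0 < (1 - x) ^+ 2 + u by have := sqr_ge0 (1 - x); lra.
have e0 : 0 < (x - 2^-1) ^+ 2 by rewrite exprn_even_gt0 //= subr_eq0.
pose P := (x ^+ 2 + u) * ((1 - x) ^+ 2 + u).
pose e := (x - 2^-1) ^+ 2; pose b := u + 4^-1.
have PE : P = b ^+ 2 + e * (2 * b + e - 1) by rewrite /P /e /b; field.
have E : 32 * u / (4 * u + 1) ^+ 2 -
    (2 * x / (x ^+ 2 + u) - (x ^+ 2 - u) / (x ^+ 2 + u) ^+ 2 +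
      (2 * (1 - x) / ((1 - x) ^+ 2 + u) - ((1 - x) ^+ 2 - u) / ((1 - x) ^+ 2 + u) ^+ 2)) / 2 =
   2 * e * (P * b ^+ 2 + u * (P * (2 * b + e - 1) - 2 * b ^+ 2)) / (b ^+ 2 * P ^+ 2).
  by rewrite /P /e /b; field; rewrite !gt_eqF //; lra.
have b6 : 6 < b by rewrite /b; lra.
have e0' : 0 < e by [].
have b2 : 0 < b ^+ 2 by rewrite exprn_gt0 //; lra.
have Pb : b ^+ 2 <= P.
  rewrite PE lerDl mulr_ge0 //; [exact: ltW|lra].
have P0 : 0 < P by exact: lt_le_trans Pb.
have K0 : 0 <= P * (2 * b + e - 1) - 2 * b ^+ 2.
  have : b ^+ 2 * 2 <= P * (2 * b + e - 1) by apply: ler_pM => //; lra.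
  lra.
have lt : (2 * x / (x ^+ 2 + u) - (x ^+ 2 - u) / (x ^+ 2 + u) ^+ 2 +
      (2 * (1 - x) / ((1 - x) ^+ 2 + u) - ((1 - x) ^+ 2 - u) / ((1 - x) ^+ 2 + u) ^+ 2)) / 2
      < 32 * u / (4 * u + 1) ^+ 2.
  rewrite -subr_gt0 E divr_gt0 //; last by rewrite mulr_gt0 // exprn_gt0.
  apply: mulr_gt0; first exact: mulr_gt0.
  by apply: ltr_pwDl; [exact: mulr_gt0|exact: mulr_ge0].
split; last by split=> H; [move: lt; rewrite H ltxx|move: xn; rewrite H eqxx].
rewrite (ltW lt) andbT divr_ge0 //.
have pos z : 0 <= z <= 1 -> 0 <= 2 * z / (z ^+ 2 + u) - (z ^+ 2 - u) / (z ^+ 2 + u) ^+ 2.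
  move=> /andP[z0 z1]; have z2 : z ^+ 2 <= 1 by rewrite exprn_ile1.
  rewrite addr_ge0 //.
    by rewrite divr_ge0 ?mulr_ge0 // addr_ge0 ?sqr_ge0.
  by rewrite -mulNr divr_ge0 ?exprn_ge0 // ?addr_ge0 ?sqr_ge0 //; lra.
by rewrite addr_ge0 // pos //; apply/andP; split; lra.
Qed.

Variable F : selberg_sf R.

Lemma zero_free_sqr (t : R) rho : 0 <= t -> zero_free_upto F t -> nontrivial_zeros F rho ->
  Re rho != 2^-1 -> t ^+ 2 < Im rho ^+ 2.
Proof.
move=> t0 H Zr r2; rewrite -[ltRHS]real_normK ?num_real // ltrXn2r ?nnegrE //.
exact: H.
Qed.

Lemma inv_le_inv_Im (g : R) : (4 * g ^+ 2 + 1)^-1 <= (1 + g ^+ 2)^-1.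
Proof. by have := sqr_ge0 g => ?; rewrite lef_pV2 ?posrE; lra. Qed.

Lemma GRH_li1 : zero_free_upto F (Num.sqrt 3)^-1 ->
  GRH F <-> (Re (li_coeff F 1))%:E = sum_zeros_im F (fun g => 2 / (4 * g ^+ 2 + 1)).
Proof.
move=> zf; pose p (rho : C) := (li_term1 (Re rho) (Im rho) + li_term1 (1 - Re rho) (Im rho)) / 2.
have H rho (Zr : nontrivial_zeros F rho) := @li_pair1 (Re rho) (Im rho).
have zf' rho : nontrivial_zeros F rho -> Re rho != 2^-1 -> 3^-1 < Im rho ^+ 2.
  move=> Zr r2; have := zero_free_sqr _ zf Zr r2.
  by rewrite invr_ge0 sqrtr_ge0 exprVn sqr_sqrtr // => /(_ isT).
apply: (GRH_iff (p := p) (K := 2)) => //.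
- by move=> rho _; rewrite /p !Re_li_term1 Re_reflect Im_reflect.
- by move=> rho Zr; have [] := H _ Zr (zf' _ Zr) (nontrivial_zeros_critical_strip Zr).
- by move=> g; rewrite ler_pM2l // inv_le_inv_Im.
- by move=> rho Zr; have [] := H _ Zr (zf' _ Zr) (nontrivial_zeros_critical_strip Zr).
Qed.

Lemma GRH_li2 : zero_free_upto F (Num.sqrt 6) ->
  GRH F <-> (Re (li_coeff F 2))%:E =
    sum_zeros_im F (fun g => 32 * g ^+ 2 / (4 * g ^+ 2 + 1) ^+ 2).
Proof.
move=> zf; pose p (rho : C) := (li_term2 (Re rho) (Im rho) + li_term2 (1 - Re rho) (Im rho)) / 2.
have H rho (Zr : nontrivial_zeros F rho) := @li_pair2 (Re rho) (Im rho).
have zf' rho : nontrivial_zeros F rho -> Re rho != 2^-1 -> 6 < Im rho ^+ 2.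
  move=> Zr r2; have := zero_free_sqr (sqrtr_ge0 _) zf Zr r2.
  by rewrite sqr_sqrtr.
apply: (GRH_iff (p := p) (K := 8)) => //.
- by move=> rho _; rewrite /p !Re_li_term2 Re_reflect Im_reflect.
- by move=> rho Zr; have [] := H _ Zr (zf' _ Zr) (nontrivial_zeros_critical_strip Zr).
- move=> g; have g2 := sqr_ge0 g; have q0 : 0 < 4 * g ^+ 2 + 1 by lra.
  apply: (@le_trans _ _ (8 / (4 * g ^+ 2 + 1))); last by rewrite ler_pM2l // inv_le_inv_Im.
  rewrite ler_pdivrMr ?exprn_gt0 //.
  have -> : 8 / (4 * g ^+ 2 + 1) * (4 * g ^+ 2 + 1) ^+ 2 = 8 * (4 * g ^+ 2 + 1).
    by field; rewrite gt_eqF.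
  lra.
- by move=> rho Zr; have [] := H _ Zr (zf' _ Zr) (nontrivial_zeros_critical_strip Zr).
Qed.

End PairedTerms.

(** * The zero-counting function *)

Section CountingIntegral.
Context {R : realType}.
Local Notation C := R[i].
Local Notation Re := complex.Re.
Local Notation Im := complex.Im.
Local Notation mu := (@lebesgue_measure R).

Definition count_kernel (x : R) : R := (4 * x ^+ 2 + 1)^-1.

(* [count_tail] is the integral of [count_weight] from [x] to infinity. *)
Definition count_weight (n : nat) (x : R) : R := x * count_kernel x ^+ n.+2.

Definition count_tail (n : nat) (x : R) : R := (8 * n.+1%:R)^-1 * count_kernel x ^+ n.+1.

Lemma kern_gt0 x : 0 < count_kernel x.
Proof. by rewrite invr_gt0; have := sqr_ge0 x; lra. Qed.

Lemma tail_ge0 n x : 0 <= count_tail n x.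
Proof. by rewrite /count_tail mulr_ge0 ?invr_ge0 ?mulr_ge0 // exprn_ge0 // ltW // kern_gt0. Qed.

Lemma is_derive_kern (x : R) : is_derive x (1 : R) count_kernel (- 8 * x * count_kernel x ^+ 2).
Proof.
have q0 : 4 * x ^+ 2 + 1 != 0 by rewrite gt_eqF //; have := sqr_ge0 x; lra.
have H : is_derive x (1 : R) (fun x => 4 * x ^+ 2 + 1) (8 * x).
  apply/is_derive_eps => e e0; exists (e / 4); first by rewrite divr_gt0.
  move=> h he; rewrite (_ : _ - _ = 4 * h * h); last by ring.
  rewrite 2!normrM (ger0_norm (_ : 0 <= 4)) // ler_wpM2r //; lra.
have := @is_deriveV R (fun x => 4 * x ^+ 2 + 1) x _ 1 q0 H.
by congr is_derive; rewrite /count_kernel /GRing.scale /=; field.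
Qed.

Lemma is_derive_kernX n (x : R) :
  is_derive x (1 : R) (fun x => count_kernel x ^+ n.+1) (- 8 * n.+1%:R * (x * count_kernel x ^+ n.+2)).
Proof.
elim: n => [|n IH].
  have -> : - 8 * 1%:R * (x * count_kernel x ^+ 2) = - 8 * x * count_kernel x ^+ 2 by ring.
  exact: is_derive_kern.
have := is_deriveM (is_derive_kern x) IH.
rewrite (_ : count_kernel * _ = fun x => count_kernel x ^+ n.+2); last first.
  by apply/funext => y; rewrite exprS.
congr is_derive; rewrite /GRing.scale /= -[in RHS](natr1 n.+1) !exprS; ring.
Qed.

Lemma weight_continuous n : continuous (count_weight n).
Proof.
move=> x; apply: differentiable_continuous; apply/derivable1_diffP.
have := is_deriveM (is_derive_id x (1 : R)) (is_derive_kernX n.+1 x).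
by case.
Qed.

Lemma integral_weight n (a : R) : 0 <= a ->
  (\int[mu]_(x in `[a, +oo[) (count_weight n x)%:E = (count_tail n a)%:E)%E.
Proof.
move=> a0.
have DF (x : R) : is_derive x (1 : R) (fun x => - count_tail n x) (count_weight n x).
  have := is_deriveN (is_deriveZ (8 * n.+1%:R)^-1 (is_derive_kernX n x)).
  congr is_derive; rewrite /GRing.scale /= /count_weight; field.
  by rewrite addrC natr1 pnatr_eq0.
rewrite (@ge0_continuous_FTC2y _ (count_weight n) (fun x => - count_tail n x) a 0) ?sub0e -?EFinN ?opprK //.
- move=> x ax; rewrite mulr_ge0 ?exprn_ge0 ?(ltW (kern_gt0 x)) //.
  exact: le_trans ax.
- exact: continuous_subspaceT (@weight_continuous n).
- apply/cvgrPdist_le => e e0; near=> x.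
  have x1 : 1 <= x by near: x; apply: nbhs_pinfty_ge; exact: num_real.
  have xe : e^-1 <= x by near: x; apply: nbhs_pinfty_ge; exact: num_real.
  have k0 := kern_gt0 x.
  have x2 : x <= x ^+ 2 by rewrite expr2 ler_peMl //; lra.
  have kx : count_kernel x <= x^-1 by rewrite lef_pV2 ?posrE //; lra.
  have k1 : count_kernel x <= 1 by apply: (le_trans kx); rewrite invf_le1 //; lra.
  have ke : count_kernel x <= e.
    apply: (le_trans kx); rewrite -[leRHS]invrK lef_pV2 ?posrE ?invr_gt0 //; lra.
  rewrite sub0r opprK ger0_norm ?tail_ge0 //.
  apply: le_trans ke; rewrite /count_tail exprS mulrCA ler_piMr ?(ltW k0) //.
  rewrite mulr_ile1 ?invr_ge0 ?mulr_ge0 ?exprn_ge0 ?exprn_ile1 ?(ltW k0) //.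
  rewrite invf_le1 ?mulr_gt0 // -natrM ler1n //.
- have cF : {for a, continuous (fun x => - count_tail n x)}.
    by apply: differentiable_continuous; apply/derivable1_diffP; case: (DF a).
  exact: cvg_at_right_filter cF.
- by move=> x _; rewrite derive1E; case: (DF x).
Unshelve. all: by end_near. Qed.

Variable F : selberg_sf R.
Local Notation Z := (nontrivial_zeros F).
Local Notation m := (zero_mult F).

(** Turns sums over zeros into series over [nat], which can be integrated term by term. *)
Lemma zeros_countable : countable Z.
Proof.
have -> : Z = \bigcup_(n in [set: nat]) zeros_upto F n%:R.
  apply/seteqP; split=> [rho Zr|rho [n _ []]] //.
  exists (Num.truncn `|Im rho|).+1 => //; split=> //=.
  exact: ltW (truncnS_gt _).
by apply: bigcup_countable => // n _; apply: finite_set_countable; exact: zeros_upto_finite.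
Qed.

(** The zeros are enumerated by a bijection [e] from a set [B] of naturals, with terms outside [B]
    set to 0. The zero [e i] is counted by [N_F] exactly on [[|Im (e i)|, +oo[], where the weight
    has integral [count_tail]. Measurability is recorded as well, for the integrability argument in
    [integral_count2]. *)
Lemma integral_weight_zero_count n :
  measurable_fun (`[0%R, +oo[ : set R) (fun x => (count_weight n x)%:E * zero_count F x)%E /\
  (\int[mu]_(x in `[0%R, +oo[) ((count_weight n x)%:E * zero_count F x) =
   \esum_(rho in Z) ((m rho)%:R * count_tail n (Im rho))%:E)%E.
Proof.
have [e [B eB]] : exists (e : nat -> C) (B : set nat), set_bij B Z e.
  have /countable_bijP[B] := zeros_countable; rewrite card_eq_sym.
  by move=> /(@card_set_bijP nat C^o)[e eB]; exists e, B.
have D0 : measurable (`[0%R, +oo[ : set R) by exact: measurable_itv.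
pose E i : set R := [set x | `|Im (e i)| <= x].
pose g i : R -> \bar R := (EFin \o count_weight n) \_ (E i).
pose f i x : \bar R := if i \in B then ((m (e i))%:R%:E * g i x)%E else 0%E.
have EE i : E i = `[`|Im (e i)|, +oo[%classic.
  by apply/seteqP; split=> x; rewrite /E /= in_itv /= andbT.
have w0 x : 0 <= x -> 0 <= count_weight n x.
  by move=> x0; rewrite mulr_ge0 // exprn_ge0 // ltW // kern_gt0.
have r0 i x : 0 <= x -> (0 <= g i x)%E.
  by move=> x0; rewrite /g patchE; case: ifP => // _; rewrite lee_fin w0.
have f0 i x : `[0%R, +oo[%classic x -> (0 <= f i x)%E.
  rewrite /= in_itv /= andbT => x0; rewrite /f; case: ifP => // _.
  by rewrite mule_ge0 ?lee_fin // r0.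
have mr i : measurable_fun (`[0%R, +oo[ : set R) (g i).
  apply/measurable_restrict => //; first by rewrite EE; exact: measurable_itv.
  apply: measurable_funTS; apply/measurable_EFinP.
  apply: continuous_measurable_fun; exact: weight_continuous.
have mf i : measurable_fun (`[0%R, +oo[ : set R) (f i).
  rewrite /f; case: (i \in B); last exact: measurable_cst.
  exact: measurable_funeM.
have [_ einj eimg] : [/\ True, set_inj B e & [set e i | i in B] = Z].
  case: eB => e1 e2 e3; split=> //; apply/seteqP; split; last exact: e3.
  by move=> _ [i Bi <-]; exact: e1.
have sumE (a : C -> \bar R) : (forall rho, (0 <= a rho)%E) ->
    (\esum_(rho in Z) a rho = \sum_(0 <= i <oo) (if i \in B then a (e i) else 0))%E.
  move=> ap; rewrite -eimg esum_set_image //.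
  exact: eseries_mkcond.
have fx x : `[0%R, +oo[%classic x -> ((count_weight n x)%:E * zero_count F x = \sum_(0 <= i <oo) f i x)%E.
  rewrite /= in_itv /= andbT => x0.
  rewrite /zero_count /zeros_upto esum_mkcondr sumE; last first.
    by move=> rho; case: ifP => // _; rewrite lee_fin.
  rewrite -nneseriesZl; last by move=> i _; case: ifP => // _; case: ifP => // _; rewrite lee_fin.
  apply: eq_eseriesr => i _; rewrite /f; case: ifP => _; last by rewrite mule0.
  rewrite /g patchE; have -> : (x \in E i) = (e i \in [set rho | `|Im rho| <= x]).
    by apply/idP/idP; rewrite !inE.
  by case: ifP => _; rewrite ?mule0 // muleC.
split.
  apply: (eq_measurable_fun (fun x => \sum_(0 <= i <oo | i \in xpredT) f i x)%E).
    by move=> x; rewrite inE => /fx ->; apply: eq_eseriesl => i.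
  by apply: ge0_emeasurable_sum => // i x /f0.
transitivity (\int[mu]_(x in `[0%R, +oo[) (\sum_(0 <= i <oo) f i x))%E.
  by apply: eq_integral => x; rewrite inE => /fx.
rewrite integral_nneseries // sumE; last first.
  by move=> rho; rewrite lee_fin mulr_ge0 // tail_ge0.
apply: eq_eseriesr => i _; rewrite /f; case: ifP => _; last by rewrite integral0.
have gr0 x : `[0%R, +oo[%classic x -> (0 <= g i x)%E.
  by rewrite /= in_itv /= andbT; exact: r0.
rewrite (ge0_integralZl_EFin mu D0 gr0 (mr i)) //.
rewrite -integral_mkcondr (_ : _ `&` E i = `[`|Im (e i)|, +oo[%classic); last first.
  rewrite EE; apply/seteqP; split=> [x []//|x]; rewrite /= !in_itv /= !andbT => h; split=> //.
  exact: le_trans h.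
rewrite integral_weight // -EFinM; congr (_ * _)%:E.
by rewrite /count_tail /count_kernel real_normK ?num_real.
Qed.

Lemma zero_sum_tail_fin n : (\esum_(rho in Z) ((m rho)%:R * count_tail n (Im rho))%:E)%E \is a fin_num.
Proof.
rewrite ge0_fin_numE; last first.
  by apply: esum_ge0 => rho _; rewrite lee_fin mulr_ge0 // tail_ge0.
apply: (@esum_zeros_le _ F (fun rho => count_tail n (Im rho)) 1) => // rho _.
have k0 := kern_gt0 (Im rho).
have k1 : count_kernel (Im rho) <= 1.
  by rewrite invf_le1; have := sqr_ge0 (Im rho); lra.
rewrite mul1r; apply: le_trans (inv_le_inv_Im (Im rho)).
rewrite /count_tail exprS mulrCA ler_piMr ?(ltW k0) //.
rewrite mulr_ile1 ?invr_ge0 ?mulr_ge0 ?exprn_ge0 ?exprn_ile1 ?(ltW k0) //.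
by rewrite invf_le1 ?mulr_gt0 // -natrM ler1n.
Qed.

End CountingIntegral.

(** One inequality suffices: applied to [c] and then to [c^-1] it gives both. *)
Lemma esumZ (R : realType) (T : choiceType) (A : set T) (a : T -> R) (c : R) : 0 < c ->
  (\esum_(i in A) (c * a i)%:E = c%:E * \esum_(i in A) (a i)%:E)%E.
Proof.
have le (b : T -> R) (k : R) : 0 < k ->
    (\esum_(i in A) (k * b i)%:E <= k%:E * \esum_(i in A) (b i)%:E)%E.
  move=> k0; apply: ge_ereal_sup => _ [X [finX XA] <-].
  rewrite fsumEFin // -mulr_fsumr // EFinM -fsumEFin // lee_pmul2l //.
  by apply: esum_ge; exists X.
move=> c0; apply/eqP; rewrite eq_le le //=.
have ci : 0 < c^-1 by rewrite invr_gt0.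
have := le (fun i => c * a i) _ ci.
under eq_esum do rewrite mulKf ?gt_eqF //.
move=> h; rewrite -(@lee_pmul2l _ c^-1%:E) ?lte_fin //.
by rewrite muleA -EFinM mulVf ?gt_eqF // mul1e.
Qed.

Section CountingIdentities.
Context {R : realType}.
Local Notation mu := (@lebesgue_measure R).
Variable F : selberg_sf R.

Lemma integral_count1 :
  (16%:E * \int[mu]_(x in `[0%R, +oo[) ((x / (4 * x ^+ 2 + 1) ^+ 2)%R%:E * zero_count F x) =
   sum_zeros_im F (fun g => 2 / (4 * g ^+ 2 + 1))%R)%E.
Proof.
have [_ E] := integral_weight_zero_count F 0.
transitivity (16%:E * \int[mu]_(x in `[0%R, +oo[) ((count_weight 0 x)%:E * zero_count F x))%E.
  by congr (_ * _)%E; apply: eq_integral => x _; rewrite /count_weight /count_kernel exprVn.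
rewrite E -esumZ //; apply: eq_esum => rho _; congr EFin.
by rewrite /count_tail /count_kernel; field; have := sqr_ge0 (complex.Im rho); lra.
Qed.

(** The kernel changes sign at [x = 1/2]. By [4 x^2 - 1 = (4 x^2 + 1) - 2] it is
    [count_weight 0 - 2 count_weight 1], a difference of nonnegative weights that are both
    integrable against [N_F]. *)
Lemma integral_count2 :
  (64%:E * \int[mu]_(x in `[0%R, +oo[)
     ((x * (4 * x ^+ 2 - 1) / (4 * x ^+ 2 + 1) ^+ 3)%R%:E * zero_count F x) =
   sum_zeros_im F (fun g => 32 * g ^+ 2 / (4 * g ^+ 2 + 1) ^+ 2)%R)%E.
Proof.
have D0 : measurable (`[0%R, +oo[ : set R) by exact: measurable_itv.
have N0 x : (0 <= zero_count F x)%E.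
  by apply: esum_ge0 => rho _; rewrite lee_fin.
have Nfin x : zero_count F x \is a fin_num.
  rewrite /zero_count esum_fset; last 2 first.
  - exact: zeros_upto_finite.
  - by move=> rho _; rewrite lee_fin.
  by rewrite fsumEFin //; exact: zeros_upto_finite.
have intw n : mu.-integrable `[0%R, +oo[ (fun x => (count_weight n x)%:E * zero_count F x)%E.
  have [mw E] := integral_weight_zero_count F n.
  apply/integrableP; split=> //.
  rewrite (_ : integral _ _ _ = \int[mu]_(x in `[0%R, +oo[) ((count_weight n x)%:E * zero_count F x))%E.
    by rewrite E ltey_eq zero_sum_tail_fin.
  apply: eq_integral => x; rewrite inE /= in_itv /= andbT => x0.
  rewrite gee0_abs // mule_ge0 // lee_fin mulr_ge0 // exprn_ge0 // ltW //.
  exact: kern_gt0.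
transitivity (64%:E * \int[mu]_(x in `[0%R, +oo[) ((count_weight 0 x)%:E * zero_count F x -
    2%:E * ((count_weight 1 x)%:E * zero_count F x)))%E.
  congr (_ * _)%E; apply: eq_integral => x _.
  rewrite -(fineK (Nfin x)) -!EFinM -EFinB; congr EFin; rewrite /count_weight /count_kernel; field.
  by rewrite gt_eqF //; have := sqr_ge0 x; lra.
rewrite integralB //; last exact: integrableZl.
rewrite integralZl // !(integral_weight_zero_count F _).2.
have fin n := zero_sum_tail_fin F n.
pose S n : \bar R := (\esum_(rho in nontrivial_zeros F)
  ((zero_mult F rho)%:R * count_tail n (complex.Im rho))%:E)%E.
(* With [k = 1 / (4 g^2 + 1)] this is [8 k = 32 g^2 k^2 + 8 k^2] summed over the zeros, stated
   additively so that [esumD] applies to nonnegative terms; finiteness then permits the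
   subtraction. *)
have S0 : (64%:E * S 0%N =
   sum_zeros_im F (fun g => 32 * g ^+ 2 / (4 * g ^+ 2 + 1) ^+ 2)%R + 128%:E * S 1%N)%E.
  rewrite -!esumZ // /sum_zeros_im -esumD; last 2 first.
  - by move=> rho _; rewrite lee_fin mulr_ge0 // divr_ge0 ?sqr_ge0 // mulr_ge0 ?sqr_ge0.
  - by move=> rho _; rewrite lee_fin; apply: mulr_ge0 => //; rewrite mulr_ge0 // tail_ge0.
  apply: eq_esum => rho _; rewrite -EFinD; congr EFin.
  by rewrite /count_tail /count_kernel; field; have := sqr_ge0 (complex.Im rho); lra.
move: S0 (fin 0%N) (fin 1%N); rewrite -!/(S _).
case: (S 0%N) => // s0; case: (S 1%N) => // s1 + _ _.
case: (sum_zeros_im _ _) => // s [h].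
by transitivity (64 * (s0 - 2 * s1))%:E => //; congr EFin; lra.
Qed.

End CountingIdentities.

Unset Implicit Arguments.
Local Close Scope complex_scope.

Theorem theorem3 (R : realType) :
  (forall F : selberg_sf R, zero_free_upto F (Num.sqrt 3)^-1 ->
    (GRH F <->
       ((complex.Re (li_coeff F 1))%:E =
        16%:E * \int[lebesgue_measure]_(x in `[0%R, +oo[)
                  ((x / (4 * x ^+ 2 + 1) ^+ 2)%R%:E * zero_count F x))%E)
    /\
    (GRH F <->
       (complex.Re (li_coeff F 1))%:E =
         sum_zeros_im F (fun g => 1 - (4 * g ^+ 2 - 1) / (4 * g ^+ 2 + 1)) /\
       sum_zeros_im F (fun g => 1 - (4 * g ^+ 2 - 1) / (4 * g ^+ 2 + 1)) =
         sum_zeros_im F (fun g => 2 / (4 * g ^+ 2 + 1))))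
  /\
  (forall F : selberg_sf R, zero_free_upto F (Num.sqrt 6) ->
    (GRH F <->
       ((complex.Re (li_coeff F 2))%:E =
        64%:E * \int[lebesgue_measure]_(x in `[0%R, +oo[)
                  ((x * (4 * x ^+ 2 - 1) / (4 * x ^+ 2 + 1) ^+ 3)%R%:E
                     * zero_count F x))%E)
    /\
    (GRH F <->
       (complex.Re (li_coeff F 2))%:E =
         sum_zeros_im F (fun g =>
           1 - chebyshev_T2 ((4 * g ^+ 2 - 1) / (4 * g ^+ 2 + 1))) /\
       sum_zeros_im F (fun g =>
           1 - chebyshev_T2 ((4 * g ^+ 2 - 1) / (4 * g ^+ 2 + 1))) =
         sum_zeros_im F (fun g => 32 * g ^+ 2 / (4 * g ^+ 2 + 1) ^+ 2))).
Proof.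
split=> F zf.
  (* The two expressions for the summand agree pointwise, so the second equation of the chain holds
     automatically. *)
  have E : (fun g : R => 1 - (4 * g ^+ 2 - 1) / (4 * g ^+ 2 + 1)) =
      (fun g => 2 / (4 * g ^+ 2 + 1)).
    by apply/funext => g; field; have := sqr_ge0 g; lra.
  rewrite E integral_count1; split; first exact: GRH_li1.
  by rewrite (GRH_li1 zf); split=> [|[]].
have E : (fun g : R => 1 - chebyshev_T2 ((4 * g ^+ 2 - 1) / (4 * g ^+ 2 + 1))) =
    (fun g => 32 * g ^+ 2 / (4 * g ^+ 2 + 1) ^+ 2).
  by apply/funext => g; rewrite /chebyshev_T2; field; have := sqr_ge0 g; lra.
rewrite E integral_count2; split; first exact: GRH_li2.
by rewrite (GRH_li2 zf); split=> [|[]].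
Qed.
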